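(* For every constant $\epsilon>0$ there exists an online (possibly randomized) algorithm for the submodular matroid secretary problem with shortlists which, on every instance with $n$ items, a matroid $\mathcal{M}$ of rank $k$, and a monotone submodular function $f$, achieves a competitive ratio of $$\frac{1}{2}\left(1-\frac{1}{e^2}-\epsilon-O\!\left(\frac1k\right)\right)$$ using a shortlist of size at most $\eta_\epsilon(k)=O(k)$, where more precisely $\eta_\epsilon(k)=O\!\left(2^{\mathrm{poly}(1/\epsilon)}\,k\right)$. The running time of this online algorithm is $O(nk)$.
   Context: Submodular matroid secretary problem with shortlists. An instance consists of a finite set $\mathcal{U}=\{a_1,\dots,a_n\}$ of items, a matroid $\mathcal{M}=(\mathcal{U},\mathcal{I})$ with $rk(\mathcal{M})=k$ ($\mathcal{I}$ is the family of independent sets), and a monotone submodular function $f:2^{\mathcal{U}}\to\mathbb{R}_{\ge 0}$. The items arrive one at a time in uniformly random order over $n$ rounds. The set $\mathcal{U}$ is fixed in advance but unknown to the algorithm; $n$ and $k$ are known. The algorithm has value oracle access to $f$ and independence oracle access to $\mathcal{M}$ (on sets of items that have already arrived). In each round the algorithm must irrevocably decide whether or not to add the arriving item to a shortlist $A$. The value of the algorithm is $$\mathrm{ALG}=\mathbb{E}\Big[\max_{S\subseteq A,\ S\in\mathcal{I}} f(S)\Big],$$ the expectation being over the arrival order and the internal randomness of the algorithm, and the offline optimum is $\mathrm{OPT}=\max_{S\subseteq\mathcal{U},\ S\in\mathcal{I}} f(S)$. The algorithm achieves competitive ratio $c$ using a shortlist of size $\eta(k)$ if at the end of the $n$ rounds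 $|A|\le\eta(k)$ and $\mathrm{ALG}\ge c\cdot\mathrm{OPT}$. $O(\cdot)$ is asymptotic in $n$ and $k$, with $\epsilon$ a constant: the constants hidden in $O(1/k)$, $O(k)$ and $O(nk)$ may depend on $\epsilon$ but not on the instance; in $O(2^{\mathrm{poly}(1/\epsilon)}k)$ the dependence on $\epsilon$ is explicit, $\mathrm{poly}$ being some fixed polynomial. For the running time, each oracle query counts as one step. *)

(* Defs.v *)
From HB Require Import structures.
From mathcomp Require Import all_boot all_order all_fingroup all_algebra.
From mathcomp Require Import reals.

Set Implicit Arguments.
Unset Strict Implicit.
Unset Printing Implicit Defensive.

Import Order.TTheory GRing.Theory Num.Theory.

Local Open Scope ring_scope.

Section Matroid.
Variable T : finType.

Definition is_matroid (I : {set {set T}}) : Prop :=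
  [/\ set0 \in I,
      (forall A B : {set T}, A \subset B -> B \in I -> A \in I)
    & (forall A B : {set T}, A \in I -> B \in I -> (#|A| < #|B|)%N ->
         exists2 x, x \in B :\: A & x |: A \in I)].

Definition rk (I : {set {set T}}) : nat := (\max_(S in I) #|S|)%N.

Variable R : realType.

Definition nonnegative (f : {set T} -> R) : Prop := forall A, 0 <= f A.

Definition monotone (f : {set T} -> R) : Prop :=
  forall A B : {set T}, A \subset B -> f A <= f B.

Definition submodular (f : {set T} -> R) : Prop :=
  forall A B : {set T}, f (A :|: B) + f (A :&: B) <= f A + f B.

(* The neutral element 0 is harmless: f is nonnegative and set0 is
   independent. *)
Definition best (I : {set {set T}}) (f : {set T} -> R) (A : {set T}) : R :=
  \big[Num.max/0]_(S in I | S \subset A) f S.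

Definition opt (I : {set {set T}}) (f : {set T} -> R) : R := best I f [set: T].

End Matroid.

(* Algorithms are programs of a unit-cost random access machine with scalar
   variables and arrays holding natural numbers, and scalar variables and
   arrays holding real numbers (obtained from the value oracle by additions
   and subtractions).  Variables and arrays are named by numbers, so that a
   program mentions finitely many of them.  An item is known to the program
   only by its arrival time 0, 1, 2, ...  An oracle is queried on the set of
   items whose cell in a given array is nonzero. *)
Inductive instr : Type :=
  | NConst (x c : nat)
  | NAdd (x y z : nat)
  | NSub (x y z : nat)
  | NLoad (x a y : nat)
  | NStore (a x y : nat)
  | RAdd (x y z : nat)
  | RSub (x y z : nat)
  | RLoad (x a y : nat)   (* x and a are real, the index y is natural *)
  | RStore (a x y : nat)  (* a and y are real, the index x is natural *)
  | Value (x a : nat)     (* value oracle; x is real, a is natural *)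
  | Indep (x a : nat).    (* independence oracle; x and a are natural *)

Inductive test : Type :=
  | NLe (x y : nat)
  | RLe (x y : nat).

(* Rand x y draws x uniformly in {0, ..., y - 1} (x := 0 if y = 0).  Decide x
   shortlists the current item iff x is nonzero, and the next item arrives. *)
Inductive cmd : Type :=
  | Skip
  | Do (i : instr)
  | Rand (x y : nat)
  | Decide (x : nat)
  | Seq (c d : cmd)
  | If (b : test) (c d : cmd)
  | While (b : test) (c : cmd).

Definition upd (A : Type) (g : nat -> A) (x : nat) (v : A) : nat -> A :=
  fun y => if y == x then v else g y.

Section Machine.
Variable R : realType.

Record memory := Memory {
  nvar : nat -> nat;
  narr : nat -> nat -> nat;
  rvar : nat -> R;
  rarr : nat -> nat -> R }.

Definition set_nvar (m : memory) (x v : nat) : memory :=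
  Memory (upd (nvar m) x v) (narr m) (rvar m) (rarr m).

Definition set_narr (m : memory) (a i v : nat) : memory :=
  Memory (nvar m) (upd (narr m) a (upd (narr m a) i v)) (rvar m) (rarr m).

Definition set_rvar (m : memory) (x : nat) (v : R) : memory :=
  Memory (nvar m) (narr m) (upd (rvar m) x v) (rarr m).

Definition set_rarr (m : memory) (a i : nat) (v : R) : memory :=
  Memory (nvar m) (narr m) (rvar m) (upd (rarr m) a (upd (rarr m a) i v)).

Definition eval_test (b : test) (m : memory) : bool :=
  match b with
  | NLe x y => (nvar m x <= nvar m y)%N
  | RLe x y => rvar m x <= rvar m y
  end.

Variables (n : nat) (I : {set {set 'I_n}}) (f : {set 'I_n} -> R).
(* The item arriving at time j is s j. *)
Variable s : 'S_n.

(* Only the items that have arrived by time t (the current item included)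
   can be queried. *)
Definition queried (t : nat) (g : nat -> nat) : {set 'I_n} :=
  [set s j | j : 'I_n & (j <= t)%N && (g j != 0%N)].

Definition exec (t : nat) (i : instr) (m : memory) : memory :=
  match i with
  | NConst x c => set_nvar m x c
  | NAdd x y z => set_nvar m x (nvar m y + nvar m z)%N
  | NSub x y z => set_nvar m x (nvar m y - nvar m z)%N
  | NLoad x a y => set_nvar m x (narr m a (nvar m y))
  | NStore a x y => set_narr m a (nvar m x) (nvar m y)
  | RAdd x y z => set_rvar m x (rvar m y + rvar m z)
  | RSub x y z => set_rvar m x (rvar m y - rvar m z)
  | RLoad x a y => set_rvar m x (rarr m a (nvar m y))
  | RStore a x y => set_rarr m a (nvar m x) (rvar m y)
  | Value x a => set_rvar m x (f (queried t (narr m a)))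
  | Indep x a => set_nvar m x (queried t (narr m a) \in I)
  end.

Record config := Config {
  todo : seq cmd;
  clock : nat;  (* arrival time of the current item *)
  state : memory;
  shortlist : {set 'I_n} }.

Definition halted (c : config) : bool := nilp (todo c).

(* The equally likely successors of a configuration; a halted configuration
   stays put.  A Decide after the last item has no effect on the shortlist,
   and items left undecided are not shortlisted. *)
Definition step (c : config) : seq config :=
  let: Config k t m A := c in
  match k with
  | [::] => [:: c]
  | Skip :: k => [:: Config k t m A]
  | Do i :: k => [:: Config k t (exec t i m) A]
  | Rand x y :: k =>
      [seq Config k t (set_nvar m x v) A | v <- iota 0 (maxn 1 (nvar m y))]
  | Decide x :: k =>
      let B := if nvar m x == 0%N then A
               else A :|: [set s j | j : 'I_n & j == t :> nat] in
      [:: Config k t.+1 m B]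
  | Seq d e :: k => [:: Config [:: d, e & k] t m A]
  | If b d e :: k => [:: Config ((if eval_test b m then d else e) :: k) t m A]
  | While b d :: k =>
      [:: Config (if eval_test b m then [:: d, While b d & k] else k) t m A]
  end.

(* The distribution of the configuration after N steps, as a list of pairs
   (probability, configuration), possibly with repeated configurations. *)
Fixpoint outcomes (N : nat) (c : config) : seq (R * config) :=
  if N is N'.+1 then
    [seq (o.1 / (size (step c))%:R, o.2) | c' <- step c, o <- outcomes N' c']
  else [:: (1, c)].

(* The number of items and the rank are given in the natural variables 0
   and 1; everything else is initially 0. *)
Definition start (alg : cmd) : config :=
  Config [:: alg] 0
    (Memory (upd (upd (fun=> 0%N) 0 n) 1 (rk I))
            (fun _ _ => 0%N) (fun=> 0) (fun _ _ => 0))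
    set0.

End Machine.

Section Performance.
Variables (R : realType) (n : nat) (I : {set {set 'I_n}}) (f : {set 'I_n} -> R).
Variable alg : cmd.

(* Worst case over the arrival order and the internal randomness. *)
Definition runs_within (N : nat) : Prop :=
  forall s : 'S_n,
    all (fun o => halted o.2) (outcomes I f s N (start R I alg)).

Definition shortlist_within (N q : nat) : Prop :=
  forall s : 'S_n,
    all (fun o => #|shortlist o.2| <= q)%N (outcomes I f s N (start R I alg)).

(* Expected value of the shortlist after N steps, for a uniformly random
   arrival order. *)
Definition alg_value (N : nat) : R :=
  (\sum_(s : 'S_n) \sum_(o <- outcomes I f s N (start R I alg))
     o.1 * best I f (shortlist o.2)) / (n`!)%:R.

(* The algorithm halts within N steps and then has achieved competitive ratio
   c with a shortlist of size at most q. *)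
Definition achieves (N : nat) (c : R) (q : nat) : Prop :=
  [/\ runs_within N, shortlist_within N q & c * opt I f <= alg_value N].

End Performance.

(* Main.v *)
(* Every item is assigned to one of m = (d^2 + d) k slots and to one of d
   sub-bins of its slot, uniformly and independently: cutting the random arrival
   sequence into consecutive blocks of multinomial sizes has this effect.  The
   algorithm keeps an independent set S in k cells.  In each slot it replaces the
   contents of one cell by the best candidate, if this increases f(S); the
   candidates are the items of the slot and one earlier winner, drawn at random.
   An item that has not won yet is uniform among the slots from the current one
   on, given the history, since moving it there from an earlier slot would not
   have changed the history.  So each member of a fixed optimal basis is offered
   with probability at least 1/m per slot, collisions cost a factor 1 - 1/d in the
   first d^2 k slots, and the basis exchange bijection gives
   E f(S') - E f(S) >= (1 - 1/d)/m (OPT - 2 E f(S)),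
   whence E f(S) >= (1 - e^(-2 + 4/(d+1))) OPT / 2 at the end.
   The shortlist receives the successive records of each slot outside its first
   sub-bin, which only serves as a sample.  S itself may use sample items: moving
   such a winner to another sub-bin changes nothing else, so only a fraction 1/d
   of f(S) is lost by intersecting with the shortlist.  Likewise, moving a record
   that did not win to the sample makes it the best item of the sample and changes
   nothing else; hence there are at most d + 1 records per slot on average, even
   when weighted by f(S), and by Markov's inequality truncating the shortlist at
   m (d + 1) d items costs another fraction 1/d. *)

(* All randomness is encoded by finite functions (slot and sub-bin of each item, recycled slot of
   each slot), and an expectation is a sum over them. Each probabilistic claim then has two halves:
   overwriting one coordinate of a uniform function keeps it uniform, and the deterministic run does
   not notice the overwriting. This needs an order inside the bins that does not depend on the bins.
   The program draws a bin for each label [j] and cuts the arrival sequence accordingly; sorting the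
   labels by bin is a permutation, and its composite with the uniform arrival order is again
   uniform. So the order [p] can be fixed first and the bins drawn afterwards. Recycling is needed
   because an item that has won is no longer uniform over the remaining slots and may have been
   evicted from S since. The recycled slot is drawn among all m slots, future ones being empty, so a
   past winner returns with probability exactly 1/m. Ties are the other obstacle: a sample winner
   must still win after its move to any sub-bin, hence a main item beats a sample item of equal
   value. *)
Require Import Defs.
From mathcomp Require Import all_boot all_order all_fingroup all_algebra.
From mathcomp Require Import reals sequences exp.
From mathcomp Require Import zify ring lra.

Set Implicit Arguments.
Unset Strict Implicit.
Unset Printing Implicit Defensive.

Import Order.TTheory GRing.Theory Num.Theory.

Local Open Scope ring_scope.

(** * Matroids and submodular functions *)

Section Matroids.
Variables (T : finType) (I : {set {set T}}).
Hypothesis matI : is_matroid I.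

Lemma indep0 : set0 \in I. Proof. by case: matI. Qed.

Lemma indepS (A B : {set T}) : A \subset B -> B \in I -> A \in I.
Proof. by case: matI => _ H _; exact: H. Qed.

Lemma indep_extend (A B : {set T}) : A \in I -> B \in I -> (#|A| <= #|B|)%N ->
  exists X : {set T}, [/\ X \in I, A \subset X, X \subset A :|: B & #|X| = #|B|].
Proof.
move=> + BI; move en: (#|B| - #|A|)%N => e.
elim: e A en => [|e IH] A en AI leAB.
  by exists A; split=> //; [exact: subsetUl | lia].
have [_ _ exI] := matI.
have [|x /setDP[xB xA] xI] := exI _ _ AI BI; first by lia.
have cx : #|x |: A| = #|A|.+1 by rewrite cardsU1 xA.
have [||X [XI sX sX' cX]] := IH (x |: A) _ xI; rewrite ?cx; [lia|lia|].
exists X; split=> //; first exact: subset_trans (subsetUr _ _) sX.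
apply: subset_trans sX' _; rewrite subUset subsetUr andbT subUset subsetUl andbT.
by rewrite sub1set inE xB orbT.
Qed.

Lemma card_indep (A : {set T}) : A \in I -> (#|A| <= rk I)%N.
Proof. by move=> AI; rewrite /rk (bigD1 A) //= leq_maxl. Qed.

Lemma basis_extend (A : {set T}) : A \in I ->
  exists X : {set T}, [/\ X \in I, A \subset X & #|X| = rk I].
Proof.
move=> AI; have [|B BI eB] := @eq_bigmax_cond _ (mem I) (fun S : {set T} => #|S|).
  by apply/card_gt0P; exists A.
have eB' : #|B| = rk I by rewrite /rk -eB.
have [|X [XI sX _ cX]] := indep_extend AI BI; first by rewrite eB' card_indep.
by exists X; rewrite -eB' -cX.
Qed.

(** Symmetric exchange without circuits: [C] plays the part of the fundamental circuit of [a] in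
    [B], with [a] removed. Adding [a] to [C] gives a dependent set, so extending [C] by elements of
    [A] to a basis leaves [a] out; augmenting [A :\ a] from that basis must then use an element of
    [C]. *)
Lemma basis_exchange (A B : {set T}) (a : T) :
  A \in I -> B \in I -> #|A| = rk I -> #|B| = rk I -> a \in A :\: B ->
  exists2 b, b \in B :\: A & (a |: B :\ b \in I) && (b |: A :\ a \in I).
Proof.
move=> AI BI cA cB /setDP[aA aB].
pose C := [set b in B | a |: B :\ b \in I].
have CB : C \subset B by apply/subsetP => b; rewrite inE => /andP[].
have CI : C \in I by exact: indepS BI.
have aCI : a |: C \notin I.
  apply/negP => aCI.
  have [|Y [YI sY sY' cY]] := indep_extend aCI BI; first by rewrite cB card_indep.
  have aY : a \in Y by apply: (subsetP sY); rewrite setU11.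
  have sYB : Y \subset a |: B.
    by apply: subset_trans sY' _; rewrite subUset subsetUr andbT setUS.
  have /subsetPn[b baB bY] : ~~ (a |: B \subset Y).
    by apply: contraTN isT => /subset_leq_card; rewrite cY cardsU1 aB add1n ltnn.
  have ba : b != a by apply: contraNneq bY => ->.
  have bB : b \in B by move: baB; rewrite !inE (negPf ba).
  have eY : Y = a |: B :\ b.
    apply/eqP; rewrite eqEcard; apply/andP; split.
      apply/subsetP => x xY; have := subsetP sYB _ xY.
      rewrite !inE => /orP[->//|->]; rewrite andbT.
      by apply/orP; right; apply: contraNneq bY => <-.
    by rewrite cY cardsU1 !inE (negPf aB) andbF /= (cardsD1 b B) bB.
  by move/negP: bY; apply; apply: (subsetP sY); rewrite !inE bB -eY YI orbT.
have [|X [XI sX sX' cX]] := indep_extend CI AI; first by rewrite cA card_indep.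
have aX : a \notin X.
  by apply: contra aCI => aX; apply: indepS XI; rewrite subUset sub1set aX.
have [_ _ exI] := matI.
have AaI : A :\ a \in I by apply: indepS AI; exact: subsetDl.
have [|b /setDP[bX bA] bAI] := exI _ _ AaI XI.
  by rewrite cX (cardsD1 a A) aA.
have ba : b != a by apply: contraNneq aX => <-.
have bA' : b \notin A by move: bA; rewrite !inE ba.
have bC : b \in C.
  by have := subsetP sX' _ bX; rewrite inE (negPf bA') orbF.
by exists b; rewrite ?bAI ?inE ?bA' ?(subsetP CB) //; move: bC; rewrite inE => /andP[_ ->].
Qed.

(** Induction on the size of [A :\: B] with [B] fixed. Symmetric exchange replaces [a] by some [b]
    in [A], which brings [A] closer to [B]; the map obtained for the new basis fixes [b] and takes
    that value nowhere else, so [a] can be sent to [b]. *)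
Lemma basis_bijection (A B : {set T}) :
  A \in I -> B \in I -> #|A| = rk I -> #|B| = rk I ->
  exists g : T -> T, [/\ {in A &, injective g}, {in A :&: B, g =1 id} &
    forall a, a \in A -> g a \in B /\ a |: B :\ g a \in I].
Proof.
move=> + BI + cB; move en: #|A :\: B| => e.
elim: e A en => [|e IH] A en AI cA.
  exists id; split=> // a aA.
  have aB : a \in B by move/cards0_eq/eqP: en; rewrite setD_eq0 => /subsetP; apply.
  by rewrite setD1K.
have /set0Pn[a aAB] : A :\: B != set0 by rewrite -cards_eq0 en.
have [aA aB] := setDP aAB.
have [b bBA /andP[aBI bAI]] := basis_exchange AI BI cA cB aAB.
have [bB bA] := setDP bBA.
have eD : (b |: A :\ a) :\: B = (A :\: B) :\ a.
  apply/setP => x; rewrite !inE; case: (eqVneq x b) => [->|_] /=.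
    by rewrite bB /= andbF.
  by case: (x \in B); case: (x == a).
have [||g [ginj gid gP]] := IH (b |: A :\ a) _ bAI.
- by rewrite eD; move: en; rewrite (cardsD1 a) aAB => -[].
- by rewrite cardsU1 !inE (negPf bA) andbF /= -cA (cardsD1 a A) aA.
have bAa x : x \in A -> x != a -> x \in b |: A :\ a.
  by move=> xA xa; rewrite !inE xA xa orbT.
have gb : g b = b by apply: gid; rewrite !inE eqxx bB.
have gNb x : x \in A -> x != a -> g x != b.
  move=> xA xa; apply: contraNneq bA => gxb.
  suff <- : x = b by [].
  by apply: ginj; rewrite ?gxb ?gb ?setU11 ?bAa.
exists (fun x => if x == a then b else g x); split.
- move=> x y xA yA; case: (eqVneq x a) => [->|xa]; case: (eqVneq y a) => [->|ya] //.
  + by move/eqP; rewrite eq_sym (negPf (gNb y yA ya)).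
  + by move/eqP; rewrite (negPf (gNb x xA xa)).
  + by apply: ginj; apply: bAa.
- move=> x /setIP[xA xB]; have xa : x != a by apply: contraNneq aB => <-.
  by rewrite (negPf xa) gid // inE xB bAa.
- move=> x xA; case: (eqVneq x a) => [->//|xa].
  by apply: gP; apply: bAa.
Qed.
End Matroids.

(** * Exchange inequality for monotone submodular functions *)

Section Submodular.
Variables (R : realType) (T : finType) (f : {set T} -> R).
Hypotheses (f_ge0 : nonnegative f) (f_mono : monotone f) (f_sub : submodular f).

Lemma sum_marginals_ge (S A : {set T}) :
  f (S :|: A) - f S <= \sum_(e in A) (f (e |: S) - f S).
Proof.
move en : #|A| => n; elim: n A en => [|n IH] A en.
  by move/cards0_eq: en => ->; rewrite setU0 subrr big_set0.
have /set0Pn[a aA] : A != set0 by rewrite -cards_eq0 en.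
rewrite (bigD1 a) //= (eq_bigl (mem (A :\ a))); last first.
  by move=> x; rewrite !inE andbC.
move: (IH (A :\ a)); rewrite (cardsD1 a) aA add1n in en; case: en => en /(_ en).
have := f_sub (a |: S) (S :|: (A :\ a)).
have -> : (a |: S) :|: (S :|: (A :\ a)) = S :|: A.
  apply/setP => x; rewrite !inE; case: (eqVneq x a) => [->|_] //=.
    by rewrite aA !orbT.
  by rewrite orbA orbb.
have : f S <= f ((a |: S) :&: (S :|: (A :\ a))).
  by apply: f_mono; rewrite subsetI subsetUr subsetUl.
lra.
Qed.

Lemma sum_losses_le (S A : {set T}) :
  \sum_(b in A) (f S - f (S :\ b)) <= f S - f (S :\: A).
Proof.
move en : #|A| => n; elim: n A en => [|n IH] A en.
  by move/cards0_eq: en => ->; rewrite setD0 subrr big_set0.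
have /set0Pn[a aA] : A != set0 by rewrite -cards_eq0 en.
rewrite (bigD1 a) //= (eq_bigl (mem (A :\ a))); last first.
  by move=> x; rewrite !inE andbC.
move: (IH (A :\ a)); rewrite (cardsD1 a) aA add1n in en; case: en => en /(_ en).
have := f_sub (S :\ a) (S :\: (A :\ a)).
have -> : (S :\ a) :&: (S :\: (A :\ a)) = S :\: A.
  apply/setP => x; rewrite !inE; case: (eqVneq x a) => [->|_] //=.
    by rewrite aA.
  by case: (x \in A); case: (x \in S).
case: (boolP (a \in S)) => aS.
  have -> : (S :\ a) :|: (S :\: (A :\ a)) = S.
    apply/setP => x; rewrite !inE; case: (eqVneq x a) => [->|_] //=.
    by case: (x \in A); case: (x \in S).
  lra.
have -> : S :\ a = S by apply/setDidPl; rewrite disjoint_sym disjoints1.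
have : f (S :\: (A :\ a)) <= f (S :|: (S :\: (A :\ a))) by apply: f_mono; exact: subsetUr.
have : f (S :\: A) <= f (S :\: (A :\ a)) by apply: f_mono; apply: setDS; exact: subsetDl.
have : f (S :|: (S :\: (A :\ a))) <= f S by apply: f_mono; rewrite subUset subxx subsetDl.
lra.
Qed.

(** Extend [S] to a basis and pair [A] with it. Swapping [e] for its partner gains at least the
    marginal of [e] minus the loss of the partner; the marginals sum to at least [f A - f S] and the
    losses to at most [f S]. A partner outside [S] makes the swap a plain insertion, which requires
    [S] not to be a basis. *)
Lemma sum_swap_gains (I : {set {set T}}) (S A : {set T}) (v : T -> R) :
  is_matroid I -> S \in I -> A \in I -> #|A| = rk I ->
  (forall e b, e |: S :\ b \in I -> (b \in S) || (#|S| < rk I)%N ->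
     f (e |: S :\ b) <= v e) ->
  f A - 2 * f S <= \sum_(e in A) (v e - f S).
Proof.
move=> matI SI AI cA vP.
have [B [BI sSB cB]] := basis_extend matI SI.
have [g [ginj gid gP]] := basis_bijection matI AI BI cA cB.
have swap e : e \in A ->
    (f (e |: S) - f S) - (f S - f (S :\ g e)) <= v e - f S.
  move=> eA; have [gB gI] := gP e eA.
  have : f (e |: S :\ g e) <= v e.
    apply: vP; first by apply: indepS gI => //; apply: setUS; exact: setSD.
    case: (boolP (g e \in S)) => //= geS; rewrite -cB.
    by apply: proper_card; apply/properP; split=> //; exists (g e).
  have := f_sub (e |: S :\ g e) S.
  have : f (e |: S) <= f ((e |: S :\ g e) :|: S).
    by apply: f_mono; rewrite -setUA setUS ?subsetUr.
  have : f (S :\ g e) <= f ((e |: S :\ g e) :&: S).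
    by apply: f_mono; rewrite subsetI subsetUr subsetDl.
  lra.
apply: le_trans (ler_sum _ swap); rewrite sumrB.
have h1 := sum_marginals_ge S A.
have : \sum_(e in A) (f S - f (S :\ g e)) <= f S.
  rewrite -(big_imset (fun b => f S - f (S :\ b)) ginj) /=.
  apply: le_trans (sum_losses_le _ _) _.
  by have := f_ge0 (S :\: g @: A); lra.
have : f A <= f (S :|: A) by apply: f_mono; exact: subsetUr.
lra.
Qed.

End Submodular.

(** * Splitting the value of a set among its items *)

Section Marginals.
Variables (R : realType) (n : nat) (f : {set 'I_n} -> R).
Hypotheses (f_ge0 : nonnegative f) (f_mono : monotone f) (f_sub : submodular f).

Definition prefix (S : {set 'I_n}) (j : nat) : {set 'I_n} := [set x in S | (x < j)%N].

(** The share of [x] when the items of [S] are added by increasing index. Shares allow the loss of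
    the sample items to be averaged item by item. *)
Definition marginal (S : {set 'I_n}) (x : 'I_n) : R :=
  f (prefix S x.+1) - f (prefix S x).

Lemma marginal_ge0 (S : {set 'I_n}) x : 0 <= marginal S x.
Proof.
rewrite subr_ge0; apply: f_mono; apply/subsetP => y; rewrite !inE => /andP[-> /=].
exact: ltnW.
Qed.

Lemma marginal_notin (S : {set 'I_n}) x : x \notin S -> marginal S x = 0.
Proof.
move=> xS; apply/eqP; rewrite subr_eq0; apply/eqP; congr f; apply/setP => y.
rewrite !inE ltnS [(y <= x)%N]leq_eqVlt val_eqE.
by case: (eqVneq y x) => [->|//]; rewrite (negPf xS).
Qed.

Lemma sum_marginals (S : {set 'I_n}) : \sum_x marginal S x = f S - f set0.
Proof.
rewrite -(big_mkord xpredT (fun x => f (prefix S x.+1) - f (prefix S x))).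
rewrite telescope_sumr //; congr (f _ - f _); apply/setP => y; rewrite !inE.
  by rewrite ltn_ord andbT.
by rewrite ltn0 andbF.
Qed.

(** By submodularity the share of an item of [A] can only grow when the items outside [A] are
    deleted, so at most the shares of the deleted items are lost. *)
Lemma loss_le_marginals (S A : {set 'I_n}) :
  f S - f (S :&: A) <= \sum_(x | x \notin A) marginal S x.
Proof.
have : \sum_(x in A) marginal S x <= \sum_x marginal (S :&: A) x.
  rewrite big_mkcond; apply: ler_sum => x _; case: ifP => xA; last exact: marginal_ge0.
  have := f_sub (prefix (S :&: A) x.+1) (prefix S x).
  have -> : prefix (S :&: A) x.+1 :&: prefix S x = prefix (S :&: A) x.
    apply/setP => y; rewrite !inE; case: (ltnP y x) => yx; last by rewrite !andbF.
    by rewrite ltnS (ltnW yx) !andbT andbAC andbb.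
  have : f (prefix S x.+1) <= f (prefix (S :&: A) x.+1 :|: prefix S x).
    apply: f_mono; apply/subsetP => y; rewrite !inE ltnS leq_eqVlt val_eqE.
    by case: (eqVneq y x) => [->|_ /andP[-> /= ->]]; rewrite ?xA ?orbT ?andbT // => ->.
  rewrite /marginal; lra.
rewrite sum_marginals; have := sum_marginals S; rewrite (bigID (mem A)) /=; lra.
Qed.

End Marginals.

(** * The selection rule within a slot *)

Lemma count_lt (T : eqType) (a b : pred T) (s : seq T) (x : T) :
  subpred a b -> x \in s -> b x -> ~~ a x -> (count a s < count b s)%N.
Proof.
move=> ab + bx /negPf ax; elim: s => [//|y s IH]; rewrite in_cons => /orP[/eqP <-|/IH] /=.
  by rewrite ax bx add0n add1n ltnS; exact: sub_count.
by have : (a y <= b y)%N; [case E: (a y) => //; rewrite (ab _ E) | lia].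
Qed.

Section FirstMax.
Variables (R : realType) (T : eqType) (g : T -> R) (theta : R).

Definition is_max (l : seq T) (x : T) : bool :=
  (theta < g x) && all (fun y => g y <= g x) l.

Definition maxes (l : seq T) : seq T := [seq x <- l | is_max l x].

(** The outcome of a pass over the list, described without intermediate states, so that the outcomes
    on two different lists can be compared. *)
Definition first_max (l : seq T) : option T := ohead (maxes l).

Definition top_value (o : option T) : R := if o is Some x then g x else theta.

Lemma maxes_nil l : maxes l = [::] -> all (fun x => g x <= theta) l.
Proof.
case: l => [//|x0 l0]; set l := x0 :: l0 => e.
have [w wl wmax] : exists2 w, w \in l & all (fun y => g y <= g w) l.
  rewrite /l; elim: l0 x0 {l e} => [|y s IH] x; first by exists x; rewrite ?mem_head //= lexx.
  have [w ws wm] := IH y; case: (leP (g x) (g w)) => h.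
    by exists w; rewrite 1?in_cons ?ws ?orbT //; apply/andP.
  exists x; rewrite ?mem_head //=; rewrite lexx /=.
  by apply: sub_all wm => z /le_trans; apply; exact: ltW.
apply/allP => y yl; rewrite leNgt; apply/negP => ty.
suff : w \in maxes l by rewrite e.
by rewrite mem_filter /is_max wl wmax !andbT (lt_le_trans ty) // (allP wmax).
Qed.

Lemma first_max_none l : first_max l = None -> all (fun x => g x <= theta) l.
Proof. by rewrite /first_max; case e: (maxes l) => // _; exact: maxes_nil. Qed.

Lemma first_max_some l x : first_max l = Some x ->
  [/\ x \in l, theta < g x & {in l, forall y, g y <= g x}].
Proof.
rewrite /first_max; case e: (maxes l) => [//|z s] [<-].
have : z \in maxes l by rewrite e mem_head.
by rewrite mem_filter => /andP[/andP[-> /allP h] ->].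
Qed.

Lemma le_top_value l : {in l, forall y, g y <= top_value (first_max l)}.
Proof.
case e: (first_max l) => [w|] y yl; first by have [_ _] := first_max_some e; apply.
by move/first_max_none: e => /allP; apply.
Qed.

Lemma theta_le_top_value l : theta <= top_value (first_max l).
Proof. by case e: (first_max l) => [w|] //=; have [_ /ltW] := first_max_some e. Qed.

Lemma top_value_is_max l x : is_max l x -> x \in l -> top_value (first_max l) = g x.
Proof.
case/andP => tx /allP h xl; apply/eqP; rewrite eq_le le_top_value // andbT.
case e: (first_max l) => [w|] /=; last exact: ltW.
by have [wl _ _] := first_max_some e; exact: h.
Qed.

(** The source of the history arguments: two lists that differ only in the place of an item winning
    in neither have the same winner. *)
Lemma first_max_rem e l : first_max l != Some e ->
  first_max [seq x <- l | x != e] = first_max l.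
Proof.
move=> ne; case E: (first_max l) => [w|]; last first.
  rewrite /first_max; case E': (maxes _) => [//|z s].
  have : z \in maxes [seq x <- l | x != e] by rewrite E' mem_head.
  rewrite !mem_filter => /andP[/andP[h _] /andP[_ zl]].
  by move/first_max_none: E => /allP/(_ z zl); rewrite leNgt h.
have we : w != e by apply: contraNneq ne => <-; rewrite E.
have [wl tw wm] := first_max_some E.
have -> : first_max [seq x <- l | x != e] = ohead [seq x <- maxes l | x != e].
  rewrite /first_max /maxes -!filter_predI; congr ohead; apply: eq_in_filter => x xl /=.
  rewrite andbC; case: (eqVneq x e) => //= xe; congr (_ && _).
  apply/allP/allP => h y.
    move=> yl; apply: (le_trans (wm y yl)); apply: h; by rewrite mem_filter we.
  by rewrite mem_filter => /andP[_]; exact: h.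
by move: E; rewrite /first_max; case: (maxes l) => // z s [->] /=; rewrite we.
Qed.

Lemma first_max_cat l1 l2 x :
  theta < g x -> {in l1, forall y, g y < g x} -> {in l2, forall y, g y <= g x} ->
  first_max (l1 ++ x :: l2) = Some x.
Proof.
move=> tx h1 h2; rewrite /first_max /maxes filter_cat /=.
have -> : is_max (l1 ++ x :: l2) x.
  by rewrite /is_max tx all_cat /= lexx /=; apply/andP; split; apply/allP => y /=; [move/h1/ltW | move/h2].
case E: [seq _ <- l1 | _] => [//|z s].
have : z \in z :: s by rewrite mem_head.
rewrite -E mem_filter => /andP[/andP[_ /allP h] /h1].
have : x \in l1 ++ x :: l2 by rewrite mem_cat mem_head orbT.
by move/h => gzx; rewrite ltNge gzx.
Qed.

(** The last hypothesis prevents [x] from becoming the first among equals: it is strictly smaller,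
    or nothing exceeds the threshold, or a maximum precedes it. *)
Lemma first_max_insert l1 l2 x :
  g x <= top_value (first_max (l1 ++ l2)) ->
  [|| g x < top_value (first_max (l1 ++ l2)), first_max (l1 ++ l2) == None
    | has (is_max (l1 ++ l2)) l1] ->
  first_max (l1 ++ x :: l2) = first_max (l1 ++ l2).
Proof.
case E: (first_max (l1 ++ l2)) => [w|] /=; last first.
  move=> xt _; move/first_max_none: E; rewrite all_cat => /andP[/allP h1 /allP h2].
  rewrite /first_max; case E': (maxes _) => [//|z s].
  have : z \in maxes (l1 ++ x :: l2) by rewrite E' mem_head.
  rewrite mem_filter mem_cat in_cons => /andP[/andP[tz _]] /or3P[/h1|/eqP zx|/h2].
  - by rewrite leNgt tz.
  - by move: xt; rewrite leNgt -zx tz.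
  - by rewrite leNgt tz.
move=> xw hx; have [_ tw _] := first_max_some E.
have eqm z : z \in l1 ++ l2 -> is_max (l1 ++ x :: l2) z = is_max (l1 ++ l2) z.
  move=> zl; rewrite /is_max !all_cat /=; case: (ltP theta (g z)) => //= tz.
  case: (boolP (all _ l1 && all _ l2)) => [al|/negPf al]; last by rewrite andbCA al andbF.
  have : is_max (l1 ++ l2) z by rewrite /is_max tz all_cat.
  move/top_value_is_max/(_ zl); rewrite E /= => gz.
  by move/andP: al => [-> ->]; rewrite -gz xw.
move: E hx; rewrite /first_max /maxes !filter_cat /= => E.
rewrite (eq_in_filter (a2 := is_max (l1 ++ l2))); last first.
  by move=> z zl; apply: eqm; rewrite mem_cat zl.
rewrite (eq_in_filter (a2 := is_max (l1 ++ l2)) (s := l2)); last first.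
  by move=> z zl; apply: eqm; rewrite mem_cat zl orbT.
case: ltP => /= [gx|_].
  have -> : is_max (l1 ++ x :: l2) x = false.
    apply/negP => /andP[_ /allP/(_ w)]; rewrite leNgt gx => /(_ _)/negP[] //.
    have : w \in maxes (l1 ++ l2) by rewrite /maxes filter_cat; case: (_ ++ _) E => //= ? ? [->]; rewrite mem_head.
    by rewrite mem_filter !mem_cat in_cons => /andP[_ /orP[->//|->]]; rewrite !orbT.
  by move=> _; exact: E.
by rewrite has_filter; case: [seq _ <- l1 | _] E.
Qed.

End FirstMax.

(** * Swapping a candidate into a cell, and a slot as a search for a maximum *)

Section Cells.
Variables (R : realType) (n : nat) (I : {set {set 'I_n}}) (f : {set 'I_n} -> R).
Variable k : nat.

Definition contents (L : nat -> option 'I_n) : {set 'I_n} :=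
  [set z | [exists p : 'I_k, L p == Some z]].

(** Cells may be empty, so insertions and exchanges are the same operation. The value 0 rejects
    dependent sets, because only strict improvements over a nonnegative value are retained. *)
Definition swap_value (L : nat -> option 'I_n) (x : option 'I_n) (p : nat) : R :=
  if contents (upd L p x) \in I then f (contents (upd L p x)) else 0.

Definition better_swap L x (vp : R * nat) (p : nat) : R * nat :=
  if vp.1 < swap_value L x p then (swap_value L x p, p) else vp.

Definition best_swap L x : R * nat := foldl (better_swap L x) (0, 0%N) (iota 0 k).

Lemma best_swapP L x : [/\ 0 <= (best_swap L x).1,
  forall p, (p < k)%N -> swap_value L x p <= (best_swap L x).1 &
  0 < (best_swap L x).1 -> ((best_swap L x).2 < k)%N /\
      swap_value L x (best_swap L x).2 = (best_swap L x).1].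
Proof.
rewrite /best_swap; elim: k => [|j IH]; first by split=> //=; rewrite ltxx.
rewrite -(addn1 j) iotaD foldl_cat /= add0n; move: IH; set w := foldl _ _ _; case=> h0 hle hat.
rewrite /better_swap; case: ltP => h /=; split=> //.
- by rewrite (le_trans h0) // ltW.
- move=> p; rewrite addn1 ltnS leq_eqVlt => /orP[/eqP->//|/hle/le_trans]; apply; exact: ltW.
- by rewrite addn1.
- by move=> p; rewrite addn1 ltnS leq_eqVlt => /orP[/eqP->//|/hle].
- by move=> /hat[hlt ->]; rewrite addn1 ltnW.
Qed.

(* [winner] may be a recycled item, [fresh] is the winner if it is an item of the
   slot; [tied] tells that [top] was set by a sample item. *)
Record slot_state := SlotState {
  top : R;
  cell : nat;
  winner : option 'I_n;
  fresh : option 'I_n;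
  tied : bool }.

Definition slot_start (L : nat -> option 'I_n) (x : option 'I_n) : slot_state :=
  if f (contents L) < (best_swap L x).1
  then SlotState (best_swap L x).1 (best_swap L x).2 x None false
  else SlotState (f (contents L)) 0 None None false.

(** Every candidate of a slot is evaluated against the cells [L] at the start of the slot, never
    against a provisional winner. This is what makes the slot a search for a maximum. *)
Definition offer L (main : bool) (sa : slot_state * seq 'I_n) (x : 'I_n) :
    slot_state * seq 'I_n :=
  let v := (best_swap L (Some x)).1 in
  if (top sa.1 < v) || [&& main, tied sa.1 & top sa.1 <= v]
  then (SlotState v (best_swap L (Some x)).2 (Some x) (Some x) (~~ main),
        if main then rcons sa.2 x else sa.2)
  else sa.

Definition gain_value L (x : 'I_n) : R := (best_swap L (Some x)).1.

Definition slot_base L (x : option 'I_n) : R := Num.max (f (contents L)) (best_swap L x).1.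

Lemma top_slot_start L x : top (slot_start L x) = slot_base L x.
Proof. by rewrite /slot_start /slot_base; case: ltP. Qed.

Section Slot.
Variables (L : nat -> option 'I_n) (x0 : option 'I_n) (acc0 : seq 'I_n).
Let g := gain_value L.
Let theta := slot_base L x0.

Definition slot_result (o : option 'I_n) (b : bool) : slot_state :=
  if o is Some w then SlotState (g w) (best_swap L (Some w)).2 o o b
  else slot_start L x0.

Lemma top_slot_result o b : top (slot_result o b) = top_value g theta o.
Proof. by case: o => //=; rewrite top_slot_start. Qed.

Lemma foldl_offer_sample sk :
  foldl (offer L false) (slot_start L x0, acc0) sk =
  (slot_result (first_max g theta sk) (first_max g theta sk != None), acc0).
Proof.
elim/last_ind: sk => [//|sk x IH]; rewrite foldl_rcons IH /offer top_slot_result /= orbF.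
rewrite -cats1; case: ltP => h.
  rewrite first_max_cat //.
  - by apply: le_lt_trans h; exact: theta_le_top_value.
  - by move=> y ysk; apply: le_lt_trans h; exact: le_top_value.
have := @first_max_insert _ _ g theta sk [::] x; rewrite cats0 => -> //.
case E: (first_max g theta sk) h => [w|] h; last by rewrite orbT.
rewrite /=.
apply/orP; right; have [wsk tw wm] := first_max_some E.
by apply/hasP; exists w => //; rewrite /is_max tw; apply/allP.
Qed.

(* The sample arrives first but is listed last: thanks to [tied], a main item
   wins ties against the sample. *)
Lemma foldl_offer_main sk mn : exists news b,
  let o := first_max g theta (mn ++ sk) in
  let mid := top_value g theta (first_max g theta sk) in
  let B := fun x => (mid < g x) && (g x < top_value g theta o) in
  foldl (offer L true) (slot_result (first_max g theta sk)
                                    (first_max g theta sk != None), acc0) mn =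
    (slot_result o b, acc0 ++ news) /\
  [/\ b = (o != None) && ~~ has (is_max g theta (mn ++ sk)) mn,
      forall w, o = Some w -> b \/ w \in news,
      mid <= top_value g theta o,
      news = [::] \/ (exists2 w, w \in mn & g w = top_value g theta o) &
      (size news <= 1 + count B mn + (mid < top_value g theta o)%R)%N].
Proof.
(* The first accepted main item may equal [mid], by the tie rule; from then on accepted values
   increase strictly and the last one is the top. This gives the three summands of the bound on
   [size news]. *)
elim/last_ind: mn => [|mn x [news [b [IH [hb hw hm hn hs]]]]].
  exists [::], (first_max g theta sk != None); split; first by rewrite cats0.
  by split; rewrite ?andbT //=; [move=> w /= ->; left | left].
rewrite foldl_rcons IH /offer /= top_slot_result.
have bE : tied (slot_result (first_max g theta (mn ++ sk)) b) = b.
  rewrite hb; case: (first_max g theta (mn ++ sk)) => //=.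
  by rewrite /slot_start; case: ifP.
rewrite bE {bE}; set o := first_max g theta (mn ++ sk) in hb hw hm hn hs *.
set mid := top_value g theta (first_max g theta sk) in hm hn hs *.
rewrite cat_rcons; case: ifP => [acc|rej].
  have tx : top_value g theta o <= g x by case/orP: acc => [/ltW|/andP[]].
  have mnx : {in mn, forall y, g y < g x}.
    move=> y ymn; have yo : g y <= top_value g theta o.
      by apply: le_top_value; rewrite mem_cat ymn.
    case/orP: acc => [h|/andP[+ h]]; first exact: le_lt_trans h.
    rewrite hb => /andP[oN /hasPn/(_ y ymn) ny]; rewrite lt_neqAle (le_trans yo) // andbT.
    apply: contra ny => /eqP gy; case E: o oN => [w|//] _.
    have [_ tw wm] := first_max_some E; rewrite /is_max gy.
    have gw : g w <= g x by move: tx; rewrite E.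
    by rewrite (lt_le_trans tw) //; apply/allP => z /wm/le_trans; apply.
  have fx : first_max g theta (mn ++ x :: sk) = Some x.
    apply: first_max_cat => //.
    - case/orP: acc => [h|/andP[+ h]]; first by apply: le_lt_trans h; exact: theta_le_top_value.
      rewrite hb => /andP[oN _]; case E: o oN => [w|//] _.
      have [_ tw wm] := first_max_some E; apply: (lt_le_trans tw).
      by move: tx; rewrite E.
    - by move=> y ysk; apply: le_trans tx; apply: le_top_value; rewrite mem_cat ysk orbT.
  rewrite fx; exists (rcons news x), false; split; first by rewrite /= rcons_cat.
  split=> /=.
  - suff -> : has (is_max g theta (mn ++ x :: sk)) (rcons mn x) by [].
    rewrite has_rcons; apply/orP; left; have [_ tx' xm] := first_max_some fx.
    by rewrite /is_max tx'; apply/allP.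
  - by move=> w [<-]; right; rewrite mem_rcons mem_head.
  - exact: le_trans tx.
  - by right; exists x; rewrite ?mem_rcons ?mem_head.
  - rewrite size_rcons -cats1 count_cat /= ltxx andbF !addn0.
    case: hn => [->|[w wmn gw]]; first by [].
    have lt_x : top_value g theta o < g x.
      case/orP: acc => // /andP[+ h]; rewrite hb => /andP[oN nm].
      exfalso; move/hasPn/(_ w wmn)/negP: nm; apply; case E: o oN => [v|//] _.
      have [_ tv vm] := first_max_some E; rewrite /is_max gw E /= tv.
      by apply/allP.
    case: (ltP mid (top_value g theta o)) => hmid.
      rewrite (le_lt_trans hm lt_x) /=.
      suff : (count (fun x => (mid < g x) && (g x < top_value g theta o))%R mn <
              count (fun y => (mid < g y) && (g y < g x))%R mn)%N.
        by move: hs; rewrite hmid /=; lia.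
      apply: (count_lt (x := w)) => //; last by rewrite gw ltxx andbF.
        by move=> y /= /andP[-> /lt_trans]; apply.
      by rewrite gw hmid.
    have -> : (mid < g x) by exact: le_lt_trans lt_x.
    have : (count (fun x => (mid < g x) && (g x < top_value g theta o))%R mn <=
              count (fun y => (mid < g y) && (g y < g x))%R mn)%N.
      by apply: sub_count => y /= /andP[-> /lt_trans]; apply.
    by move: hs; rewrite ltNge hmid /=; lia.
have {}rej : g x <= top_value g theta o /\ ~~ (b && (top_value g theta o <= g x)).
  by move/negbT: rej; rewrite negb_or -leNgt => /andP.
case: rej => gx nb.
have ins : first_max g theta (mn ++ x :: sk) = o.
  apply: first_max_insert => //; rewrite -/o.
  case: (ltP (g x) (top_value g theta o)) => //= gx'.
  by move: nb; rewrite gx' andbT hb negb_and !negbK.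
rewrite ins; exists news, b; split=> //; split=> //.
- rewrite hb; case E: o => [w|//] /=; congr (~~ _); rewrite has_rcons.
  have eqm z : z \in mn -> is_max g theta (mn ++ x :: sk) z = is_max g theta (mn ++ sk) z.
    move=> zl; rewrite /is_max !all_cat /=; case: (ltP theta (g z)) => //= tz.
    case: (boolP (all _ mn && all _ sk)) => [al|/negPf al]; last by rewrite andbCA al andbF.
    have : is_max g theta (mn ++ sk) z by rewrite /is_max tz all_cat.
    have zl' : z \in mn ++ sk by rewrite mem_cat zl.
    move/top_value_is_max/(_ zl'); rewrite -/o => gz.
    by move/andP: al => [-> ->]; rewrite -gz gx.
  rewrite (eq_in_has (a1 := is_max g theta (mn ++ x :: sk)) (a2 := is_max g theta (mn ++ sk))) //.
  case: (boolP (has (is_max g theta (mn ++ sk)) mn)) => hm2; rewrite ?orbT ?orbF //.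
  move: hb; rewrite E hm2 /= => eb; move: nb; rewrite eb /= -ltNge => lx.
  apply/esym/negP => /top_value_is_max; rewrite ins mem_cat mem_head orbT => /(_ isT).
  by move=> ex; move: lx; rewrite ex ltxx.
- by case: hn => [->|[w wmn gw]]; [left | right; exists w; rewrite ?mem_rcons ?in_cons ?wmn ?orbT].
- apply: leq_trans hs _; rewrite leq_add2r leq_add2l -cats1 count_cat leq_addr //.
Qed.
End Slot.
End Cells.

(** * The sequence of slots *)

Section Run.
Variables (R : realType) (n : nat) (I : {set {set 'I_n}}) (f : {set 'I_n} -> R).
Variables (k d : nat).

Definition end_slot (L : nat -> option 'I_n) (st : slot_state R n) : nat -> option 'I_n :=
  if winner st is Some _ then upd L (cell st) (winner st) else L.

Definition run_bins (bl : nat -> seq 'I_n) (i : nat) (L : nat -> option 'I_n)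
    (sa : slot_state R n * seq 'I_n) (cs : seq nat) : slot_state R n * seq 'I_n :=
  foldl (fun sa c => foldl (offer I f k L (0 < c)%N) sa (bl (i * d + c)%N)) sa cs.

Definition run_slot (bl : nat -> seq 'I_n) (r : nat -> nat) (i : nat)
    (X : (nat -> option 'I_n) * (nat -> option 'I_n) * seq 'I_n) :=
  let: (L, W, acc) := X in
  let sa := run_bins bl i L (slot_start I f k L (W (r i)), acc) (iota 0 d) in
  (end_slot L sa.1, upd W i (fresh sa.1), sa.2).

Fixpoint run (bl : nat -> seq 'I_n) (r : nat -> nat) (i : nat) :=
  if i is j.+1 then run_slot bl r j (run bl r j) else (fun=> None, fun=> None, [::]).

Definition cells_at bl r i := (run bl r i).1.1.
Definition wins_at bl r i := (run bl r i).1.2.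
Definition accepted_at bl r i := (run bl r i).2.

Definition sample_part (bl : nat -> seq 'I_n) (i : nat) : seq 'I_n := bl (i * d)%N.
Definition main_part (bl : nat -> seq 'I_n) (i : nat) : seq 'I_n :=
  flatten [seq bl (i * d + c)%N | c <- iota 1 d.-1].
Definition slot_items bl i := main_part bl i ++ sample_part bl i.

Let gain := gain_value I f k.
Let base := slot_base I f k.

Definition slot_pick bl r i : option 'I_n :=
  let L := cells_at bl r i in
  first_max (gain L) (base L (wins_at bl r i (r i))) (slot_items bl i).

Definition next_cells L x o := end_slot L (slot_result I f k L x o false).

(* Together with the first accepted item and the winner, these include all
   accepted items of the slot. *)
Definition near_misses bl r i : pred 'I_n := fun x =>
  let L := cells_at bl r i in let theta := base L (wins_at bl r i (r i)) in
  (top_value (gain L) theta (first_max (gain L) theta (sample_part bl i)) < gain L x) &&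
  (gain L x < top_value (gain L) theta (slot_pick bl r i)).

Lemma run_binsE bl i L sa : (0 < d)%N ->
  run_bins bl i L sa (iota 0 d) =
  foldl (offer I f k L true) (foldl (offer I f k L false) sa (sample_part bl i))
        (main_part bl i).
Proof.
move=> d0; rewrite /main_part -[in LHS](prednK d0) /= addn0 -/(sample_part bl i).
move: (foldl _ sa _) => sa'; rewrite /run_bins; have : all (leq 1) (iota 1 d.-1) by apply/allP => c; rewrite mem_iota => /andP[].
elim: (iota 1 d.-1) sa' => [//|c s IH] sa' /= /andP[c0 cs].
by rewrite c0 foldl_cat IH.
Qed.

Hypothesis d_gt0 : (0 < d)%N.

(** Replaces the item-by-item pass over a slot by [slot_pick], the form in which two runs can be
    compared. The 2 in the size bound stands for the first accepted item and the winner. *)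
Lemma runS bl r i : exists news,
  [/\ cells_at bl r i.+1 = next_cells (cells_at bl r i) (wins_at bl r i (r i)) (slot_pick bl r i),
      wins_at bl r i.+1 = upd (wins_at bl r i) i (slot_pick bl r i),
      accepted_at bl r i.+1 = accepted_at bl r i ++ news,
      (size news <= 2 + count (near_misses bl r i) (main_part bl i))%N &
      forall w, slot_pick bl r i = Some w -> w \in main_part bl i -> w \in news].
Proof.
rewrite /cells_at /wins_at /accepted_at /near_misses /slot_pick /cells_at /wins_at /=.
case: (run bl r i) => [[L W] acc] /=; rewrite run_binsE //.
rewrite foldl_offer_sample.
have [news [b [-> [hb hw _ _ hs]]]] := foldl_offer_main I f k L (W (r i)) acc
  (sample_part bl i) (main_part bl i).
exists news; split=> //=.
- by rewrite /next_cells /slot_items; case: (first_max _ _ _).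
- rewrite /slot_items; case: (first_max _ _ _) => //=.
  by rewrite /slot_start; case: ifP.
- apply: leq_trans hs _; rewrite addnAC leq_add2r.
  by case: (_ < _)%R.
move=> w ew wm; case: (hw w ew) => // bt.
move: hb; rewrite bt => /esym/andP[_ /hasPn/(_ w wm)].
have [_ tw wmax] := first_max_some ew.
by rewrite /is_max tw /=; move/negP; case; apply/allP.
Qed.

Lemma wins_persist bl r i i' j : (j < i)%N -> (i <= i')%N ->
  wins_at bl r i' j = wins_at bl r i j.
Proof.
move=> ji /subnKC <-; elim: (i' - i)%N => [|e IH]; first by rewrite addn0.
rewrite addnS; have [_ [_ -> _ _ _]] := runS bl r (i + e); rewrite -IH /upd.
by case: eqP => // ej; move: ji; rewrite ej; lia.
Qed.

End Run.

(** * Invariants and progress of a single run *)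

Section Deterministic.
Variables (R : realType) (n : nat) (I : {set {set 'I_n}}) (f : {set 'I_n} -> R).
Variables (k d : nat).
Hypotheses (matI : is_matroid I) (f_ge0 : nonnegative f) (f_mono : monotone f).
Hypothesis d_gt0 : (0 < d)%N.

Definition inj_cells (L : nat -> option 'I_n) : Prop :=
  forall p q z, (p < k)%N -> (q < k)%N -> L p = Some z -> L q = Some z -> p = q.

Lemma contentsP (L : nat -> option 'I_n) z : reflect (exists2 p, (p < k)%N & L p = Some z) (z \in contents k L).
Proof.
rewrite inE; apply: (iffP existsP) => [[p /eqP]|[p pk Lp]]; first by exists p.
by exists (Ordinal pk); apply/eqP.
Qed.

Lemma contents_upd_sub (L : nat -> option 'I_n) p x z : z \in contents k (upd L p x) ->
  z \in contents k L \/ x = Some z.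
Proof.
case/contentsP=> q qk; rewrite /upd; case: eqP => _; first by right.
by left; apply/contentsP; exists q.
Qed.

(** Offering [None] empties a cell, which cannot help a monotone [f]; so a recycled slot without a
    winner has no effect. *)
Lemma best_swap_none L : (best_swap I f k L None).1 <= f (contents k L).
Proof.
have [h0 _ h] := best_swapP I f k L None.
case: (ltP 0 (best_swap I f k L None).1) => [/h[_ <-]|/le_trans]; last exact.
rewrite /swap_value; case: ifP => // _; apply: f_mono; apply/subsetP => z.
by case/contents_upd_sub.
Qed.

Lemma swap_spec L y : inj_cells L ->
  f (contents k L) < (best_swap I f k L (Some y)).1 ->
  let L' := upd L (best_swap I f k L (Some y)).2 (Some y) in
  [/\ contents k L' \in I, inj_cells L' & f (contents k L') = (best_swap I f k L (Some y)).1].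
Proof.
move=> inj lt_v; have [_ _] := best_swapP I f k L (Some y).
have v0 : 0 < (best_swap I f k L (Some y)).1 by apply: le_lt_trans lt_v.
case/(_ v0); set p := (best_swap _ _ _ _ _).2; rewrite /swap_value => pk.
case: ifP => [LI <-|_ v0']; last by move: v0; rewrite -v0' ltxx.
(* An item already present cannot improve the set: writing it into another cell adds nothing new. *)
have yL : y \notin contents k L.
  apply/negP => yL; move: lt_v; have := best_swapP I f k L (Some y) => -[_ _ /(_ v0)[_ <-]].
  rewrite -/p /swap_value LI ltNge => /negP[]; apply: f_mono; apply/subsetP => z.
  by case/contents_upd_sub => // -[<-].
split=> // q q' z qk q'k; rewrite /upd.
case: (eqVneq q p) => [->|qp]; case: (eqVneq q' p) => [->|q'p] //.
- by move=> [<-] Lq'; case/negP: yL; apply/contentsP; exists q'.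
- by move=> Lq [ez]; case/negP: yL; apply/contentsP; exists q; rewrite // ez.
- exact: inj.
Qed.

Lemma next_cells_spec L x o :
  contents k L \in I -> inj_cells L ->
  (forall w, o = Some w -> slot_base I f k L x < gain_value I f k L w) ->
  let L' := next_cells I f k L x o in
  [/\ contents k L' \in I, inj_cells L',
      forall z, z \in contents k L' -> [\/ z \in contents k L, x = Some z | o = Some z] &
      f (contents k L') = top_value (gain_value I f k L) (slot_base I f k L x) o].
Proof.
move=> LI inj ho; rewrite /next_cells /end_slot; case: o ho => [w|_] /=.
  move=> /(_ w erefl) lt_w.
  have [|LI' inj' fL'] := @swap_spec L w inj.
    by apply: le_lt_trans lt_w; rewrite /slot_base le_max lexx.
  by split=> // z /contents_upd_sub[]; [constructor 1 | constructor 3].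
rewrite /slot_start /slot_base; case: ltP => [lt_x|le_x] /=; last first.
  by split=> // z zL; constructor 1.
case: x lt_x => [x|] lt_x /=.
  have [LI' inj' fL'] := @swap_spec L x inj lt_x.
  by split=> // z /contents_upd_sub[]; [constructor 1 | constructor 2].
by have := best_swap_none L; rewrite leNgt lt_x.
Qed.

Variables (bl : nat -> seq 'I_n) (r : nat -> nat).
Let cells := cells_at I f k d bl r.
Let wins := wins_at I f k d bl r.
Let acc := accepted_at I f k d bl r.
Let gain := gain_value I f k.
Let base i := slot_base I f k (cells i) (wins i (r i)).
Let pck := slot_pick I f k d bl r.

Lemma pick_items i w : pck i = Some w ->
  w \in slot_items d bl i /\ base i < gain (cells i) w.
Proof. by case/first_max_some. Qed.

Lemma run_invariant i :
  [/\ contents k (cells i) \in I, inj_cells (cells i),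
      forall z, z \in contents k (cells i) -> exists j, wins i j = Some z &
      forall j z, wins i j = Some z -> (j < i)%N /\ z \in slot_items d bl j].
Proof.
elim: i => [|i [LI inj wL Wi]].
  split=> //; last by move=> z; case/contentsP.
  rewrite (_ : contents _ _ = set0) ?indep0 //.
  by apply/setP => z; rewrite !inE; apply/existsP => -[].
have [news [eL eW _ _ _]] := runS I f k d_gt0 bl r i.
have := @next_cells_spec (cells i) (wins i (r i)) (pck i) LI inj.
case=> [w /pick_items[]//|]; rewrite -/(cells i.+1) /cells eL => LI' inj' sub' _.
split=> //.
  rewrite /wins eW => z /sub'[/wL[j Wj]|Wr|pz].
  - by exists j; rewrite /upd; case: eqP => // ej; have [] := Wi _ _ Wj; rewrite ej ltnn.
  - exists (r i); rewrite /upd; case: eqP => // ej.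
    by have [] := Wi _ _ Wr; rewrite ej ltnn.
  - by exists i; rewrite /upd eqxx.
rewrite /wins eW => j z; rewrite /upd; case: eqP => [->|_]; last first.
  by move/Wi => [/ltnW h ?]; rewrite ltnS.
by case/pick_items.
Qed.

Lemma cells_value_succ i :
  f (contents k (cells i.+1)) = top_value (gain (cells i)) (base i) (pck i).
Proof.
have [LI inj _ _] := run_invariant i.
have [news [eL _ _ _ _]] := runS I f k d_gt0 bl r i.
have := @next_cells_spec (cells i) (wins i (r i)) (pck i) LI inj.
by case=> [w /pick_items[]//|]; rewrite -eL.
Qed.

Lemma cells_value_base i : base i <= f (contents k (cells i.+1)).
Proof. by rewrite cells_value_succ; exact: theta_le_top_value. Qed.

Lemma cells_value_mono i : f (contents k (cells i)) <= f (contents k (cells i.+1)).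
Proof. by apply: le_trans (cells_value_base i); rewrite le_max lexx. Qed.

Lemma cells_value_recycled i e : wins i (r i) = Some e ->
  gain (cells i) e <= f (contents k (cells i.+1)).
Proof. by move=> We; apply: le_trans (cells_value_base i); rewrite /base We le_max lexx orbT. Qed.

Lemma cells_value_item i e : e \in slot_items d bl i ->
  gain (cells i) e <= f (contents k (cells i.+1)).
Proof. by rewrite cells_value_succ; exact: le_top_value. Qed.

Lemma accepted_main i j z : wins i j = Some z -> z \in main_part d bl j -> z \in acc i.
Proof.
elim: i => [//|i IH]; have [news [_ eW eA _ hn]] := runS I f k d_gt0 bl r i.
rewrite /wins eW /acc eA /upd mem_cat; case: eqP => [->|_].
  by move=> /hn h /h ->; rewrite orbT.
by move=> Wj zj; rewrite IH.
Qed.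

Lemma size_accepted i : (size (acc i) <=
  \sum_(j < i) (2 + count (near_misses I f k d bl r j) (main_part d bl j)))%N.
Proof.
elim: i => [|i IH]; first by rewrite big_ord0.
have [news [_ _ eA hs _]] := runS I f k d_gt0 bl r i.
by rewrite big_ord_recr /acc eA size_cat leq_add.
Qed.

Lemma sum_gains (A : {set 'I_n}) i : submodular f -> rk I = k ->
  A \in I -> #|A| = k ->
  f A - 2 * f (contents k (cells i)) <=
    \sum_(e in A) (gain (cells i) e - f (contents k (cells i))).
Proof.
move=> f_sub rkI AI cA; have [LI inj _ _] := run_invariant i.
apply: (sum_swap_gains f_ge0 f_mono f_sub matI LI AI); first by rewrite rkI.
move=> e b eI hb; rewrite /gain /gain_value.
have [_ hsw _] := best_swapP I f k (cells i) (Some e).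
suff [p pk eqp] : exists2 p, (p < k)%N &
    contents k (upd (cells i) p (Some e)) = e |: contents k (cells i) :\ b.
  by have := hsw p pk; rewrite /swap_value eqp eI.
(* The cell to overwrite is the one holding [b], or else an empty one; if none were empty, the cells
   would hold [k] distinct items, more than the bound in [hb] allows. *)
case: (boolP (b \in contents k (cells i))) hb => [/contentsP[p pk Lp] _|bL /= hb].
  exists p => //; apply/setP => z; rewrite !in_setU1 in_setD1; apply/idP/idP.
    case/contentsP => q qk; rewrite /upd; case: eqP => [_ [->]|qp Lq]; first by rewrite eqxx.
    apply/orP; right; apply/andP; split; last by apply/contentsP; exists q.
    by apply/eqP => zb; apply: qp; apply: inj Lp; rewrite // -zb.
  case/orP => [/eqP->|/andP[zb /contentsP[q qk Lq]]]; apply/contentsP.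
    by exists p; rewrite // /upd eqxx.
  exists q; rewrite // /upd; case: eqP => // qp; case/eqP: zb.
  by move: Lq; rewrite qp Lp => -[].
have [p pk Lp] : exists2 p, (p < k)%N & cells i p = None.
  case: (pickP (fun p : 'I_k => cells i p == None)) => [p /eqP|noN]; first by exists p.
  exfalso; move: hb; rewrite rkI ltnNge => /negP[].
  have some p : {z | cells i p = Some z} + {(k <= p)%N}.
    case: (ltnP p k) => pk; last by right.
    by left; case E: (cells i p) => [z|]; [exists z | have := noN (Ordinal pk); rewrite /= E].
  pose h (p : 'I_k) : 'I_n := if some p is inleft s then sval s else b.
  have hP (p : 'I_k) : cells i p = Some (h p).
    by rewrite /h; case: (some p) => [[]//|]; rewrite leqNgt ltn_ord.
  have hinj : injective h.
    move=> p q hpq; apply: val_inj; apply: (inj p q (h p)); rewrite ?ltn_ord ?hP ?hpq //.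
  rewrite -{1}(card_ord k) -(card_image hinj 'I_k).
  apply: subset_leq_card; apply/subsetP => z /imageP[p _ ->].
  by apply/contentsP; exists p.
exists p => //; apply/setP => z; rewrite !in_setU1 in_setD1; apply/idP/idP.
  case/contentsP => q qk; rewrite /upd; case: eqP => [_ [->]|qp Lq]; first by rewrite eqxx.
  have zL : z \in contents k (cells i) by apply/contentsP; exists q.
  by apply/orP; right; rewrite zL andbT; apply: contraNneq bL => <-.
case/orP => [/eqP->|/andP[zb /contentsP[q qk Lq]]]; apply/contentsP.
  by exists p; rewrite // /upd eqxx.
by exists q; rewrite // /upd; case: eqP => // qp; move: Lq; rewrite qp Lp.
Qed.

End Deterministic.

(** * Moving one item to another bin *)

Section Bins.
Variables (n d : nat) (ord : seq 'I_n).
Hypotheses (d_gt0 : (0 < d)%N) (ord_uniq : uniq ord) (ord_all : forall x, x \in ord).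
Implicit Types sg bt : 'I_n -> nat.

Definition bins sg bt (q : nat) : seq 'I_n := [seq x <- ord | sg x * d + bt x == q]%N.

Lemma bins_slot sg bt i c x : (c < d)%N -> (bt x < d)%N ->
  (x \in bins sg bt (i * d + c)%N) = (sg x == i) && (bt x == c).
Proof.
move=> cd bd; rewrite mem_filter ord_all andbT; apply/eqP/andP => [e|[/eqP-> /eqP->]//].
have := congr1 (divn^~ d) e; have := congr1 (modn^~ d) e.
by rewrite !modnMDl !modn_small // !divnMDl // !divn_small // !addn0 => -> ->.
Qed.

Lemma mem_sample_part sg bt i x : (bt x < d)%N ->
  (x \in sample_part d (bins sg bt) i) = (sg x == i) && (bt x == 0%N).
Proof. by move=> bd; rewrite /sample_part -[(i * d)%N]addn0 bins_slot. Qed.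

Lemma mem_main_part sg bt i x : (bt x < d)%N ->
  (x \in main_part d (bins sg bt) i) = (sg x == i) && (0 < bt x)%N.
Proof.
move=> bd; apply/flattenP/andP => [[s /mapP[c]]|[si b0]].
  rewrite mem_iota => /andP[c0 cd] -> ; rewrite bins_slot; last by [].
    by case/andP=> -> /eqP ->.
  by move: cd; rewrite add1n prednK.
exists (bins sg bt (i * d + bt x)%N); last by rewrite bins_slot // si eqxx.
by apply/mapP; exists (bt x) => //; rewrite mem_iota b0 add1n prednK.
Qed.

Lemma mem_slot_items sg bt i x : (bt x < d)%N ->
  (x \in slot_items d (bins sg bt) i) = (sg x == i).
Proof.
move=> bd; rewrite mem_cat mem_main_part // mem_sample_part //.
by case: eqP => //= _; case: (bt x).
Qed.

Lemma uniq_main_part sg bt i : (forall x, bt x < d)%N -> uniq (main_part d (bins sg bt) i).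
Proof.
move=> bd; rewrite /main_part; have := iota_uniq 1 d.-1.
have : all (fun c => c < d)%N (iota 1 d.-1).
  by apply/allP => c; rewrite mem_iota add1n prednK // => /andP[].
elim: (iota 1 d.-1) => [//|c s IH] /= /andP[cd sd] /andP[cs us].
rewrite cat_uniq IH // andbT filter_uniq //=.
apply/hasPn => x /flattenP[_ /mapP[c' c's ->]].
have cd' := allP sd _ c's; rewrite bins_slot // => /andP[_ /eqP ec]; rewrite bins_slot //.
by apply: contraNN cs => /andP[_ /eqP <-]; rewrite ec.
Qed.

Section AgreeOff.
Variables (sg bt sg' bt' : 'I_n -> nat) (e : 'I_n).
Hypotheses (eq_sg : forall x, x != e -> sg' x = sg x) (eq_bt : forall x, x != e -> bt' x = bt x).

Lemma bins_off q : [seq x <- bins sg' bt' q | x != e] = [seq x <- bins sg bt q | x != e].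
Proof.
rewrite /bins -!filter_predI; apply: eq_filter => x /=.
by case: (eqVneq x e) => //= xe; rewrite eq_sg // eq_bt.
Qed.

Lemma main_part_off i :
  [seq x <- main_part d (bins sg' bt') i | x != e] = [seq x <- main_part d (bins sg bt) i | x != e].
Proof.
rewrite /main_part !filter_flatten -!map_comp; congr flatten.
by apply: eq_map => c /=; exact: bins_off.
Qed.

Lemma slot_items_off i :
  [seq x <- slot_items d (bins sg' bt') i | x != e] =
  [seq x <- slot_items d (bins sg bt) i | x != e].
Proof. by rewrite /slot_items !filter_cat main_part_off /sample_part bins_off. Qed.

Variables (R : realType) (I : {set {set 'I_n}}) (f : {set 'I_n} -> R) (k : nat) (r : nat -> nat).
Let bl := bins sg bt.
Let bl' := bins sg' bt'.

Lemma run_eq i :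
  (forall j, (j < i)%N ->
     cells_at I f k d bl' r j = cells_at I f k d bl r j ->
     wins_at I f k d bl' r j = wins_at I f k d bl r j ->
     slot_pick I f k d bl' r j = slot_pick I f k d bl r j) ->
  cells_at I f k d bl' r i = cells_at I f k d bl r i /\
  wins_at I f k d bl' r i = wins_at I f k d bl r i.
Proof.
elim: i => [//|i IH] h; have [|ec ew] := IH; first by move=> j ji; apply: h; exact: ltnW.
have [_ [-> -> _ _ _]] := runS I f k d_gt0 bl r i.
have [_ [-> -> _ _ _]] := runS I f k d_gt0 bl' r i.
by rewrite ec ew h.
Qed.

(** Once [e] is deleted, both runs see the same lists in every slot. The second hypothesis may
    assume that the runs agree so far, since it is used inside the induction. *)
Lemma run_eq_off i :
  (forall j, (j < i)%N -> slot_pick I f k d bl r j <> Some e) ->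
  (forall j, (j < i)%N -> 
     cells_at I f k d bl' r j = cells_at I f k d bl r j ->
     wins_at I f k d bl' r j = wins_at I f k d bl r j ->
     slot_pick I f k d bl' r j <> Some e) ->
  cells_at I f k d bl' r i = cells_at I f k d bl r i /\
  wins_at I f k d bl' r i = wins_at I f k d bl r i.
Proof.
move=> h h'; apply: run_eq => j ji ec ew; have := h' j ji ec ew; have := h j ji.
rewrite /slot_pick ec ew => /eqP p1 /eqP p2.
by rewrite -(first_max_rem p1) -(first_max_rem p2) slot_items_off.
Qed.

End AgreeOff.

Variables (R : realType) (I : {set {set 'I_n}}) (f : {set 'I_n} -> R) (k : nat) (r : nat -> nat).
Hypotheses (matI : is_matroid I) (f_ge0 : nonnegative f) (f_mono : monotone f).

Notation cells sg bt := (cells_at I f k d (bins sg bt) r).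
Notation wins sg bt := (wins_at I f k d (bins sg bt) r).

Lemma wins_pick sg bt i j : (j < i)%N -> wins sg bt i j = slot_pick I f k d (bins sg bt) r j.
Proof.
move=> ji; rewrite (wins_persist I f k d_gt0 _ _ (leqnn j.+1)) //.
by have [_ [_ -> _ _ _]] := runS I f k d_gt0 (bins sg bt) r j; rewrite /upd eqxx.
Qed.

Lemma pick_slot sg bt j x : (bt x < d)%N -> slot_pick I f k d (bins sg bt) r j = Some x -> sg x = j.
Proof. by move=> bd /pick_items[]; rewrite mem_slot_items // => /eqP. Qed.

Lemma wins_slot sg bt i j x : (bt x < d)%N -> wins sg bt i j = Some x ->
  (j < i)%N /\ sg x = j.
Proof.
move=> bd; have [_ _ _ h] := run_invariant k matI f_ge0 f_mono d_gt0 (bins sg bt) r i.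
by case/h => ji; rewrite mem_slot_items // => /eqP.
Qed.

(* An item that has not won before slot [i] may be moved to any slot from [i]
   on without altering the first [i] slots. *)
Lemma move_slot sg bt sg' e i : (forall x, bt x < d)%N ->
  (forall x, x != e -> sg' x = sg x) -> wins sg bt i (sg e) <> Some e -> (i <= sg' e)%N ->
  cells sg' bt i = cells sg bt i /\ wins sg' bt i = wins sg bt i.
Proof.
move=> bd eq_sg nw ie; apply: (run_eq_off eq_sg) => // j ji.
  move=> pj; have ej := pick_slot (bd e) pj.
  by apply: nw; rewrite ej wins_pick.
by move=> _ _ /pick_slot ej; move: ji; rewrite -(ej (bd e)) ltnNge ie.
Qed.

(** The sample is listed last, so [x] wins from it only if it strictly beats every main item.
    Wherever it is inserted in the main part, it therefore strictly beats what precedes it and is at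
    least as good as what follows. *)
Lemma move_sample_winner sg bt bt' x i : (forall x, bt x < d)%N -> (forall x, bt' x < d)%N ->
  (forall y, y != x -> bt' y = bt y) -> bt x = 0%N ->
  slot_pick I f k d (bins sg bt) r (sg x) = Some x ->
  cells sg bt' i = cells sg bt i /\ wins sg bt' i = wins sg bt i.
Proof.
move=> bd bd' eq_bt b0 px.
have off j := slot_items_off (fun z (_ : z != x) => erefl (sg z)) eq_bt j.
have moff j := main_part_off (fun z (_ : z != x) => erefl (sg z)) eq_bt j.
apply: (@run_eq sg bt sg bt') => j _ ec ew; case: (eqVneq j (sg x)) => [ej|jx]; last first.
  rewrite /slot_pick ec ew.
  have := first_max_rem (e := x) (l := slot_items d (bins sg bt) j)
    (g := gain_value I f k (cells sg bt j))
    (theta := slot_base I f k (cells sg bt j) (wins sg bt j (r j))).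
  have nx b : (b x < d)%N -> x \notin slot_items d (bins sg b) j.
    by move=> bx; rewrite mem_slot_items // eq_sym.
  have fx b : (b x < d)%N ->
      [seq z <- slot_items d (bins sg b) j | z != x] = slot_items d (bins sg b) j.
    by move=> bx; apply/all_filterP/allP => z; apply: contraTneq => ->; exact: nx.
  by rewrite -(fx bt') // off fx.
rewrite {j}ej in ec ew *; rewrite px /slot_pick ec ew.
have [xl tx xm] := first_max_some px; rewrite -/(slot_pick _ _ _ _ _ _ _) in xl tx xm.
case: (posnP (bt' x)) => [b0'|b0'].
  suff eb q : bins sg bt' q = bins sg bt q.
    rewrite -[RHS]px /slot_pick /slot_items /main_part /sample_part eb.
    by congr (first_max _ _ (flatten _ ++ _)); apply: eq_map.
  by apply: eq_filter => z; case: (eqVneq z x) => [->|zx]; rewrite ?b0 ?b0' // eq_bt.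
have xm' : x \in main_part d (bins sg bt') (sg x) by rewrite mem_main_part ?eqxx.
have um := uniq_main_part sg (sg x) bd'.
have xnm : x \notin main_part d (bins sg bt) (sg x) by rewrite mem_main_part // b0 andbF.
have mlt z : z \in main_part d (bins sg bt) (sg x) ->
    gain_value I f k (cells sg bt (sg x)) z < gain_value I f k (cells sg bt (sg x)) x.
  move=> zm; have zl : z \in slot_items d (bins sg bt) (sg x) by rewrite mem_cat zm.
  rewrite lt_neqAle xm // andbT; apply: contraNneq xnm => gz.
  move: px; rewrite /slot_pick /first_max /maxes /slot_items filter_cat.
  set M := [seq _ <- main_part _ _ _ | _].
  have : z \in M.
    rewrite mem_filter zm andbT /is_max gz tx /=; apply/allP => y yl; exact: xm.
  case eM: M => [//|w s] _ /= [ex].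
  have : w \in M by rewrite eM mem_head.
  by rewrite /M mem_filter => /andP[_]; rewrite ex.
have sub s1 s2 : main_part d (bins sg bt') (sg x) = s1 ++ x :: s2 ->
    {subset s1 ++ s2 <= main_part d (bins sg bt) (sg x)}.
  move=> es z zs; have zx : z != x.
    apply: contraTneq zs => ->; move: um; rewrite es uniq_catC cat_cons /= mem_cat.
    by rewrite orbC -mem_cat => /andP[].
  have : z \in [seq z <- main_part d (bins sg bt) (sg x) | z != x].
    by rewrite -moff es mem_filter zx mem_cat in_cons orbCA -mem_cat zs orbT.
  by rewrite mem_filter => /andP[].
rewrite /slot_items; case/splitPr: xm' sub => s1 s2 /(_ s1 s2 erefl) sub.
rewrite -catA; apply: first_max_cat => // z.
  by move=> zs; apply: mlt; apply: sub; rewrite mem_cat zs.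
rewrite mem_cat => /orP[zs|zs]; first by apply/ltW/mlt/sub; rewrite mem_cat zs orbT.
apply: xm; rewrite mem_cat; apply/orP; right; move: zs.
by rewrite !mem_sample_part // => /andP[-> /=]; case: (eqVneq z x) => [->|zx]; [rewrite b0 | rewrite eq_bt].
Qed.

(** A near miss is strictly below the winner of its slot, and that winner stays in the slot; so [x]
    wins neither before nor after the move. *)
Lemma demote_near_miss sg bt bt' x i : (forall x, bt x < d)%N -> (forall x, bt' x < d)%N ->
  (forall y, y != x -> bt' y = bt y) -> bt' x = 0%N ->
  x \in main_part d (bins sg bt) (sg x) ->
  near_misses I f k d (bins sg bt) r (sg x) x ->
  cells sg bt' i = cells sg bt i /\ wins sg bt' i = wins sg bt i.
Proof.
move=> bd bd' eq_bt b0 xmain /andP[_ lt_x].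
have nx : slot_pick I f k d (bins sg bt) r (sg x) <> Some x.
  by move=> ex; move: lt_x; rewrite ex /= ltxx.
apply: (@run_eq_off sg bt sg bt' x) => // j _.
  by move=> pj; apply: nx; rewrite (pick_slot (bd x) pj).
move=> ec ew pj; have ej := pick_slot (bd' x) pj; rewrite -{j}ej in ec ew pj.
move: pj; rewrite /slot_pick ec ew => pj; have [_ tx xm] := first_max_some pj.
move: lt_x; rewrite /slot_pick; case E: (first_max _ _ _) => [w|] /=; last first.
  by move=> /(lt_trans tx); rewrite ltxx.
rewrite ltNge => /negP[]; apply: xm.
have [wl _ _] := first_max_some E; move: wl; rewrite !mem_slot_items //.
Qed.

(** After the move [x] is the strict maximum of the sample, and a sample has at most one such item.
    This is what bounds the number of near misses. *)
Lemma near_miss_top sg bt bt' x : (forall x, bt x < d)%N -> (forall x, bt' x < d)%N ->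
  (forall y, y != x -> bt' y = bt y) -> bt' x = 0%N -> 
  x \in main_part d (bins sg bt) (sg x) ->
  near_misses I f k d (bins sg bt) r (sg x) x ->
  forall y, y \in sample_part d (bins sg bt') (sg x) -> y != x ->
  gain_value I f k (cells sg bt' (sg x)) y < gain_value I f k (cells sg bt' (sg x)) x.
Proof.
move=> bd bd' eq_bt b0 xm nm y + yx.
have [-> _] := demote_near_miss (sg x) bd bd' eq_bt b0 xm nm.
move=> ys; have {}ys : y \in sample_part d (bins sg bt) (sg x).
  by move: ys; rewrite !mem_sample_part // eq_bt.
by case/andP: nm => + _; apply: le_lt_trans; exact: le_top_value.
Qed.

End Bins.

(** * Expected progress per slot *)

Section Resample.
Variables (R : realType) (A B : finType).
Implicit Types g : {ffun A -> B}.

Definition updf g (a : A) (v : B) : {ffun A -> B} := [ffun x => if x == a then v else g x].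

Lemma updf_same g a v : updf g a v a = v. Proof. by rewrite ffunE eqxx. Qed.

Lemma updf_other g a v x : x != a -> updf g a v x = g x.
Proof. by move=> /negPf xa; rewrite ffunE xa. Qed.

(** Resampling a coordinate preserves the uniform measure: exchanging the new value with the
    overwritten one is an involution on pairs. *)
Lemma sum_updf (H : {ffun A -> B} -> R) (a : A) :
  \sum_(g : {ffun A -> B}) \sum_v H (updf g a v) = #|B|%:R * \sum_g H g.
Proof.
pose h (p : {ffun A -> B} * B) := (updf p.1 a p.2, p.1 a).
have hK : involutive h.
  move=> [g v]; rewrite /h /= updf_same; congr (_, _); apply/ffunP => x.
  by rewrite !ffunE; case: eqP => [->|].
rewrite pair_big /= (reindex_inj (inv_inj hK)) /=.
have -> : \sum_j H (updf (updf j.1 a j.2) a (j.1 a)) = \sum_(j : {ffun A -> B} * B) H j.1.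
  by apply: eq_bigr => p _; have := hK p; rewrite /h /= => /(congr1 fst) /= ->.
rewrite -(pair_big xpredT xpredT (fun g (v : B) => H g)) /= big_distrr /=.
by apply: eq_bigr => g _; rewrite sumr_const mulr_natl.
Qed.

Lemma sum_updf_at (H : {ffun A -> B} -> R) (a : A) (v : B) :
  \sum_(g : {ffun A -> B}) H (updf g a v) = #|B|%:R * \sum_(g : {ffun A -> B}) (g a == v)%:R * H g.
Proof.
rewrite -(sum_updf (fun g => (g a == v)%:R * H g) a); apply: eq_bigr => g _.
rewrite (bigD1 v) //= updf_same eqxx mul1r big1 ?addr0 // => w wv.
by rewrite updf_same (negPf wv) mul0r.
Qed.

End Resample.

(** The padding 0 is the initial content of the arrays, so a complete draw and the array that stores
    it agree at all indices. *)
Definition ext (a b : nat) (g : {ffun 'I_a -> 'I_b}) (i : nat) : nat :=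
  if insub i is Some j then g j else 0%N.

Lemma extE (a b : nat) (g : {ffun 'I_a -> 'I_b}) (i : 'I_a) : ext g i = g i.
Proof. by rewrite /ext valK. Qed.

Lemma card_geq_ord (m i : nat) : (i <= m)%N -> #|[pred v : 'I_m | (i <= v)%N]| = (m - i)%N.
Proof.
move=> im; rewrite -sum1_card -(big_mkord (fun v => i <= v)%N (fun=> 1%N)).
rewrite (big_cat_nat (n := i)) //= big_nat_cond big1 ?add0n; last first.
  by move=> v /andP[/andP[_ vi]]; rewrite leqNgt vi.
rewrite big_nat_cond (eq_bigl (fun v => (i <= v < m)%N && true)); last first.
  by move=> v /=; rewrite andbT; case: (leqP i v) => //= _; rewrite andbT.
by rewrite -big_nat_cond sum_nat_const_nat muln1.
Qed.

(** If [e0] is offered, its own term is at most [D], and every other term is at most 0 because [e0]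
    is among its collisions. *)
Lemma pairs_collide (R : realType) (T : finType) (A : {set T}) (u : T -> bool) (G : T -> R) (D : R) :
  0 <= D -> (forall e, 0 <= G e) -> (forall e, u e -> G e <= D) ->
  \sum_(e in A) (u e)%:R * G e * (1 - \sum_(e' in A | e' != e) (u e')%:R) <= D.
Proof.
move=> D0 G0 uG; case: (pickP (fun e => (e \in A) && u e)) => [e0 /andP[e0A ue0]|nu]; last first.
  rewrite big1 // => e eA; have := nu e; rewrite /= eA /= => ->.
  by rewrite !mul0r.
rewrite (bigD1 e0) //= ue0 mul1r -[leRHS]addr0; apply: lerD.
  apply: le_trans (uG _ ue0); rewrite ler_piMr // lerBlDr lerDl.
  by apply: sumr_ge0 => e' _; case: (u e').
apply: sumr_le0 => e /andP[eA ne]; apply: mulr_ge0_le0; first by rewrite mulr_ge0 ?ler0n.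
rewrite (bigD1 e0) /=; last by rewrite e0A eq_sym.
rewrite ue0 opprD addrA subrr add0r oppr_le0.
by apply: sumr_ge0 => e' _; case: (u e').
Qed.

(** * Offers, collisions and the expected gain of a slot *)

Section Averages.
Variables (R : realType) (n : nat) (I : {set {set 'I_n}}) (f : {set 'I_n} -> R).
Variables (k d m : nat) (ord : seq 'I_n).
Hypotheses (matI : is_matroid I) (rkI : rk I = k).
Hypotheses (f_ge0 : nonnegative f) (f_mono : monotone f) (f_sub : submodular f).
Hypotheses (d_gt0 : (0 < d)%N) (ord_uniq : uniq ord) (ord_all : forall x, x \in ord).

Notation slots := {ffun 'I_n -> 'I_m}.
Notation subs := {ffun 'I_n -> 'I_d}.
Notation recs := {ffun 'I_m -> 'I_m}.
Implicit Types (sg : slots) (bt : subs) (r : recs).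

Definition binned sg bt : nat -> seq 'I_n :=
  bins d ord (fun x => val (sg x)) (fun x => val (bt x)).

Let cells sg bt r i := cells_at I f k d (binned sg bt) (ext r) i.
Let wins sg bt r i := wins_at I f k d (binned sg bt) (ext r) i.
Let value sg bt r i : R := f (contents k (cells sg bt r i)).
(** The positive part, since an offer that does not improve the set is declined. *)
Let gain sg bt r i e : R := Num.max 0 (gain_value I f k (cells sg bt r i) e - value sg bt r i).
(** An item can be recorded as winner only in its own slot, so looking there suffices. *)
Let won sg bt r i e : bool := wins sg bt r i (sg e) == Some e.
Let recycled sg bt r i e : bool := wins sg bt r i (ext r i) == Some e.
Let offered sg bt r i e : bool := (sg e == i :> nat) || recycled sg bt r i e.

Lemma gain_ge0 sg bt r i e : 0 <= gain sg bt r i e.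
Proof. by rewrite le_max lexx. Qed.

Lemma move_item sg bt r i e (v : 'I_m) : ~~ won sg bt r i e -> (i <= v)%N ->
  cells (updf sg e v) bt r i = cells sg bt r i /\ wins (updf sg e v) bt r i = wins sg bt r i.
Proof.
move=> nw iv; apply: (move_slot d_gt0 ord_all (e := e)) => //.
- by move=> x; exact: ltn_ord.
- by move=> x xe; rewrite updf_other.
- by move=> we; move/negP: nw; apply; apply/eqP.
- by rewrite updf_same.
Qed.

Lemma won_slot sg bt r i j e : wins sg bt r i j = Some e -> (j < i)%N /\ sg e = j :> nat.
Proof. by apply: (wins_slot d_gt0 ord_all matI f_ge0 f_mono); exact: ltn_ord. Qed.

Lemma move_recycle sg bt r r' i : (forall j : 'I_m, (j < i)%N -> r' j = r j) ->
  cells sg bt r' i = cells sg bt r i /\ wins sg bt r' i = wins sg bt r i.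
Proof.
move=> rr; rewrite /cells /wins /cells_at /wins_at.
suff -> : run I f k d (binned sg bt) (ext r') i = run I f k d (binned sg bt) (ext r) i by [].
elim: i rr => [//|i IH] rr /=; rewrite IH; last by move=> j ji; apply: rr; exact: ltnW.
rewrite /run_slot; case: (run _ _ _ _ _ _ _) => [[L W] acc].
suff -> : ext r' i = ext r i by [].
by rewrite /ext; case: insubP => // j _ ej; rewrite rr // ej.
Qed.

(** The draw of slot [i] is independent of the earlier slots, and for a past winner [e] exactly one
    of its [m] values, the slot of [e], brings [e] back. *)
Lemma sum_recycled sg bt i e (H : recs -> R) : (i < m)%N ->
  (forall r r', (forall j : 'I_m, (j < i)%N -> r' j = r j) -> H r' = H r) ->
  m%:R * (\sum_(r : recs) (recycled sg bt r i e)%:R * H r) = \sum_(r : recs) (won sg bt r i e)%:R * H r.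
Proof.
move=> im hH; pose i0 := Ordinal im.
have off (r : recs) v : forall j : 'I_m, (j < i)%N -> updf r i0 v j = r j.
  by move=> j ji; rewrite updf_other // -val_eqE /=; apply: contraTneq ji => ->; rewrite ltnn.
have := sum_updf (fun r => (recycled sg bt r i e)%:R * H r) i0.
rewrite card_ord => <-.
apply: eq_bigr => r _; rewrite /recycled.
have E v : (wins sg bt (updf r i0 v) i (ext (updf r i0 v) i) == Some e)%:R * H (updf r i0 v)
    = (wins sg bt r i v == Some e)%:R * H r.
  have [_ ->] := move_recycle sg bt (off r v).
  by rewrite (hH _ _ (off r v)) -[X in ext _ X]/(val i0) extE updf_same.
rewrite (eq_bigr _ (fun v _ => E v)) (bigD1 (sg e)) //= big1 ?addr0 // => v ve.
case: eqP => [/won_slot[_ ev]|_]; last by rewrite mul0r.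
by move: ve; rewrite -val_eqE /= ev eqxx.
Qed.

Lemma gain_recycle sg bt r r' i e : (forall j : 'I_m, (j < i)%N -> r' j = r j) ->
  gain sg bt r' i e = gain sg bt r i e.
Proof. by move=> rr; rewrite /gain /value; have [-> _] := move_recycle sg bt rr. Qed.

Lemma offeredE sg bt r i e :
  (offered sg bt r i e)%:R = (sg e == i :> nat)%:R + (recycled sg bt r i e)%:R :> R.
Proof.
rewrite /offered; case: eqP => [se|_]; last by rewrite add0r.
case: (boolP (recycled _ _ _ _ _)) => [/eqP/won_slot[ji es]|_]; last by rewrite addr0.
by move: ji; rewrite -es se ltnn.
Qed.

(* Items that have not won before are uniform among at least the remaining
   slots, and earlier winners are recycled uniformly. *)
Lemma sum_offered_ge bt i e : (i < m)%N ->
  \sum_(sg : slots) \sum_(r : recs) gain sg bt r i e <=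
  m%:R * \sum_(sg : slots) \sum_(r : recs) (offered sg bt r i e)%:R * gain sg bt r i e.
Proof.
move=> im; pose i0 := Ordinal im.
have -> : \sum_(sg : slots) \sum_(r : recs) gain sg bt r i e =
    \sum_(sg : slots) \sum_(r : recs) (~~ won sg bt r i e)%:R * gain sg bt r i e +
    \sum_(sg : slots) \sum_(r : recs) (won sg bt r i e)%:R * gain sg bt r i e.
  rewrite -big_split; apply: eq_bigr => sg _; rewrite -big_split; apply: eq_bigr => r _ /=.
  by rewrite -mulrDl; case: won; rewrite ?add0r ?addr0 mul1r.
have -> : \sum_(sg : slots) \sum_(r : recs) (offered sg bt r i e)%:R * gain sg bt r i e =
    \sum_(sg : slots) \sum_(r : recs) (sg e == i0)%:R * gain sg bt r i e +
    \sum_(sg : slots) \sum_(r : recs) (recycled sg bt r i e)%:R * gain sg bt r i e.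
  rewrite -big_split; apply: eq_bigr => sg _; rewrite -big_split; apply: eq_bigr => r _ /=.
  by rewrite offeredE mulrDl.
rewrite mulrDr; apply: lerD; last first.
  rewrite mulr_sumr; apply: ler_sum => sg _.
  by rewrite sum_recycled // => r r'; exact: gain_recycle.
rewrite exchange_big [in leRHS]exchange_big /= mulr_sumr; apply: ler_sum => r _.
have := sum_updf_at (fun sg => gain sg bt r i e) e i0.
rewrite card_ord => <-; apply: ler_sum => sg _.
case: (boolP (won sg bt r i e)) => we; first by rewrite mul0r gain_ge0.
by rewrite mul1r /gain /value; have [-> _] := move_item (v := i0) we (leqnn i).
Qed.

(** An assignment with [e] in slot [i] yields [m - i] assignments with the same history, one for
    each slot from [i] on, in all of which [e] has not won. Items that lost in an earlier slot make
    this an inequality. *)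
Lemma sum_arrivals_le bt i e (H : slots -> recs -> R) : (i < m)%N ->
  (forall sg r, 0 <= H sg r) ->
  (forall sg r (v : 'I_m), ~~ won sg bt r i e -> (i <= v)%N -> H (updf sg e v) r = H sg r) ->
  (m - i)%:R * (\sum_(sg : slots) \sum_(r : recs) (sg e == i :> nat)%:R * H sg r) <=
  \sum_(sg : slots) \sum_(r : recs) (~~ won sg bt r i e)%:R * H sg r.
Proof.
move=> im H0 hH; pose i0 := Ordinal im.
rewrite exchange_big [in leRHS]exchange_big /= mulr_sumr; apply: ler_sum => r _.
have m0 : 0 < (m%:R : R) by rewrite ltr0n (leq_ltn_trans (leq0n i) im).
rewrite -(ler_pM2l m0) mulrCA.
have := sum_updf_at (fun sg => H sg r) e i0; rewrite card_ord => <-; rewrite mulr_sumr.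
have := sum_updf (fun sg => (~~ won sg bt r i e)%:R * H sg r) e; rewrite card_ord => <-.
apply: ler_sum => sg _.
have nw0 : ~~ won (updf sg e i0) bt r i e.
  by apply/eqP => /won_slot[]; rewrite updf_same /= ltnn.
have uu (v : 'I_m) : updf (updf sg e i0) e v = updf sg e v.
  by apply/ffunP => x; rewrite !ffunE; case: eqP.
have nw (v : 'I_m) : (i <= v)%N -> ~~ won (updf sg e v) bt r i e.
  by move=> iv; apply/eqP => /won_slot[]; rewrite updf_same ltnNge iv.
apply: le_trans (_ : \sum_(v < m | (i <= v)%N) H (updf sg e i0) r <= _).
  rewrite sumr_const -[leRHS]mulr_natl (_ : #|_| = (m - i)%N) //.
  exact: card_geq_ord (ltnW im).
rewrite big_mkcond; apply: ler_sum => v _; case: ifP => iv.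
  by rewrite nw // mul1r -(hH _ _ _ nw0 iv) uu.
by rewrite mulr_ge0 ?ler0n.
Qed.


(** Either [e'] arrives in slot [i], and [sum_arrivals_le] applies, or [e'] is recycled, with
    probability 1/m. In the second case [e] must be an arrival, as a slot recycles only one item. *)
Lemma sum_collisions_le bt i e e' : (i < m)%N -> e != e' ->
  (m - i)%:R * (\sum_(sg : slots) \sum_(r : recs)
     (offered sg bt r i e)%:R * (offered sg bt r i e')%:R * gain sg bt r i e) <=
  \sum_(sg : slots) \sum_(r : recs) (offered sg bt r i e)%:R * gain sg bt r i e.
Proof.
move=> im ee'.
have -> : \sum_(sg : slots) \sum_(r : recs) (offered sg bt r i e)%:R * gain sg bt r i e =
    \sum_(sg : slots) \sum_(r : recs)
      (~~ won sg bt r i e')%:R * ((offered sg bt r i e)%:R * gain sg bt r i e) +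
    \sum_(sg : slots) \sum_(r : recs)
      (won sg bt r i e')%:R * ((offered sg bt r i e)%:R * gain sg bt r i e).
  rewrite -big_split; apply: eq_bigr => sg _; rewrite -big_split; apply: eq_bigr => r _ /=.
  by rewrite -mulrDl; case: (won _ _ _ _ e'); rewrite ?add0r ?addr0 mul1r.
have -> : \sum_(sg : slots) \sum_(r : recs)
     (offered sg bt r i e)%:R * (offered sg bt r i e')%:R * gain sg bt r i e =
    \sum_(sg : slots) \sum_(r : recs)
      (sg e' == i :> nat)%:R * ((offered sg bt r i e)%:R * gain sg bt r i e) +
    \sum_(sg : slots) \sum_(r : recs)
      (recycled sg bt r i e')%:R * ((sg e == i :> nat)%:R * gain sg bt r i e).
  rewrite -big_split; apply: eq_bigr => sg _; rewrite -big_split; apply: eq_bigr => r _ /=.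
  rewrite (offeredE _ _ _ _ e') mulrDr mulrDl; congr (_ + _); first by rewrite mulrAC mulrC.
  rewrite mulrAC mulrC offeredE mulrDl.
  case: (boolP (recycled sg bt r i e')) => [/eqP re'|_]; last by rewrite !mul0r.
  rewrite !mul1r /recycled re' (_ : Some e' == Some e = false) ?mul0r ?addr0 //.
  by apply/eqP => -[] /eqP; rewrite eq_sym (negPf ee').
rewrite mulrDr; apply: lerD.
  apply: (sum_arrivals_le (H := fun sg r => (offered sg bt r i e)%:R * gain sg bt r i e)) => //.
    by move=> sg r; rewrite mulr_ge0 ?ler0n ?gain_ge0.
  move=> sg r v nw iv; have [ec ew] := move_item nw iv.
  by rewrite /offered /recycled /gain /value ec ew updf_other.
apply: le_trans (_ : m%:R * (\sum_(sg : slots) \sum_(r : recs)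
   (recycled sg bt r i e')%:R * ((sg e == i :> nat)%:R * gain sg bt r i e)) <= _).
  apply: ler_wpM2r; last by rewrite ler_nat leq_subr.
  by do 2![apply: sumr_ge0 => ? _]; rewrite !mulr_ge0 ?ler0n ?gain_ge0.
rewrite mulr_sumr; apply: ler_sum => sg _.
rewrite sum_recycled //; last by move=> r r' rr; rewrite (gain_recycle _ _ _ rr).
apply: ler_sum => r _; rewrite offeredE mulrDl mulrDr lerDl.
by rewrite !mulr_ge0 ?ler0n ?gain_ge0.
Qed.

Lemma value_step sg bt r i (A : {set 'I_n}) :
  \sum_(e in A) (offered sg bt r i e)%:R * gain sg bt r i e *
     (1 - \sum_(e' in A | e' != e) (offered sg bt r i e')%:R) <=
  value sg bt r i.+1 - value sg bt r i.
Proof.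
have mono : value sg bt r i <= value sg bt r i.+1.
  exact: (cells_value_mono k matI f_ge0 f_mono d_gt0 (binned sg bt) (ext r) i).
apply: pairs_collide; rewrite ?subr_ge0 // => e; first exact: gain_ge0.
move=> oe; rewrite /gain ge_max subr_ge0 mono /= lerD2r.
case/orP: oe => [/eqP se|/eqP re].
  apply: (cells_value_item k matI f_ge0 f_mono d_gt0).
  by rewrite (mem_slot_items d_gt0 ord_all) ?ltn_ord //; apply/eqP.
exact: (cells_value_recycled matI f_ge0 f_mono d_gt0).
Qed.

Variables (A : {set 'I_n}) (b : nat).
Hypotheses (AI : A \in I) (cardA : #|A| = k) (b_gt0 : (0 < b)%N) (m_gt0 : (0 < m)%N).

(** While at least [b * k] slots remain, each of the at most [k] other elements of [A] collides with
    [e] on a fraction at most 1/(b k) of the offers of [e]; together they cost the factor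
    [1 - b%:R^-1]. *)
Lemma expected_step bt i : (i + b * k <= m)%N -> (i < m)%N ->
  (1 - b%:R^-1) / m%:R * (\sum_(sg : slots) \sum_(r : recs) (f A - 2 * value sg bt r i)) <=
  \sum_(sg : slots) \sum_(r : recs) (value sg bt r i.+1 - value sg bt r i).
Proof.
move=> im im'.
have b0 : 0 < (b%:R : R) by rewrite ltr0n.
have m0 : 0 < (m%:R : R) by rewrite ltr0n.
have b1 : 0 <= 1 - (b%:R : R)^-1 by rewrite subr_ge0 invf_le1 // ler1n.
pose U e : R := \sum_(sg : slots) \sum_(r : recs) (offered sg bt r i e)%:R * gain sg bt r i e.
have U0 e : 0 <= U e.
  by do 2![apply: sumr_ge0 => ? _]; rewrite !mulr_ge0 ?ler0n ?gain_ge0.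
have coll e : e \in A -> \sum_(sg : slots) \sum_(r : recs)
    (offered sg bt r i e)%:R * gain sg bt r i e *
      (\sum_(e' in A | e' != e) (offered sg bt r i e')%:R) <= b%:R^-1 * U e.
  move=> eA; pose V e' : R := \sum_(sg : slots) \sum_(r : recs)
     (offered sg bt r i e)%:R * (offered sg bt r i e')%:R * gain sg bt r i e.
  have -> : \sum_(sg : slots) \sum_(r : recs) (offered sg bt r i e)%:R * gain sg bt r i e *
      (\sum_(e' in A | e' != e) (offered sg bt r i e')%:R) = \sum_(e' in A | e' != e) V e'.
    rewrite /V [RHS]exchange_big /=; apply: eq_bigr => sg _.
    rewrite [RHS]exchange_big /=; apply: eq_bigr => r _.
    by rewrite mulr_sumr; apply: eq_bigr => e' _; rewrite mulrAC.
  have kA : (0 < k)%N by rewrite -cardA; apply/card_gt0P; exists e.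
  rewrite -(ler_pM2l b0) mulVKf ?gt_eqF // mulr_sumr.
  have k0 : 0 < (k%:R : R) by rewrite ltr0n.
  apply: le_trans (_ : \sum_(e' in A | e' != e) k%:R^-1 * U e <= _).
    apply: ler_sum => e' /andP[_ ne]; rewrite -(ler_pM2l k0) mulVKf ?gt_eqF //.
    apply: le_trans (sum_collisions_le bt im' (_ : e != e')); last by rewrite eq_sym.
    rewrite mulrA -natrM; apply: ler_wpM2r; last by rewrite ler_nat; lia.
    by do 2![apply: sumr_ge0 => ? _]; rewrite !mulr_ge0 ?ler0n ?gain_ge0.
  rewrite sumr_const -[leLHS]mulr_natl mulrA ler_piMl // ler_pdivrMr // mul1r ler_nat -cardA.
  by apply: subset_leq_card; apply/subsetP => x /andP[].
apply: le_trans (_ : \sum_(e in A) (1 - b%:R^-1) * U e <= _); last first.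
  apply: le_trans (_ : \sum_(sg : slots) \sum_(r : recs) \sum_(e in A)
     (offered sg bt r i e)%:R * gain sg bt r i e *
     (1 - \sum_(e' in A | e' != e) (offered sg bt r i e')%:R) <= _); last first.
    by apply: ler_sum => sg _; apply: ler_sum => r _; exact: value_step.
  under [leRHS]eq_bigr => sg _ do rewrite exchange_big /=.
  rewrite exchange_big /=; apply: ler_sum => e eA.
  under eq_bigr => sg _ do under eq_bigr => r _ do rewrite mulrBr mulr1.
  under eq_bigr => sg _ do rewrite sumrB.
  by rewrite sumrB mulrBl mul1r; apply: lerB => //; exact: coll.
rewrite -mulr_sumr mulrAC -mulrA ler_wpM2l // ler_pdivrMr // mulrC mulr_sumr.
apply: le_trans (_ : \sum_(e in A) \sum_(sg : slots) \sum_(r : recs) gain sg bt r i e <= _).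
  rewrite [leRHS]exchange_big /=; apply: ler_sum => sg _; rewrite [leRHS]exchange_big /=.
  apply: ler_sum => r _.
  have := sum_gains matI f_ge0 f_mono d_gt0 (binned sg bt) (ext r) i f_sub rkI AI cardA.
  by move/le_trans; apply; apply: ler_sum => e _; rewrite le_max lexx orbT.
by apply: ler_sum => e _; exact: sum_offered_ge.
Qed.

End Averages.

(** * Expected value of the shortlist *)

(** The gap [M / 2 - E i] shrinks by the factor [1 - 2 * c] at each step. *)
Lemma linear_recurrence (R : realFieldType) (E : nat -> R) (c M : R) (i0 : nat) :
  0 <= E 0%N -> 0 <= 1 - 2 * c ->
  (forall i, (i < i0)%N -> c * (M - 2 * E i) <= E i.+1 - E i) ->
  M / 2 * (1 - (1 - 2 * c) ^+ i0) <= E i0.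
Proof.
move=> E0 c1; elim: i0 => [|i IH] h; first by rewrite expr0 subrr mulr0.
have {}IH := IH (fun j ji => h j (ltnW ji)); have := h i (ltnSn i).
move: IH; rewrite exprS; set q := (1 - 2 * c) ^+ i; set x := E i; set y := E i.+1 => h1 h2.
have h3 := ler_wpM2l c1 h1.
have -> : M / 2 * (1 - (1 - 2 * c) * q) = (1 - 2 * c) * (M / 2 * (1 - q)) + c * M by lra.
lra.
Qed.

Lemma best_ge (R : realType) (T : finType) (I : {set {set T}}) (f : {set T} -> R) (S X : {set T}) :
  S \in I -> S \subset X -> f S <= best I f X.
Proof. by move=> SI SX; apply: (le_bigmax_cond 0 f); rewrite SI. Qed.

Lemma best_ge0 (R : realType) (T : finType) (I : {set {set T}}) (f : {set T} -> R) (X : {set T}) :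
  0 <= best I f X.
Proof. exact: bigmax_ge_id. Qed.

Definition shortlisted n (cap : nat) (acc : seq 'I_n) : {set 'I_n} := [set x in take cap acc].

Section Expectation.
Variables (R : realType) (n : nat) (I : {set {set 'I_n}}) (f : {set 'I_n} -> R).
Variables (k d m : nat) (ord : seq 'I_n).
Hypotheses (matI : is_matroid I) (rkI : rk I = k).
Hypotheses (f_ge0 : nonnegative f) (f_mono : monotone f) (f_sub : submodular f).
Hypotheses (d_gt0 : (0 < d)%N) (ord_uniq : uniq ord) (ord_all : forall x, x \in ord).

Notation slots := {ffun 'I_n -> 'I_m}.
Notation subs := {ffun 'I_n -> 'I_d}.
Notation recs := {ffun 'I_m -> 'I_m}.
Implicit Types (sg : slots) (bt : subs) (r : recs).

Let cells sg bt r i := cells_at I f k d (binned ord sg bt) (ext r) i.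
Let wins sg bt r i := wins_at I f k d (binned ord sg bt) (ext r) i.
Let acc sg bt r i := accepted_at I f k d (binned ord sg bt) (ext r) i.
Let value sg bt r i : R := f (contents k (cells sg bt r i)).
Let final sg bt r : {set 'I_n} := contents k (cells sg bt r m).

Lemma value_mono sg bt r i j : (i <= j)%N -> value sg bt r i <= value sg bt r j.
Proof.
move/subnKC <-; elim: (j - i)%N => [|e IH]; first by rewrite addn0.
rewrite addnS; apply: le_trans IH _.
exact: (cells_value_mono k matI f_ge0 f_mono d_gt0).
Qed.

(** The sums are not normalised, so the recurrence runs with [f A] multiplied by the number of pairs
    of draws. The slots after [i0] serve only as slack against collisions. *)
Lemma expected_value bt (A : {set 'I_n}) (b i0 : nat) :
  A \in I -> #|A| = k -> (0 < b)%N -> (0 < k)%N -> (2 <= m)%N -> (i0 + b * k <= m)%N ->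
  let c : R := (1 - b%:R^-1) / m%:R in
  (\sum_(sg : slots) \sum_(r : recs) 1) * (f A / 2 * (1 - (1 - 2 * c) ^+ i0)) <=
  \sum_(sg : slots) \sum_(r : recs) value sg bt r m.
Proof.
move=> AI cA b0 k0 m2 im /=; set c : R := _ / m%:R.
apply: le_trans (_ : \sum_(sg : slots) \sum_(r : recs) value sg bt r i0 <= _); last first.
  by apply: ler_sum => sg _; apply: ler_sum => r _; apply: value_mono; lia.
have m0 : 0 < (m%:R : R) by rewrite ltr0n; lia.
have := @linear_recurrence R (fun i => \sum_(sg : slots) \sum_(r : recs) value sg bt r i) c
  ((\sum_(sg : slots) \sum_(r : recs) 1) * f A) i0; rewrite -!mulrA; apply.
- by do 2![apply: sumr_ge0 => ? _]; exact: f_ge0.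
- rewrite subr_ge0 /c mulrA ler_pdivrMr // mul1r.
  have : 0 <= (b%:R^-1 : R) by rewrite invr_ge0 ler0n.
  have : 2 <= (m%:R : R) by rewrite ler_nat.
  lra.
- move=> i ii0.
  have := expected_step matI rkI f_ge0 f_mono f_sub d_gt0 ord_uniq ord_all AI cA b0.
  have m_gt0 : (0 < m)%N by lia.
  move/(_ m m_gt0 bt i (ltac:(lia)) (ltac:(lia))).
  rewrite -/c; set X := \sum_sg \sum_r (_ - _); set Y := \sum_sg \sum_r (_ - _).
  have -> : X = (\sum_(sg : slots) \sum_(r : recs) 1) * f A -
      2 * (\sum_(sg : slots) \sum_(r : recs) value sg bt r i).
    rewrite /X mulr_suml mulr_sumr -sumrB; apply: eq_bigr => sg _.
    rewrite mulr_suml mulr_sumr -sumrB; apply: eq_bigr => r _.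
    by rewrite mul1r.
  have -> : Y = \sum_(sg : slots) \sum_(r : recs) value sg bt r i.+1 -
     \sum_(sg : slots) \sum_(r : recs) value sg bt r i.
    by rewrite /Y -sumrB; apply: eq_bigr => sg _; rewrite -sumrB.
  by [].
Qed.

Lemma final_pick sg bt r x : x \in final sg bt r ->
  slot_pick I f k d (binned ord sg bt) (ext r) (sg x) = Some x /\
  wins sg bt r m (sg x) = Some x.
Proof.
have [_ _ h _] := run_invariant k matI f_ge0 f_mono d_gt0 (binned ord sg bt) (ext r) m.
case/h=> j Wj; have [jm sj] : (j < m)%N /\ sg x = j :> nat.
  by apply: (wins_slot d_gt0 ord_all matI f_ge0 f_mono) Wj; exact: ltn_ord.
by rewrite /wins sj Wj -Wj /binned (wins_pick ord d_gt0).
Qed.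

Lemma final_indep sg bt r : final sg bt r \in I.
Proof. by have [] := run_invariant k matI f_ge0 f_mono d_gt0 (binned ord sg bt) (ext r) m. Qed.

(** A pointwise Markov bound: if the accepted items overflow [cap], the last subtracted term already
    exceeds the value. Otherwise only sample items are missing from the final set, and their shares
    are subtracted. *)
Lemma shortlist_value sg bt r cap : (0 < cap)%N ->
  value sg bt r m - \sum_(x | bt x == 0%N :> nat) marginal f (final sg bt r) x
     - (size (acc sg bt r m))%:R * value sg bt r m / cap%:R <=
  best I f (shortlisted cap (acc sg bt r m)).
Proof.
move=> cap0; have c0 : 0 < (cap%:R : R) by rewrite ltr0n.
have v0 : 0 <= value sg bt r m by exact: f_ge0.
have M0 : 0 <= \sum_(x | bt x == 0%N :> nat) marginal f (final sg bt r) x.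
  by apply: sumr_ge0 => x _; exact: marginal_ge0.
have [le_cap|gt_cap] := leqP (size (acc sg bt r m)) cap; last first.
  apply: le_trans (best_ge0 _ _ _); rewrite -addrA -opprD subr_le0 -mulrA mulrCA -[leLHS]mulr1.
  apply: (@le_trans _ _ (value sg bt r m * ((size (acc sg bt r m))%:R / cap%:R))).
    by rewrite ler_wpM2l // ler_pdivlMr // mul1r ler_nat ltnW.
  by rewrite lerDr.
pose X := [set x in acc sg bt r m].
apply: le_trans (_ : f (final sg bt r :&: X) <= _); last first.
  apply: best_ge; first by apply: indepS (final_indep sg bt r) => //; exact: subsetIl.
  by apply/subsetP => x; rewrite !inE take_oversize // => /andP[].
apply: le_trans (_ : value sg bt r m -
  \sum_(x | bt x == 0%N :> nat) marginal f (final sg bt r) x <= _).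
  by rewrite lerBlDr lerDl divr_ge0 ?mulr_ge0 ?ler0n.
rewrite lerBlDr -lerBlDl; apply: le_trans (loss_le_marginals f_mono f_sub _ _) _.
rewrite [leRHS]big_mkcond [leLHS]big_mkcond; apply: ler_sum => x _; case: ifP => xX; last first.
  by case: ifP => // _; exact: marginal_ge0.
case: eqP => // bx; case: (boolP (x \in final sg bt r)) => xS; last first.
  by rewrite marginal_notin.
case/negP: xX; have [_ Wx] := final_pick xS; rewrite inE.
apply: accepted_main Wx _ => //; rewrite (mem_main_part d_gt0 ord_all) ?ltn_ord //.
by rewrite eqxx lt0n; apply/eqP.
Qed.

(** If [x] is in the final set when placed in the sample, it is in the same final set from each of
    the [d] sub-bins. Hence the sample position carries at most a fraction 1/d of the total share of
    [x]. *)
Lemma expected_sample_loss sg r :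
  \sum_(bt : subs) \sum_(x | bt x == 0%N :> nat) marginal f (final sg bt r) x <=
  d%:R^-1 * \sum_(bt : subs) value sg bt r m.
Proof.
pose b0 : 'I_d := Ordinal d_gt0.
have d0 : 0 < (d%:R : R) by rewrite ltr0n.
apply: le_trans (_ : \sum_(bt : subs) d%:R^-1 * \sum_x marginal f (final sg bt r) x <= _); last first.
  rewrite mulr_sumr; apply: ler_sum => bt _; rewrite ler_wpM2l ?invr_ge0 ?ler0n //.
  by rewrite sum_marginals lerBlDr lerDl f_ge0.
under eq_bigr => bt _ do rewrite big_mkcond /=.
rewrite exchange_big -mulr_sumr [X in _ * X]exchange_big mulr_sumr /=.
apply: ler_sum => x _; rewrite -(ler_pM2l d0) mulVKf ?gt_eqF //.
rewrite -(ler_pM2l d0).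
have := sum_updf_at (fun bt => marginal f (final sg bt r) x) x b0; rewrite card_ord.
have -> : \sum_(bt : subs) (bt x == b0)%:R * marginal f (final sg bt r) x =
    \sum_(bt : subs) (if bt x == 0%N :> nat then marginal f (final sg bt r) x else 0).
  apply: eq_bigr => bt _; rewrite -val_eqE /=.
  by case: ifP => _; rewrite ?mul1r ?mul0r.
move=> <-; rewrite mulr_sumr.
have := sum_updf (fun bt => marginal f (final sg bt r) x) x; rewrite card_ord => <-.
apply: ler_sum => bt _; rewrite mulr_natl -[X in _ *+ X](card_ord d) -sumr_const.
apply: ler_sum => v _; case: (boolP (x \in final sg (updf bt x b0) r)) => xS; last first.
  by rewrite (marginal_notin _ xS) marginal_ge0.
have [px _] := final_pick xS.
suff -> : final sg (updf bt x v) r = final sg (updf bt x b0) r by [].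
rewrite /final /cells /binned.
have bd (w : subs) y : (val (w y) < d)%N by exact: ltn_ord.
have eqb y : y != x -> val (updf bt x v y) = val (updf bt x b0 y).
  by move=> yx; rewrite !updf_other.
have b00 : val (updf bt x b0 x) = 0%N by rewrite updf_same.
by have [-> _] := move_sample_winner d_gt0 ord_uniq ord_all m (bd _) (bd _) eqb b00 px.
Qed.

(** A near miss in one of the [d.-1] main sub-bins is charged to the assignment with that item
    demoted. Demotion keeps the final value, which is why the weight is harmless, and makes the item
    the unique top of its sample. *)
Lemma expected_near_misses sg r j : (j < m)%N ->
  \sum_(bt : subs) (count (near_misses I f k d (binned ord sg bt) (ext r) j)
      (main_part d (binned ord sg bt) j))%:R * value sg bt r m <=
  (d.-1)%:R * \sum_(bt : subs) value sg bt r m.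
Proof.
move=> jm; pose b0 : 'I_d := Ordinal d_gt0.
have d0 : 0 < (d%:R : R) by rewrite ltr0n.
pose near bt x := (x \in main_part d (binned ord sg bt) j) &&
   near_misses I f k d (binned ord sg bt) (ext r) j x.
pose top1 bt x := (x \in sample_part d (binned ord sg bt) j) &&
   [forall y, (y \in sample_part d (binned ord sg bt) j) && (y != x) ==>
     (gain_value I f k (cells sg bt r j) y < gain_value I f k (cells sg bt r j) x)].
have top1_uniq bt : \sum_x (top1 bt x)%:R <= 1 :> R.
  case: (pickP (top1 bt)) => [x tx|nt]; last by rewrite big1 // => x _; rewrite nt.
  rewrite (bigD1 x) //= tx big1 ?addr0 // => y yx.
  case: (boolP (top1 bt y)) => // /andP[ys /forallP/(_ x)].
  case/andP: tx => xs /forallP/(_ y); rewrite ys yx xs eq_sym yx /= => h1 h2.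
  by have := lt_trans h1 h2; rewrite ltxx.
have countE bt : (count (near_misses I f k d (binned ord sg bt) (ext r) j)
      (main_part d (binned ord sg bt) j))%:R = \sum_x (near bt x)%:R :> R.
  rewrite -sum1_count natr_sum big_mkcond /= big_uniq /=; last first.
    by apply: (uniq_main_part d_gt0) => // x; exact: ltn_ord.
  rewrite big_mkcond /=; apply: eq_bigr => x _; rewrite /near.
  by case: (x \in _); case: near_misses.
have demote bt x (v : 'I_d) : near (updf bt x v) x ->
    [/\ v != b0, top1 (updf bt x b0) x &
        final sg (updf bt x v) r = final sg (updf bt x b0) r].
  case/andP=> xm nm.
  have bd (w : subs) y : (val (w y) < d)%N by exact: ltn_ord.
  have := xm; rewrite (mem_main_part d_gt0 ord_all) // updf_same => /andP[/eqP sx v0].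
  have eqb y : y != x -> val (updf bt x b0 y) = val (updf bt x v y).
    by move=> yx; rewrite !updf_other.
  have b00 : val (updf bt x b0 x) = 0%N by rewrite updf_same.
  rewrite -sx in xm nm.
  have dm := @demote_near_miss n d ord d_gt0 ord_all R I f k (ext r)
    (fun y => val (sg y)) (fun y => val (updf bt x v y)) (fun y => val (updf bt x b0 y)) x.
  split; first by rewrite -val_eqE /= -lt0n.
    rewrite /top1 (mem_sample_part d_gt0 ord_all) // sx eqxx b00 eqxx /=.
    apply/forallP => y; apply/implyP => /andP[ys yx]; rewrite -sx in ys *.
    exact: (near_miss_top d_gt0 ord_all (bd _) (bd _) eqb b00 xm nm).
  by rewrite /final /cells /binned; have [-> _] := dm m (bd _) (bd _) eqb b00 xm nm.
under eq_bigr => bt _ do rewrite countE mulr_suml.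
apply: le_trans (_ : \sum_(bt : subs) \sum_x (d.-1)%:R * ((top1 bt x && (bt x == b0))%:R * value sg bt r m) <= _); last first.
  rewrite mulr_sumr; apply: ler_sum => bt _; rewrite -mulr_sumr ler_wpM2l ?ler0n //.
  rewrite -mulr_suml ler_piMl ?f_ge0 //; apply: le_trans (top1_uniq bt).
  by apply: ler_sum => x _; case: (top1 bt x) => //=; case: (_ == _).
rewrite exchange_big [leRHS]exchange_big; apply: ler_sum => x _ /=.
rewrite -mulr_sumr -(ler_pM2l d0).
have := sum_updf (fun bt => (near bt x)%:R * value sg bt r m) x; rewrite card_ord => <-.
rewrite mulrCA.
have := sum_updf_at (fun bt => (top1 bt x)%:R * value sg bt r m) x b0; rewrite card_ord.
have -> : \sum_(bt : subs) (bt x == b0)%:R * ((top1 bt x)%:R * value sg bt r m) =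
  \sum_(bt : subs) (top1 bt x && (bt x == b0))%:R * value sg bt r m.
  by apply: eq_bigr => bt _; rewrite mulrA -natrM mulnb andbC.
move=> <-; rewrite mulr_sumr; apply: ler_sum => bt _.
set Z := _ * value _ _ _ _.
have Z0 : 0 <= Z by rewrite mulr_ge0 ?ler0n ?f_ge0.
apply: le_trans (_ : \sum_(v | v != b0) Z <= _); last first.
  rewrite sumr_const -[leLHS]mulr_natl ler_wpM2r // ler_nat.
  by rewrite cardC1 card_ord.
rewrite [leRHS]big_mkcond; apply: ler_sum => v _.
case: (boolP (near (updf bt x v) x)) => [/demote[-> t1 e]|_]; last first.
  by rewrite mul0r; case: ifP.
by rewrite /Z t1 !mul1r /value -/(final _ _ _) e.
Qed.

Lemma expected_shortlist sg r : (0 < m)%N ->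
  (1 - 2 * d%:R^-1) * \sum_(bt : subs) value sg bt r m <=
  \sum_(bt : subs) best I f (shortlisted (m * d.+1 * d) (acc sg bt r m)).
Proof.
move=> m0; have cap0 : (0 < m * d.+1 * d)%N by rewrite !muln_gt0 m0 d_gt0.
have c0 : 0 < ((m * d.+1 * d)%:R : R) by rewrite ltr0n.
apply: le_trans (ler_sum _ (fun bt _ => shortlist_value sg bt r cap0)).
rewrite !sumrB -mulr_suml.
have h1 := expected_sample_loss sg r.
set V := \sum_bt value sg bt r m in h1 *.
have : \sum_(bt : subs) (size (acc sg bt r m))%:R * value sg bt r m <= (m * d.+1)%:R * V.
  apply: le_trans (_ : \sum_(bt : subs) \sum_(j < m)
     (2 * value sg bt r m + (count (near_misses I f k d (binned ord sg bt) (ext r) j)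
      (main_part d (binned ord sg bt) j))%:R * value sg bt r m) <= _).
    apply: ler_sum => bt _.
    under [leRHS]eq_bigr => j _ do rewrite -mulrDl -natrD.
    rewrite -mulr_suml ler_wpM2r ?f_ge0 // -natr_sum ler_nat.
    exact: size_accepted.
  rewrite exchange_big /= natrM -mulrA.
  have -> : m%:R * (d.+1%:R * V) = \sum_(j < m) (d.+1%:R * V).
    by rewrite sumr_const card_ord mulr_natl.
  apply: ler_sum => j _; rewrite big_split /= -mulr_sumr.
  have := expected_near_misses sg r (ltn_ord j); rewrite -/V => h.
  (* Per slot: the first accepted item, the winner, and [d.-1] near misses on average. *)
  have -> : d.+1%:R * V = 2 * V + d.-1%:R * V.
    by rewrite -mulrDl -natrD add2n -[in LHS](prednK d_gt0).
  by rewrite lerD2l.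
rewrite -(ler_pM2r (_ : 0 < ((m * d.+1 * d)%:R : R)^-1)) ?invr_gt0 //.
rewrite [(m * d.+1 * d)%:R]natrM invfM.
have md0 : ((m * d.+1)%:R : R) != 0 by rewrite pnatr_eq0 muln_eq0 negb_or -!lt0n m0.
rewrite [leRHS]mulrACA mulfV // mul1r mulrBl mul1r [V * _]mulrC.
move: h1; set S1 := \sum_(bt : subs) \sum_(x | _) _; set S2 := (\sum_(bt : subs) _) * _.
by rewrite -mulrA; set y := _^-1 * V; lra.
Qed.

End Expectation.

(** * Program logic *)

Definition code (l : seq instr) : cmd := foldr (fun i c => Seq (Do i) c) Skip l.

Section Semantics.
Variables (R : realType) (n : nat) (I : {set {set 'I_n}}) (f : {set 'I_n} -> R).
Variables (s : 'S_n) (q : nat).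
Notation config := (config R n).
Notation memory := (memory R).

(** Halting and size are required of every outcome, the value only on average. Every budget from [B]
    on is covered because a halted configuration stays put; so bounds on the branches can be padded
    to a common [B]. *)
Definition good (B : nat) (c : config) (v : R) : Prop := forall N, (B <= N)%N ->
  all (fun o => halted o.2 && (#|shortlist o.2| <= q)%N) (outcomes I f s N c) /\
  v <= \sum_(o <- outcomes I f s N c) o.1 * best I f (shortlist o.2).

Lemma good_le B B' c v : good B c v -> (B <= B')%N -> good B' c v.
Proof. by move=> h BB N /(leq_trans BB); exact: h. Qed.

Lemma good_halted t m (A : {set 'I_n}) v : (#|A| <= q)%N -> v <= best I f A -> good 0 (Config [::] t m A) v.
Proof.
move=> Aq vA N _.
have [w [-> w1]] : exists w : R, outcomes I f s N (Config [::] t m A) = [:: (w, Config [::] t m A)] /\ w = 1.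
  elim: N => [|N [w [IH w1]]]; first by exists 1.
  by exists (w / 1); rewrite /= IH /= w1 divr1.
by rewrite big_seq1 /= Aq w1 mul1r.
Qed.

Lemma good_step B c (l : seq nat) (g : nat -> config) (v : nat -> R) :
  step I f s c = [seq g x | x <- l] -> {in l, forall x, good B (g x) (v x)} ->
  good B.+1 c ((\sum_(x <- l) v x) / (size l)%:R).
Proof.
move=> ec hl [//|N] BN /=; rewrite ec size_map.
have {}hl x : x \in l -> good B (g x) (v x) by exact: hl.
set z : R := (size l)%:R; have z0 : 0 <= z^-1 by rewrite invr_ge0 ler0n.
(* The number of branches is generalised first: it must remain the denominator while the list
   shrinks. *)
clearbody z; elim: l {ec} hl => [|x l IH] hl /=; first by rewrite !big_nil mul0r.
have [h1 h2] := hl x (mem_head x l) N BN.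
have [|h3 h4] := IH; first by move=> y yl; apply: hl; rewrite in_cons yl orbT.
rewrite all_cat h3 andbT all_map; split; first exact: h1.
rewrite big_cat big_cons mulrDl /=; apply: lerD h4; rewrite big_map /=.
under eq_bigr => o _ do rewrite mulrAC.
by rewrite -mulr_suml ler_wpM2r.
Qed.

Lemma good_step1 B c c' v : step I f s c = [:: c'] -> good B c' v -> good B.+1 c v.
Proof.
move=> ec h; have := @good_step B c [:: 0%N] (fun=> c') (fun=> v) ec.
by rewrite big_seq1 divr1; apply.
Qed.

Lemma good_while_false B b c k t m A v : ~~ eval_test b m ->
  good B (Config k t m A) v -> good B.+1 (Config (While b c :: k) t m A) v.
Proof. by move=> /negPf e; apply: good_step1; rewrite /= e. Qed.

Lemma good_while_true B b c k t m A v : eval_test b m ->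
  good B (Config [:: c, While b c & k] t m A) v -> good B.+1 (Config (While b c :: k) t m A) v.
Proof. by move=> e; apply: good_step1; rewrite /= e. Qed.

Lemma good_seq B c d k t m A v :
  good B (Config [:: c, d & k] t m A) v -> good B.+1 (Config (Seq c d :: k) t m A) v.
Proof. exact: good_step1. Qed.

(* A Hoare triple with step budget [C], in continuation form so that it composes
   with random draws. *)
Definition runs (C : nat) (cm : cmd) (t : nat) (m : memory) (A : {set 'I_n})
    (Q : nat -> memory -> {set 'I_n} -> Prop) : Prop :=
  forall k B v, (forall t' m' A', Q t' m' A' -> good B (Config k t' m' A') v) ->
    good (C + B) (Config (cm :: k) t m A) v.

Lemma runs_le C C' cm t m A Q : (C <= C')%N -> runs C cm t m A Q -> runs C' cm t m A Q.
Proof. by move=> CC h k B v /h/good_le; apply; rewrite leq_add2r. Qed.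

Lemma runs_conseq C cm t m A (Q Q' : nat -> memory -> {set 'I_n} -> Prop) :
  (forall t' m' A', Q t' m' A' -> Q' t' m' A') -> runs C cm t m A Q -> runs C cm t m A Q'.
Proof. by move=> QQ h k B v hQ; apply: h => t' m' A' /QQ; exact: hQ. Qed.

Lemma runs_skip t m A (Q : nat -> memory -> {set 'I_n} -> Prop) :
  Q t m A -> runs 1 Skip t m A Q.
Proof. by move=> h k B v hQ; apply: good_step1; [|apply: hQ h]. Qed.

Lemma runs_seq C1 C2 c d t m A Q :
  runs C1 c t m A (fun t' m' A' => runs C2 d t' m' A' Q) -> runs (C1 + C2).+1 (Seq c d) t m A Q.
Proof.
move=> h k B v hQ; rewrite addSn; apply: good_seq.
rewrite -addnA; apply: h => t' m' A'; exact.
Qed.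

Definition execs t (l : seq instr) (m : memory) : memory :=
  foldl (fun m i => exec I f s t i m) m l.

Lemma runs_code l t m A (Q : nat -> memory -> {set 'I_n} -> Prop) :
  Q t (execs t l m) A -> runs (2 * size l).+1 (code l) t m A Q.
Proof.
elim: l m => [|i l IH] m h /=; first exact: runs_skip.
rewrite mulnS; apply: (runs_le (C := (1 + (2 * size l).+1).+1)); first by lia.
apply: runs_seq => k B v hQ; apply: good_step1; first by [].
by apply: hQ; exact: IH.
Qed.

Lemma runs_if C b c d t m A Q :
  runs C (if eval_test b m then c else d) t m A Q -> runs C.+1 (If b c d) t m A Q.
Proof.
move=> h k B v hQ; rewrite addSn; apply: good_step1; first by [].
exact: h.
Qed.

Lemma runs_while_false b c t m A (Q : nat -> memory -> {set 'I_n} -> Prop) :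
  ~~ eval_test b m -> Q t m A -> runs 1 (While b c) t m A Q.
Proof. by move=> e h k B v hQ; apply: good_while_false => //; exact: hQ. Qed.

Lemma runs_while_true C1 C2 b c t m A Q : eval_test b m ->
  runs C1 c t m A (fun t' m' A' => runs C2 (While b c) t' m' A' Q) ->
  runs (C1 + C2).+1 (While b c) t m A Q.
Proof.
move=> e h k B v hQ; rewrite addSn; apply: good_while_true => //.
rewrite -addnA; apply: h => t' m' A'; exact.
Qed.

Lemma runs_decide x t m A (Q : nat -> memory -> {set 'I_n} -> Prop) :
  Q t.+1 m (if nvar m x == 0%N then A else A :|: [set s j | j : 'I_n & j == t :> nat]) ->
  runs 1 (Decide x) t m A Q.
Proof. by move=> h k B v hQ; apply: good_step1; [|apply: hQ h]. Qed.

(** * Conditional expectations along a sequence of draws *)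

Section Draws.
Variables (N M : nat).
(** Past draws come from [g], future ones from [g']; averaging over [g'] gives the conditional
    expectation after [j] draws, and [average_combine] is its tower property. *)
Definition combine (j : nat) (g g' : {ffun 'I_N -> 'I_M}) : {ffun 'I_N -> 'I_M} :=
  [ffun x : 'I_N => if (x < j)%N then g x else g' x].

Definition average (W : {ffun 'I_N -> 'I_M} -> R) : R :=
  (\sum_g W g) / (#|{: {ffun 'I_N -> 'I_M}}|)%:R.

Lemma average_combine (W : {ffun 'I_N -> 'I_M} -> R) (j : 'I_N) g : (0 < M)%N ->
  (\sum_(v < M) average (fun g' => W (combine j.+1 (updf g j v) g'))) / M%:R =
  average (fun g' => W (combine j g g')).
Proof.
move=> M0; rewrite -mulr_suml mulrAC; congr (_ / _).
rewrite exchange_big /=.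
have := sum_updf (fun g' => W (combine j g g')) j; rewrite card_ord.
have -> : \sum_(g' : {ffun 'I_N -> 'I_M}) \sum_v W (combine j g (updf g' j v)) =
    \sum_(g' : {ffun 'I_N -> 'I_M}) \sum_v W (combine j.+1 (updf g j v) g').
  apply: eq_bigr => g' _; apply: eq_bigr => v _; congr W; apply/ffunP => x.
  rewrite !ffunE ltnS [(x <= j)%N]leq_eqVlt val_eqE; case: (eqVneq x j) => [->|_] //=.
  by rewrite ltnn.
by move=> ->; rewrite mulrAC mulfV ?mul1r // pnatr_eq0 -lt0n.
Qed.

Lemma combine_full g g' : combine N g g' = g.
Proof. by apply/ffunP => x; rewrite ffunE ltn_ord. Qed.

Lemma average_const (x : R) : (0 < M)%N -> average (fun=> x) = x.
Proof.
move=> M0; rewrite /average sumr_const -[x in LHS]mulr1 -mulrnAr.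
rewrite -mulrA mulfV ?mulr1 // pnatr_eq0 -lt0n; apply/card_gt0P.
by exists [ffun=> Ordinal M0].
Qed.

End Draws.
End Semantics.

(** * The program *)

(* Natural variables: 0 = n, 1 = k, 2 = the constant 0, 3 = the constant 1,
   4 = number m of slots, 5 = bound on the shortlist, 6 = d; 10, 17 = slot and its
   successor; 11, 18 = sub-bin and its successor; 12 = items left in the bin;
   13 = arrival time; 14 = bin; 15 = number of items accepted; 20 = position of the
   candidate; 21, 27 = loop index and its successor; 26 = best cell for the
   candidate; 30, 31, 32, 33 = cell, winner, fresh and tied of the slot state;
   34 = decision; 22 to 25 and 35 = temporary.
   Real variables: 0 = the constant 0, 1 = value of the candidate, 3 = top of the
   slot state, 4 = value of the current set; 2 = temporary.
   Natural arrays: 0 = sizes of the bins, 1 = cells, 2 = indicator of the current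
   set, 3 = winners of the slots, 4 and 5 = draws of slots and sub-bins,
   6 = draws of recycled slots. *)
Definition draw (a vN vM : nat) : cmd :=
  Seq (code [:: NConst 21 0; NConst 27 1])
      (While (NLe 27 vN)
         (Seq (Rand 20 vM) (code [:: NStore a 21 20; NAdd 21 27 2; NAdd 27 27 3]))).

Section DrawLoop.
Variables (R : realType) (n : nat) (I : {set {set 'I_n}}) (f : {set 'I_n} -> R).
Variables (s : 'S_n) (q : nat).
Notation memory := (memory R).
Notation good := (good I f s q).

Lemma good_code B l k t (m : memory) A v :
  good B (Config k t (execs I f s t l m) A) v ->
  good ((2 * size l).+1 + B) (Config (code l :: k) t m A) v.
Proof.
move=> h; apply: (@runs_code _ _ I f s q l t m A
  (fun t' m' A' => t' = t /\ m' = execs I f s t l m /\ A' = A)) => // t' m' A' [-> [-> ->]].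
exact: h.
Qed.

Variables (a vN vM N M : nat) (t : nat) (m0 : memory) (A : {set 'I_n}) (k : seq cmd).
Variables (B : nat) (W : {ffun 'I_N -> 'I_M} -> R).
Let temps : seq nat := [:: 20; 21; 27]%N.
Let frame (m : memory) : Prop :=
  [/\ forall x, x \notin temps -> nvar m x = nvar m0 x, rvar m = rvar m0 &
      forall a', a' != a -> narr m a' = narr m0 a'].
Hypotheses (vNt : vN \notin temps) (vMt : vM \notin temps) (mN : nvar m0 vN = N)
  (mM : nvar m0 vM = M) (M_gt0 : (0 < M)%N) (mz : nvar m0 2 = 0%N) (mo : nvar m0 3 = 1%N).
Hypothesis m_a : narr m0 a =1 fun=> 0%N.
Hypothesis post : forall g m, frame m -> narr m a =1 ext g -> good B (Config k t m A) (W g).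

Lemma good_draw_loop e j g m : (j + e = N)%N -> frame m ->
  nvar m 21 = j -> nvar m 27 = j.+1 ->
  narr m a =1 (fun i => if (i < j)%N then ext g i else 0%N) ->
  good (10 * e + 1 + B)
    (Config (While (NLe 27 vN) (Seq (Rand 20 vM)
         (code [:: NStore a 21 20; NAdd 21 27 2; NAdd 27 27 3])) :: k) t m A)
    (average (fun g' => W (combine j g g'))).
Proof.
elim: e j g m => [|e IH] j g m je fr mj mJ ma.
  rewrite addn0 in je; rewrite {}je in mj mJ ma *; have [frN _ _] := fr.
  rewrite (_ : 10 * 0 + 1 + B = B.+1)%N //.
  apply: good_while_false; first by rewrite /= mJ frN // mN ltnn.
  rewrite /average; under eq_bigr => g' _ do rewrite combine_full.
  rewrite -/(average (fun=> W g)) average_const //; apply: post => // i.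
  rewrite ma; case: ltnP => // Ni; rewrite /ext; case: insubP => // i' iN _.
  by rewrite ltnNge Ni in iN.
have jN : (j < N)%N by lia.
have [frN frr fra] := fr.
rewrite (_ : 10 * e.+1 + 1 + B = (7 + (10 * e + 1 + B)).+3)%N; last by lia.
apply: good_while_true; first by rewrite /= mJ frN // mN jN.
apply: good_seq.
pose v x := if insub x is Some v' then
   average (fun g' => W (combine j.+1 (updf g (Ordinal jN) v') g')) else 0.
have /= <- := average_combine W (Ordinal jN) g M_gt0.
have -> : (\sum_(v0 < M) average (fun g' => W (combine j.+1 (updf g (Ordinal jN) v0) g'))) / M%:R
    = (\sum_(x <- iota 0 M) v x) / (size (iota 0 M))%:R.
  rewrite size_iota; congr (_ / _).
  rewrite -[in RHS](subn0 M) -/(index_iota 0 M) big_mkord; apply: eq_bigr => x _.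
  by rewrite /v valK.
apply: (@good_step _ _ _ _ _ _ _ _ _ (fun x =>
  Config (code [:: NStore a 21 20; NAdd 21 27 2; NAdd 27 27 3] :: _ :: k) t (set_nvar m 20 x) A)).
  by rewrite /= frN // mM (maxn_idPr M_gt0).
move=> x; rewrite mem_iota add0n => /andP[_ xM].
cbv beta; rewrite /v insubT.
apply: (@good_code (10 * e + 1 + B) [:: NStore a 21 20; NAdd 21 27 2; NAdd 27 27 3]).
apply: (IH j.+1); rewrite /= ?addSnnS //.
- split=> //=.
  + move=> y yt; rewrite /upd; move: (yt); rewrite !inE !negb_or => /and3P[/negPf-> /negPf-> /negPf->].
    exact: frN.
  + by move=> a' /negPf na; rewrite /upd na fra // na.
- by rewrite /upd /= mJ frN // mz addn0.
- by rewrite /upd /= mJ frN // mo addn1.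
- move=> i; rewrite /upd eqxx /= mj; case: eqP => [->|ij].
    by rewrite ltnSn -[X in ext _ X]/(val (Ordinal jN)) extE updf_same.
  rewrite ma ltnS [(i <= j)%N]leq_eqVlt (introF eqP ij) /=; case: ifP => // ij'.
  have iN : (i < N)%N by lia.
  rewrite -[i]/(val (Ordinal iN)) !extE updf_other //.
  by apply/eqP => -[].
Qed.

Lemma good_draw : good (10 * N + 7 + B) (Config (draw a vN vM :: k) t m0 A) (average W).
Proof.
rewrite (_ : 10 * N + 7 + B = (5 + (10 * N + 1 + B)).+1)%N; last by lia.
apply: good_seq; apply: (@good_code (10 * N + 1 + B) [:: NConst 21 0; NConst 27 1]).
have := @good_draw_loop N 0 [ffun=> Ordinal M_gt0].
have -> : average (fun g' => W (combine 0 [ffun=> Ordinal M_gt0] g')) = average W.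
  rewrite /average; congr (_ / _); apply: eq_bigr => g _; congr W.
  by apply/ffunP => x; rewrite ffunE ltn0.
apply=> //; split=> //= y yt; rewrite /upd; move: (yt).
by rewrite !inE !negb_or => /and3P[_ /negPf-> /negPf->].
Qed.

End DrawLoop.

(** The indicator array is patched and restored around the two queries instead of being rebuilt, so
    one candidate costs O(k) in all. The outgoing item is cleared before the candidate is set, so
    that the candidate survives if they coincide. *)
Definition eval_body : cmd :=
  Seq (code [:: NLoad 22 1 21; NSub 22 0 22; NLoad 24 2 22; NStore 2 22 2; NStore 2 20 3;
               Indep 25 2; Value 2 2])
      (Seq (If (NLe 3 25) (If (RLe 2 1) Skip (code [:: RAdd 1 2 0; NAdd 26 21 2])) Skip)
           (code [:: NStore 2 20 23; NStore 2 22 24; NAdd 21 27 2; NAdd 27 27 3])).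

Definition eval_prog : cmd :=
  Seq (code [:: RAdd 1 0 0; NConst 26 0; NConst 21 0; NConst 27 1; NLoad 23 2 20])
      (While (NLe 27 1) eval_body).

(** * Evaluating a candidate against all cells *)

Section Eval.
Variables (R : realType) (n : nat) (I : {set {set 'I_n}}) (f : {set 'I_n} -> R).
Variables (s : 'S_n) (q k : nat).
Notation memory := (memory R).
Notation runs := (runs I f s q).

(* [None] gets the position [n], at which the oracles ignore the indicator array,
   and the code 0 of the initial contents of arrays. *)
Definition pos (o : option 'I_n) : nat := if o is Some z then val ((s^-1)%g z) else n.
Definition enc (o : option 'I_n) : nat := (n - pos o)%N.
Definition indf (S : {set 'I_n}) (j : nat) : nat :=
  if insub j is Some j' then nat_of_bool (s j' \in S) else 0%N.

Lemma pos_le o : (pos o <= n)%N. Proof. by case: o => //= z; exact: ltnW. Qed.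

Lemma encK o : (n - enc o)%N = pos o. Proof. by rewrite /enc subKn ?pos_le. Qed.

Lemma enc_none : enc None = 0%N. Proof. by rewrite /enc /= subnn. Qed.

Lemma enc_gt0 o : (0 < enc o)%N = (o != None).
Proof. by rewrite /enc subn_gt0; case: o => [z|] /=; rewrite ?ltn_ord ?ltnn. Qed.

Lemma indfE S (j : 'I_n) : indf S j = (s j \in S) :> nat.
Proof. by rewrite /indf valK. Qed.

Lemma indf_ge S j : (n <= j)%N -> indf S j = 0%N.
Proof. by move=> nj; rewrite /indf insubF // ltnNge nj. Qed.

Lemma pos_eq (j : 'I_n) o : (pos o == j) = (o == Some (s j)).
Proof.
case: o => [z|] /=; last by apply/negbTE; rewrite gtn_eqF.
rewrite val_eqE; apply/eqP/eqP => [<-|[->]]; first by rewrite permKV.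
by rewrite permK.
Qed.

Lemma queried_indf t (g : nat -> nat) (S : {set 'I_n}) : (forall j : 'I_n, g j = indf S j) ->
  (forall z, z \in S -> (pos (Some z) <= t)%N) -> queried s t g = S.
Proof.
move=> gS St; apply/setP => z; apply/imsetP/idP => [[j]|zS].
  by rewrite inE gS indfE => /andP[_ jS] ->; move: jS; case: (s j \in S).
exists ((s^-1)%g z); last by rewrite permKV.
by rewrite inE gS indfE permKV zS andbT; exact: St.
Qed.

(** Clearing one position is enough because, by [inj_cells], the outgoing item occupies no other
    cell. *)
Lemma indf_upd (L : nat -> option 'I_n) p (x : option 'I_n) (j : 'I_n) : inj_cells k L -> (p < k)%N ->
  upd (upd (indf (contents k L)) (pos (L p)) 0%N) (pos x) 1%N j =
  indf (contents k (upd L p x)) j.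
Proof.
move=> inj pk; rewrite indfE /upd !(eq_sym (val j)) !pos_eq.
case: (eqVneq x (Some (s j))) => [->|xj].
  suff -> : s j \in contents k (upd L p (Some (s j))) by [].
  by apply/contentsP; exists p; rewrite // /upd eqxx.
case: (eqVneq (L p) (Some (s j))) => [Lp|Lp].
  suff /negPf-> : s j \notin contents k (upd L p x) by [].
  apply/contentsP => -[i ik]; rewrite /upd; case: (eqVneq i p) => [_ /eqP|ip Li].
    by rewrite (negPf xj).
  by move/eqP: ip; apply; apply: inj Li Lp.
rewrite indfE; congr nat_of_bool; apply/contentsP/contentsP => -[i ik Li]; exists i => //.
  by rewrite /upd; case: eqP => // ip; move: Lp; rewrite -ip Li eqxx.
by move: Li; rewrite /upd; case: eqP => // _ /eqP; rewrite (negPf xj).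
Qed.

Record ctx (L : nat -> option 'I_n) (m : memory) : Prop := Ctx {
  ctx_n : nvar m 0 = n;
  ctx_k : nvar m 1 = k;
  ctx_zero : nvar m 2 = 0%N;
  ctx_one : nvar m 3 = 1%N;
  ctx_rzero : rvar m 0 = 0;
  ctx_lst : narr m 1 =1 (fun p => enc (L p));
  ctx_ind : narr m 2 =1 indf (contents k L) }.

Definition agree (ns rs : seq nat) (m m' : memory) : Prop :=
  [/\ forall x, x \notin ns -> nvar m' x = nvar m x,
      forall x, x \notin rs -> rvar m' x = rvar m x &
      forall a, narr m' a =1 narr m a].

Lemma agree_ctx ns rs L m m' : agree ns rs m m' ->
  all (fun x => x \notin ns) [:: 0; 1; 2; 3]%N -> 0%N \notin rs -> ctx L m -> ctx L m'.
Proof.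
move=> [hn hr ha] /and5P[n0 n1 n2 n3 _] r0 [*]; split; rewrite ?hn ?hr // => i; rewrite ha //.
Qed.

Definition eval_ns : seq nat := [:: 21; 22; 23; 24; 25; 26; 27]%N.
Definition eval_rs : seq nat := [:: 1; 2]%N.

Variables (L : nat -> option 'I_n) (x : option 'I_n) (t : nat) (m0 : memory) (A : {set 'I_n}).
Hypotheses (inj : inj_cells k L) (Lt : forall z, z \in contents k L -> (pos (Some z) <= t)%N).
Hypotheses (xt : forall z, x = Some z -> (pos (Some z) <= t)%N).
Hypotheses (c0 : ctx L m0) (x0 : nvar m0 20 = pos x).

Let post t' (m' : memory) A' : Prop :=
  [/\ t' = t, A' = A, agree eval_ns eval_rs m0 m',
      rvar m' 1 = (best_swap I f k L x).1 & nvar m' 26 = (best_swap I f k L x).2].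

Let before j (m : memory) : Prop :=
  [/\ agree eval_ns eval_rs m0 m, nvar m 21 = j, nvar m 27 = j.+1,
      nvar m 23 = indf (contents k L) (pos x) &
      (rvar m 1, nvar m 26) = foldl (better_swap I f k L x) (0, 0%N) (iota 0 j)].

Lemma eval_body_runs j m : (j < k)%N -> before j m ->
  runs 40 eval_body t m A (fun t' m' A' => [/\ t' = t, A' = A & before j.+1 m']).
Proof.
move=> jk [fr mj mJ mo mv]; have [hn hr ha] := fr.
have cm : ctx L m by apply: agree_ctx fr _ _ c0.
have [en ek ez eo erz el ei] := cm.
have mx : nvar m 20 = pos x by rewrite hn.
have yE : (n - narr m 1 j)%N = pos (L j) by rewrite el encK.
pose S := contents k (upd L j x).
have qS : queried s t (upd (upd (narr m 2) (pos (L j)) 0%N) (pos x) 1%N) = S.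
  apply: queried_indf => [i|z]; last first.
    by case/contents_upd_sub; [exact: Lt | exact: xt].
  by rewrite -indf_upd // /upd; do 2!case: ifP => //.
apply: (runs_le (C := (15 + (8 + 9).+1).+1)); first by [].
apply: runs_seq; apply: (@runs_code _ _ I f s q [:: _; _; _; _; _; _; _]).
set m1 := execs _ _ _ _ _ _.
have m1n y : y \notin eval_ns -> nvar m1 y = nvar m y.
  by rewrite /m1 /= /upd => yn; do ?[case: eqP yn => [->//|_ yn]].
have m1r y : y \notin eval_rs -> rvar m1 y = rvar m y.
  by rewrite /m1 /= /upd => yn; do ?[case: eqP yn => [->//|_ yn]].
have m1j : nvar m1 21 = j by rewrite /m1 /= /upd /= mj.
have m1J : nvar m1 27 = j.+1 by rewrite /m1 /= /upd /= mJ.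
have m1y : nvar m1 22 = pos (L j) by rewrite /m1 /= /upd /= mj en yE.
have m1o : nvar m1 23 = indf (contents k L) (pos x) by rewrite /m1 /= /upd /= mo.
have m1p : nvar m1 24 = narr m 2 (pos (L j)) by rewrite /m1 /= /upd /= mj en yE.
have m1a a : narr m1 a = if a == 2%N then upd (upd (narr m 2) (pos (L j)) 0%N) (pos x) 1%N else narr m a.
  rewrite /m1 /= /upd; case: (eqVneq a 2%N) => [_|_] //=.
  by rewrite mj en yE mx ez eo.
have m1i : nvar m1 25 = (S \in I) by rewrite -qS /m1 /= /upd /= mj en yE mx ez eo.
have m1w : rvar m1 2 = f S by rewrite -qS /m1 /= /upd /= mj en yE mx ez eo.
have m1v : (rvar m1 1, nvar m1 26) = (rvar m 1, nvar m 26) by [].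
clearbody m1.
pose mid (t' : nat) (m' : memory) (A' : {set 'I_n}) : Prop :=
  [/\ t' = t, A' = A, agree [:: 26%N] [:: 1%N] m1 m' &
      (rvar m' 1, nvar m' 26) = better_swap I f k L x (rvar m1 1, nvar m1 26) j].
apply: runs_seq; apply: (runs_conseq (Q := mid)).
  move=> t' m' A' [-> -> [h1 h2 h3] hv].
  apply: (@runs_code _ _ I f s q [:: _; _; _; _]); split=> //; split.
  - split.
    + move=> y yn; rewrite /= /upd; do ?[case: eqP yn => [->//|_ yn]].
      by rewrite h1 ?m1n ?hn // inE; apply: contraNneq yn => ->.
    + move=> y yn; rewrite /= h2 ?m1r ?hr // inE; apply: contraNneq yn => -> //.
    + move=> a i; rewrite /= /upd; case: (eqVneq a 2%N) => [->|a2] /=; last first.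
        by rewrite h3 m1a (negPf a2) ha.
      rewrite !h1 // m1y m1o m1p m1n // mx !h3 m1a /= /upd -ha.
      case: (eqVneq i (pos (L j))) => [->//|_]; case: (eqVneq i (pos x)) => [->|_].
        by rewrite ei.
      by [].

  - by rewrite /= /upd /= !h1 // m1J m1n // ez addn0.
  - by rewrite /= /upd /= !h1 // m1J m1n // eo addn1.
  - by rewrite /= /upd /= h1.
  - by rewrite -[in RHS](addn1 j) iotaD foldl_cat /= -mv add0n -m1v -hv.
have svE : swap_value I f k L x j = if S \in I then f S else 0 by [].
(* A dependent set has swap value 0, which cannot beat a nonnegative running maximum; this justifies
   skipping it. *)
have v0 : 0 <= (rvar m1 1, nvar m1 26).1.
  rewrite m1v mv.
  suff gen l (vp : R * nat) : 0 <= vp.1 -> 0 <= (foldl (better_swap I f k L x) vp l).1.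
    exact: gen.
  elim: l vp => //= p l IH vp vp0; apply: IH; rewrite /better_swap; case: ltP => //= lt_v; exact/ltW/(le_lt_trans vp0 lt_v).
apply: runs_if; rewrite /eval_test m1i m1n // eo; case: ifP => SI; last first.
  apply: (runs_le (C := 1)); first by [].
  apply: runs_skip; split=> //; rewrite /better_swap svE.
  by move: SI; case: (S \in I) => // _; rewrite ltNge v0.
apply: runs_if; rewrite /eval_test m1w; case: ifP => le_v.
  apply: (runs_le (C := 1)); first by [].
  apply: runs_skip; split=> //; rewrite /better_swap svE.
  by move: SI; case: (S \in I) => // _; rewrite ltNge le_v.
apply: (runs_le (C := 5)); first by [].
apply: (@runs_code _ _ I f s q [:: _; _]); split=> //.
  split=> //= y; rewrite inE /upd => /negPf-> //.
rewrite /better_swap svE.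
move: SI; case: (S \in I) => // _; rewrite ltNge le_v /=.
by rewrite /upd /= m1w m1r // erz addr0 m1j m1n // ez addn0.
Qed.

Lemma eval_loop e j m : (j + e = k)%N -> before j m ->
  runs (41 * e + 1) (While (NLe 27 1) eval_body) t m A post.
Proof.
elim: e j m => [|e IH] j m je bm; have [fr mj mJ mo mv] := bm; have [hn _ _] := fr.
  rewrite addn0 in je; apply: runs_while_false.
    by rewrite /= mJ hn // (ctx_k c0) je ltnn.
  by split=> //; move: mv; rewrite je /best_swap => <-.
apply: (runs_le (C := (40 + (41 * e + 1)).+1)); first by lia.
apply: runs_while_true; first by rewrite /= mJ hn // (ctx_k c0); lia.
apply: runs_conseq (eval_body_runs (_ : (j < k)%N) bm) => [t' m' A' [-> -> bm']|]; last by lia.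
by apply: (IH j.+1) => //; lia.
Qed.

Lemma eval_runs : runs (41 * k + 13) eval_prog t m0 A post.
Proof.
apply: (runs_le (C := (11 + (41 * k + 1)).+1)); first by lia.
apply: runs_seq; apply: (@runs_code _ _ I f s q [:: _; _; _; _; _]).
apply: (eval_loop (j := 0)) => //; have [en ek ez eo erz el ei] := c0.
split=> //; last by rewrite /= /upd /= erz addr0.
  by split=> //= y; rewrite /upd => yn; do ?[case: eqP yn => [->//|_ yn]].
by rewrite /= /upd /= x0 ei.
Qed.

End Eval.

(** The slot state is updated even when the shortlist is full, so the cap affects the shortlist only
    and the run is the uncapped one of the analysis. *)
Definition accept_main : cmd :=
  Seq (code [:: RAdd 3 1 0; NAdd 30 26 2; NSub 31 0 13; NSub 32 0 13; NConst 33 0; NAdd 35 15 3])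
      (If (NLe 35 5) (code [:: NConst 34 1; NAdd 15 35 2]) Skip).

Definition accept_sample : cmd :=
  code [:: RAdd 3 1 0; NAdd 30 26 2; NSub 31 0 13; NSub 32 0 13; NConst 33 1].

Definition decision : cmd :=
  If (RLe 1 3)
    (If (NLe 3 33) (If (NLe 3 11) (If (RLe 3 1) accept_main Skip) Skip) Skip)
    (If (NLe 3 11) accept_main accept_sample).

Definition item_prog : cmd :=
  Seq (code [:: NAdd 20 13 2])
  (Seq eval_prog
  (Seq (code [:: NConst 34 0])
  (Seq decision
  (Seq (Decide 34) (code [:: NAdd 13 13 3; NSub 12 12 3]))))).

Definition sub_body : cmd :=
  Seq (code [:: NLoad 12 0 14])
  (Seq (While (NLe 3 12) item_prog) (code [:: NAdd 11 18 2; NAdd 18 18 3; NAdd 14 14 3])).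

Definition slot_body : cmd :=
  Seq (code [:: NLoad 20 6 10; NLoad 20 3 20; NSub 20 0 20])
  (Seq eval_prog
  (Seq (code [:: NConst 30 0; NConst 31 0; NConst 32 0; NConst 33 0; RAdd 3 4 0;
                NConst 11 0; NConst 18 1])
  (Seq (If (RLe 1 3) Skip (code [:: RAdd 3 1 0; NAdd 30 26 2; NSub 31 0 20]))
  (Seq (While (NLe 18 6) sub_body)
  (Seq (If (NLe 3 31)
          (code [:: NLoad 22 1 30; NSub 22 0 22; NStore 2 22 2; NSub 20 0 31; NStore 2 20 3;
                   NStore 1 30 31; RAdd 4 3 0]) Skip)
       (code [:: NStore 3 10 32; NAdd 10 17 2; NAdd 17 17 3])))))).

Ltac frame_tac := let y := fresh "y" in let yn := fresh "yn" in
  rewrite /upd => yn; do ?[case: eqP yn => [->//|_ yn]]; try done.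

Section Agree.
Variable R : realType.
Implicit Types m : memory R.

Lemma agree_trans ns rs m1 m2 m3 : agree ns rs m1 m2 -> agree ns rs m2 m3 -> agree ns rs m1 m3.
Proof.
move=> [h1 h2 h3] [h1' h2' h3']; split=> [y yn|y yn|a i]; first by rewrite h1' ?h1.
  by rewrite h2' ?h2.
by rewrite h3' h3.
Qed.

Lemma agree_sub ns rs ns' rs' m1 m2 : {subset ns <= ns'} -> {subset rs <= rs'} ->
  agree ns rs m1 m2 -> agree ns' rs' m1 m2.
Proof.
move=> sn sr [h1 h2 h3]; split=> // y yn; [apply: h1 | apply: h2];
  by apply: contra yn => /sn || apply: contra yn => /sr.
Qed.

End Agree.

(** * Processing the items of a bin *)

Section Items.
Variables (R : realType) (n : nat) (I : {set {set 'I_n}}) (f : {set 'I_n} -> R).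
Variables (s : 'S_n) (q k cap : nat).
Notation memory := (memory R).
Notation runs := (runs I f s q).
Notation pos := (pos s).
Notation enc := (enc s).

(** [live_tied_gt0] serves the tie rule: a tie is accepted at a value not above the old one, and
    [best_swap] names a genuine cell only when its value is positive. *)
Record live (st : slot_state R n) (acc : seq 'I_n) (t : nat) (m : memory) (A : {set 'I_n}) : Prop :=
  Live {
  live_top : rvar m 3 = top st;
  live_cell : nvar m 30 = cell st;
  live_winner : nvar m 31 = enc (winner st);
  live_fresh : nvar m 32 = enc (fresh st);
  live_tied : nvar m 33 = tied st;
  live_count : nvar m 15 = minn cap (size acc);
  live_list : A = shortlisted cap acc;
  live_clock : nvar m 13 = t;
  live_top_ge0 : 0 <= top st;
  live_tied_gt0 : tied st -> 0 < top st;
  live_cell_lt : winner st <> None -> (cell st < k)%N;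
  live_winner_lt : forall z, winner st = Some z -> (pos (Some z) < t)%N;
  live_fresh_lt : forall z, fresh st = Some z -> (pos (Some z) < t)%N }.

Lemma live_agree st acc t m m' A ns rs : agree ns rs m m' ->
  all (fun y => y \notin ns) [:: 30; 31; 32; 33; 15; 13]%N -> 3%N \notin rs ->
  live st acc t m A -> live st acc t m' A.
Proof.
move=> [hn hr _] /= /andP[n1 /andP[n2 /andP[n3 /andP[n4 /andP[n5 /andP[n6 _]]]]]] r3 [*].
by split=> //; rewrite ?hn ?hr.
Qed.

Definition item_ns : seq nat := eval_ns ++ [:: 12; 13; 15; 20; 30; 31; 32; 33; 34; 35]%N.
Definition item_rs : seq nat := [:: 1; 2; 3]%N.

Lemma eval_item_ns : {subset eval_ns <= item_ns}. Proof. exact/allP. Qed.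

Lemma eval_item_rs : {subset eval_rs <= item_rs}. Proof. exact/allP. Qed.

Variables (L : nat -> option 'I_n) (c : nat).
Hypothesis inj : inj_cells k L.

Definition ready (m : memory) : Prop := [/\ ctx s k L m, nvar m 5 = cap & nvar m 11 = c].

Lemma ready_agree m m' : agree item_ns item_rs m m' -> ready m -> ready m'.
Proof.
move=> ag [cm m5 mc]; split; first by apply: agree_ctx ag _ _ cm.
  by have [-> ] := ag.
by have [-> ] := ag.
Qed.

Lemma shortlisted_accept (acc : seq 'I_n) z : (size acc < cap)%N ->
  shortlisted cap (rcons acc z) = shortlisted cap acc :|: [set z].
Proof.
move=> h; rewrite /shortlisted !take_oversize ?size_rcons //; last exact: ltnW.
by apply/setP => y; rewrite !inE mem_rcons in_cons orbC.
Qed.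

Lemma shortlisted_full (acc : seq 'I_n) z : (cap <= size acc)%N ->
  shortlisted cap (rcons acc z) = shortlisted cap acc.
Proof. by move=> h; rewrite /shortlisted -cats1 takel_cat. Qed.

Definition item_post st acc t m0 t' (m : memory) A : Prop :=
  [/\ t' = t, agree item_ns item_rs m0 m, live st acc t m A & nvar m 12 = (nvar m0 12 - 1)%N].

Lemma item_runs st acc z m A t : ready m -> live st acc t m A -> pos (Some z) = t ->
  (forall w, w \in contents k L -> (pos (Some w) <= t)%N) ->
  runs (41 * k + 80) item_prog t m A
    (item_post (offer I f k L (0 < c)%N (st, acc) z).1 (offer I f k L (0 < c)%N (st, acc) z).2 t.+1 m).
Proof.
move=> rm lm zt Lt.
apply: (runs_le (C := (3 + (41 * k + 13 + (3 + (29 + (1 + 5).+1).+1).+1).+1).+1)); first by lia.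
apply: runs_seq; apply: (@runs_code _ _ I f s q [:: _]).
set m1 := execs _ _ _ _ _ _.
have ag1 : agree item_ns item_rs m m1 by split=> //= y; frame_tac.
have rm1 := ready_agree ag1 rm.
have lm1 : live st acc t m1 A by move: lm; case; split.
have m1x : nvar m1 20 = pos (Some z).
  by have [[_ _ ez _ _ _ _] _ _] := rm; rewrite /= /upd /= ez addn0 (live_clock lm).
have m1q : nvar m1 12 = nvar m 12 by [].
clearbody m1.
apply: runs_seq; have [cm1 _ _] := rm1.
apply: (@runs_conseq _ _ I f s q _ _ _ _ _ _ _ _ (@eval_runs _ _ I f s q k L (Some z) t m1 A inj Lt _ cm1 m1x)); last first.
  by move=> w [<-]; rewrite zt.
move=> _ m2 _ [-> -> ag2 vE bE].
have lm2 : live st acc t m2 A by apply: live_agree ag2 _ _ lm1.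
have m2q : nvar m2 12 = nvar m 12 by have [-> ] := ag2.
have {}ag2 : agree item_ns item_rs m m2.
  by apply: agree_trans ag1 (agree_sub eval_item_ns eval_item_rs ag2).
have rm2 := ready_agree ag2 rm.
apply: runs_seq; apply: (@runs_code _ _ I f s q [:: _]).
set m3 := execs _ _ _ _ _ _.
have ag3 : agree item_ns item_rs m m3.
  by apply: agree_trans ag2 _; split=> //= y; frame_tac.
have lm3 : live st acc t m3 A by move: lm2; case; split.
have m3d : nvar m3 34 = 0%N by [].
have m3q : nvar m3 12 = nvar m 12 by [].
have rm3 := ready_agree ag3 rm.
have {}vE : rvar m3 1 = (best_swap I f k L (Some z)).1 by [].
have {}bE : nvar m3 26 = (best_swap I f k L (Some z)).2 by [].
clearbody m3; clear m1 rm1 lm1 m1x m1q ag1 cm1 m2 lm2 m2q ag2 rm2.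
set st' := (offer _ _ _ _ _ _ _).1; set acc' := (offer _ _ _ _ _ _ _).2.
pose mid (t' : nat) (m' : memory) (A' : {set 'I_n}) : Prop :=
  [/\ t' = t, A' = A, agree item_ns item_rs m m', nvar m' 12 = nvar m 12 &
      live st' acc' t.+1 (set_nvar m' 13 t.+1)
        (if nvar m' 34 == 0%N then A else A :|: [set z]) /\ nvar m' 13 = t].
have sz : [set s j | j : 'I_n & j == t :> nat] = [set z].
  apply/setP => y; rewrite in_set1; apply/imsetP/eqP => [[j]|->].
    by rewrite inE -zt => /eqP/val_inj -> ->; rewrite permKV.
  by exists ((s^-1)%g z); rewrite ?permKV // inE -zt.
apply: runs_seq; apply: (runs_conseq (Q := mid)).
  move=> _ m4 _ [-> -> ag4 m4q [lm4 m4t]].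
  apply: runs_seq; apply: runs_decide; rewrite sz.
  apply: (@runs_code _ _ I f s q [:: _; _]).
  have [[_ _ _ eo _ _ _] _ _] := ready_agree ag4 rm.
  split=> //; last by rewrite /= /upd /= m4q eo.
    by apply: agree_trans ag4 _; split=> //= y; frame_tac.
  by move: lm4; case; split=> //; rewrite /= /upd /= m4t eo addn1.
have [[en _ ez eo erz _ _] ecap ec] := rm3.
have skip_ok : st' = st -> acc' = acc -> mid t m3 A.
  move=> e1 e2; split=> //; split; last exact: live_clock lm3.
  rewrite m3d eqxx e1 e2; case: lm3; split=> // [w /live_winner_lt0|w /live_fresh_lt0]; exact: ltnW.
have v0 : 0 <= (best_swap I f k L (Some z)).1 by have [] := best_swapP I f k L (Some z).
have vlt : 0 < (best_swap I f k L (Some z)).1 -> ((best_swap I f k L (Some z)).2 < k)%N.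
  by move=> h; have [_ _ /(_ h)[]] := best_swapP I f k L (Some z).
have main_ok : 0 < (best_swap I f k L (Some z)).1 ->
    st' = SlotState (best_swap I f k L (Some z)).1 (best_swap I f k L (Some z)).2 (Some z) (Some z) false ->
    acc' = rcons acc z -> runs 20 accept_main t m3 A mid.
  move=> vpos e1 e2; apply: (runs_le (C := (13 + 6).+1)); first by [].
  apply: runs_seq; apply: (@runs_code _ _ I f s q [:: _; _; _; _; _; _]).
  set m4 := execs _ _ _ _ _ _.
  have m4n : nvar m4 13 = t by rewrite /= /upd /= (live_clock lm3).
  have m4c : nvar m4 35 = (minn cap (size acc)).+1.
    by rewrite /= /upd /= (live_count lm3) eo addn1.
  have m4z : nvar m4 2 = 0%N by rewrite /= /upd /= ez.
  have m4l A' cnt : cnt = minn cap (size acc') -> A' = shortlisted cap acc' ->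
      live st' acc' t.+1 (set_nvar (set_nvar m4 13 t.+1) 15 cnt) A'.
    move=> ecnt eA; rewrite e1; split=> //=; rewrite /upd /= ?vE ?bE ?en ?erz ?ez ?addr0 ?addn0 ?(live_clock lm3) //.
    - by rewrite /enc zt.
    - by rewrite /enc zt.
    - by move=> _; exact: vlt.
    - by move=> w [<-]; rewrite -zt ltnS.
    - by move=> w [<-]; rewrite -zt ltnS.
  have ag4 : agree item_ns item_rs m m4.
    by apply: agree_trans ag3 _; split=> //= y; frame_tac.
  have m4q : nvar m4 12 = nvar m 12 by rewrite -m3q.
  have m4cap : nvar m4 5 = cap by rewrite /= /upd /= ecap.
  have m4d : nvar m4 34 = 0%N by rewrite /= /upd /= m3d.
  have m4k : nvar m4 15 = minn cap (size acc) by rewrite /= /upd /= (live_count lm3).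
  clearbody m4.
  apply: runs_if; rewrite /eval_test m4cap m4c; case: ifP => hc.
    have sc : (size acc < cap)%N by lia.
    apply: (@runs_code _ _ I f s q [:: _; _]); split=> //.
      by apply: agree_trans ag4 _; split=> //= y; frame_tac.
    split; last by rewrite /= /upd /=.
    have := @m4l (A :|: [set z]) (minn cap (size acc)).+1; rewrite /= /upd /=.
    case; rewrite ?e2 ?size_rcons ?shortlisted_accept ?(live_list lm3) //; first by lia.
    by move=> *; split=> //=; rewrite /upd /= ?m4c ?m4z ?addn0 ?e2 ?size_rcons ?shortlisted_accept //; lia.
  have sc : (cap <= size acc)%N by lia.
  apply: (runs_le (C := 1)); first by [].
  apply: runs_skip; split=> //; split=> //; rewrite m4d eqxx.
  have := @m4l A (minn cap (size acc)); rewrite /= /upd /=.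
  case; rewrite ?e2 ?size_rcons ?shortlisted_full ?(live_list lm3) //; first by lia.
  by move=> *; split=> //=; rewrite /upd /= ?m4k ?e2 ?size_rcons ?shortlisted_full.
have offE : (st', acc') =
   if (top st < (best_swap I f k L (Some z)).1) ||
      [&& (0 < c)%N, tied st & top st <= (best_swap I f k L (Some z)).1]
   then (SlotState (best_swap I f k L (Some z)).1 (best_swap I f k L (Some z)).2 (Some z) (Some z) (~~ (0 < c)%N),
        if (0 < c)%N then rcons acc z else acc) else (st, acc).
  by rewrite /st' /acc' /offer /=; case: ifP.
clearbody st' acc'.
apply: (runs_le (C := 25)); first by [].
apply: runs_if; rewrite /eval_test vE (live_top lm3); case: ifP => le_v; last first.
  move: offE; rewrite ltNge le_v /= => -[e1 e2].
  have vpos : 0 < (best_swap I f k L (Some z)).1.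
    by apply: le_lt_trans (live_top_ge0 lm3) _; rewrite ltNge le_v.
  apply: (runs_le (C := 21)); first by [].
  apply: runs_if; rewrite /eval_test eo ec; case: ifP e1 e2 => c0 e1 e2; first exact: main_ok.
  apply: (runs_le (C := 11)); first by [].
  apply: (@runs_code _ _ I f s q [:: _; _; _; _; _]); split=> //.
    by apply: agree_trans ag3 _; split=> //= y; frame_tac.
  split; last by rewrite /= /upd /= (live_clock lm3).
  rewrite e1 e2; split=> //=; rewrite /upd /= ?vE ?bE ?en ?erz ?ez ?addr0 ?addn0 ?(live_clock lm3) ?m3d ?(live_count lm3) ?(live_list lm3) //.
  - by rewrite -zt.
  - by rewrite -zt.
  - by move=> _; exact: vlt.
  - by move=> w [<-]; rewrite -zt ltnS.
  - by move=> w [<-]; rewrite -zt ltnS.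
move: offE; rewrite ltNge le_v /= => offE.
apply: (runs_le (C := 23)); first by [].
apply: runs_if; rewrite /eval_test eo (live_tied lm3); case: ifP => ti; last first.
  apply: (runs_le (C := 1)); first by [].
  apply: runs_skip; have : tied st = false by case: (tied st) ti.
  by move=> e; move: offE; rewrite e andbF => -[]; exact: skip_ok.
have {}ti : tied st by case: (tied st) ti.
apply: runs_if; rewrite /eval_test eo ec; case: ifP => c0; last first.
  apply: (runs_le (C := 1)); first by [].
  by apply: runs_skip; move: offE; rewrite c0 => -[]; exact: skip_ok.
apply: runs_if; rewrite /eval_test vE (live_top lm3); case: ifP => ge_v; last first.
  apply: (runs_le (C := 1)); first by [].
  by apply: runs_skip; move: offE; rewrite ge_v !andbF => -[]; exact: skip_ok.
move: offE; rewrite c0 ti ge_v /= => -[e1 e2]; apply: main_ok => //.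
exact: lt_le_trans (live_tied_gt0 lm3 ti) ge_v.
Qed.

Lemma items_runs zs st acc m A t : ready m -> live st acc t m A ->
  [seq pos (Some z) | z <- zs] = iota t (size zs) -> nvar m 12 = size zs ->
  (forall w, w \in contents k L -> (pos (Some w) <= t)%N) ->
  let sa := foldl (offer I f k L (0 < c)%N) (st, acc) zs in
  runs ((41 * k + 81) * size zs + 1) (While (NLe 3 12) item_prog) t m A
    (fun t' m' A' => [/\ t' = (t + size zs)%N, agree item_ns item_rs m m' & live sa.1 sa.2 t' m' A']).
Proof.
elim: zs st acc m A t => [|z zs IH] st acc m A t rm lm zt mq Lt /=.
  have [[_ _ _ eo _ _ _] _ _] := rm.
  rewrite muln0; apply: runs_while_false; first by rewrite /= eo mq.
  by rewrite addn0; split=> //; split.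
have [[_ _ _ eo _ _ _] _ _] := rm.
apply: (runs_le (C := (41 * k + 80 + ((41 * k + 81) * size zs + 1)).+1)); first by rewrite mulnS; lia.
apply: runs_while_true; first by rewrite /= eo mq.
move: zt => /= -[zt zst].
apply: (@runs_conseq _ _ I f s q _ _ _ _ _ _ _ _ (@item_runs st acc z m A t rm lm zt Lt)) => t' m' A' [-> ag lm' mq'].
case: (offer I f k L (0 < c)%N (st, acc) z) lm' => st' acc' /= lm'.
apply: (@runs_conseq _ _ I f s q _ _ _ _ _ _ _ _ (IH st' acc' m' A' t.+1 (ready_agree ag rm) lm' zst _ _)).
- by move=> t2 m2 A2 [-> ag2 lm2]; split; [rewrite addSnnS | exact: agree_trans ag ag2 |].
- by rewrite mq' mq subn1.
- by move=> w /Lt/leqW.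
Qed.

End Items.

(** * Processing the slots *)

Section Slots.
Variables (R : realType) (n : nat) (I : {set {set 'I_n}}) (f : {set 'I_n} -> R).
Variables (s : 'S_n) (q k cap d M : nat).
Notation memory := (memory R).
Notation runs := (runs I f s q).
Notation pos := (pos s).
Notation enc := (enc s).
Variables (bl : nat -> seq 'I_n) (rr : nat -> nat).

(** The arrival time at which bin [b] opens. Step budgets are differences of offsets, so the cost of
    the items telescopes to a multiple of n. *)
Definition offset (b : nat) : nat := \sum_(j < b) size (bl j).

Hypothesis bl_pos : forall b, (b < M * d)%N ->
  [seq pos (Some z) | z <- bl b] = iota (offset b) (size (bl b)).
Hypotheses (matI : is_matroid I) (f_ge0 : nonnegative f) (f_mono : monotone f).
Hypothesis d_gt0 : (0 < d)%N.

Record glob (m : memory) : Prop := Glob {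
  glob_slots : nvar m 4 = M;
  glob_cap : nvar m 5 = cap;
  glob_subs : nvar m 6 = d;
  glob_sizes : narr m 0 =1 (fun b => if (b < M * d)%N then size (bl b) else 0%N);
  glob_recycle : narr m 6 =1 rr }.

Lemma glob_agree ns rs m m' : agree ns rs m m' ->
  all (fun x => x \notin ns) [:: 4; 5; 6]%N -> glob m -> glob m'.
Proof. by move=> [hn _ ha] /and4P[n4 n5 n6 _] [*]; split; rewrite ?hn // => i; rewrite ha. Qed.

Lemma offsetS b : offset b.+1 = (offset b + size (bl b))%N.
Proof. by rewrite /offset big_ord_recr. Qed.

Lemma offset_mono b c : (b <= c)%N -> (offset b <= offset c)%N.
Proof.
by move/subnKC <-; elim: (c - b)%N => [|e IH]; rewrite ?addn0 // addnS offsetS (leq_trans IH) ?leq_addr.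
Qed.

Definition sub_ns : seq nat := item_ns ++ [:: 11; 14; 18]%N.

Lemma item_sub_ns : {subset item_ns <= sub_ns}. Proof. exact/allP. Qed.
Lemma eval_sub_ns : {subset eval_ns <= sub_ns}. Proof. exact/allP. Qed.

Lemma sub_loop_runs (L : nat -> option 'I_n) (i : nat) (sa0 : slot_state R n * seq 'I_n) m0 e c m A :
  inj_cells k L -> (i < M)%N -> (c + e = d)%N -> ctx s k L m0 -> glob m0 ->
  (forall w, w \in contents k L -> (pos (Some w) < offset (i * d))%N) ->
  agree sub_ns item_rs m0 m -> nvar m 11 = c -> nvar m 18 = c.+1 -> nvar m 14 = (i * d + c)%N ->
  let sa := run_bins I f k d bl i L sa0 in
  live s k cap (sa (iota 0 c)).1 (sa (iota 0 c)).2 (offset (i * d + c)) m A ->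
  runs ((41 * k + 81) * (offset (i * d + d) - offset (i * d + c)) + 21 * e + 1)
    (While (NLe 18 6) sub_body) (offset (i * d + c)) m A
    (fun t' m' A' => [/\ t' = offset (i * d + d), agree sub_ns item_rs m0 m',
       live s k cap (sa (iota 0 d)).1 (sa (iota 0 d)).2 t' m' A' & nvar m' 14 = (i * d + d)%N]).
Proof.
move=> inj iM + cm0 gm0 Lt.
elim: e c m A => [|e IH] c m A ce ag mc mC mb sa lm.
  rewrite addn0 in ce; rewrite {c}ce in mc mC mb lm *. rewrite subnn muln0; apply: runs_while_false; last by split.
  by rewrite /= mC; have [-> // _ _] := ag; rewrite (glob_subs gm0) ltnn.
have cd : (c < d)%N by lia.
have bM : (i * d + c < M * d)%N.
  have : (i.+1 * d <= M * d)%N by rewrite leq_mul2r iM orbT.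
  by rewrite mulSn; lia.
have cm : ctx s k L m by apply: agree_ctx ag _ _ cm0.
have gm : glob m by apply: glob_agree ag _ gm0.
set b := (i * d + c)%N in mb lm bM *.
have off_b := offsetS b.
have off_le : (offset b.+1 <= offset (i * d + d))%N by apply: offset_mono; rewrite /b; lia.
apply: (runs_le (C := ((3 + (((41 * k + 81) * size (bl b) + 1) + 7).+1).+1 +
   ((41 * k + 81) * (offset (i * d + d) - offset b.+1) + 21 * e + 1)).+1)).
  rewrite (_ : (offset (i * d + d) - offset b = size (bl b) + (offset (i * d + d) - offset b.+1))%N); last by lia.
  by rewrite mulnDr; lia.
apply: runs_while_true; first by rewrite /= mC (glob_subs gm).
apply: runs_seq; apply: (@runs_code _ _ I f s q [:: _]).
set m1 := execs _ _ _ _ _ _.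
have ag1 : agree item_ns item_rs m m1 by split=> //= y; frame_tac.
have m1q : nvar m1 12 = size (bl b) by rewrite /= /upd /= mb (glob_sizes gm) bM.
have lm1 : live s k cap (sa (iota 0 c)).1 (sa (iota 0 c)).2 (offset b) m1 A.
  by move: lm; case; split.
have rm : ready s k cap L c m by split=> //; exact: glob_cap gm.
have rm1 := ready_agree ag1 rm.
clearbody m1; apply: runs_seq.
pose sa1 := foldl (offer I f k L (0 < c)%N) ((sa (iota 0 c)).1, (sa (iota 0 c)).2) (bl b).
apply: (@runs_conseq _ _ I f s q _ _ _ _ _ _ _ _ (@items_runs _ _ I f s q k cap L c inj (bl b) _ _ m1 A
   (offset b) rm1 lm1 (bl_pos bM) m1q _)); last first.
  move=> w /Lt/ltnW/leq_trans; apply; apply: offset_mono; rewrite /b; lia.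
move=> _ m2 A2 [-> ag2 lm2]; apply: (@runs_code _ _ I f s q [:: _; _; _]).
have sa1E : sa1 = sa (iota 0 c.+1).
  by rewrite /sa1 -surjective_pairing /sa /run_bins -[in RHS](addn1 c) iotaD foldl_cat /= add0n.
rewrite -/sa1 sa1E -off_b /b -addnS in lm2 *.
have ag12 : agree sub_ns item_rs m0 m2.
  apply: agree_trans ag _; apply: agree_sub item_sub_ns (fun _ => id) (agree_trans ag1 ag2).
have cm2 : ctx s k L m2 by apply: agree_ctx ag12 _ _ cm0.
have m2c : nvar m2 18 = c.+1 by have [-> //] := agree_trans ag1 ag2.
have m2b : nvar m2 14 = (i * d + c)%N by have [-> //] := agree_trans ag1 ag2.
have [en ek ez eo erz el ei] := cm2.
apply: IH; first by lia.
- by apply: agree_trans ag12 _; split=> //= y; frame_tac.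
- by rewrite /= /upd /= m2c ez addn0.
- by rewrite /= /upd /= m2c eo addn1.
- by rewrite /= /upd /= m2b eo addn1 addnS.
by move: lm2; case; split.
Qed.

Let cells i := cells_at I f k d bl rr i.
Let wins i := wins_at I f k d bl rr i.
Let acc i := accepted_at I f k d bl rr i.

Record at_slot (i t : nat) (m : memory) (A : {set 'I_n}) : Prop := AtSlot {
  slot_ctx : ctx s k (cells i) m;
  slot_wins : narr m 3 =1 (fun j => enc (wins i j));
  slot_glob : glob m;
  slot_cur : rvar m 4 = f (contents k (cells i));
  slot_count : nvar m 15 = minn cap (size (acc i));
  slot_list : A = shortlisted cap (acc i);
  slot_time : t = offset (i * d);
  slot_clock : nvar m 13 = t;
  slot_bin : nvar m 14 = (i * d)%N;
  slot_index : nvar m 10 = i;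
  slot_next : nvar m 17 = i.+1;
  slot_wins_lt : forall j z, wins i j = Some z -> (pos (Some z) < t)%N }.

Lemma run_raw i : let sa := run_bins I f k d bl i (cells i)
    (slot_start I f k (cells i) (wins i (rr i)), acc i) (iota 0 d) in
  [/\ cells i.+1 = end_slot (cells i) sa.1, wins i.+1 = upd (wins i) i (fresh sa.1) &
      acc i.+1 = sa.2].
Proof. by rewrite /cells /wins /acc /cells_at /wins_at /accepted_at /=; case: (run _ _ _ _ _ _ i) => [[? ?] ?]. Qed.

(** Allows the program to copy [top] into the variable for the current value. *)
Lemma run_top i : top (run_bins I f k d bl i (cells i)
    (slot_start I f k (cells i) (wins i (rr i)), acc i) (iota 0 d)).1 =
  f (contents k (cells i.+1)).
Proof.
rewrite run_binsE // foldl_offer_sample.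
have [news [b [-> _]]] := foldl_offer_main I f k (cells i) (wins i (rr i)) (acc i)
  (sample_part d bl i) (main_part d bl i).
by rewrite top_slot_result (cells_value_succ k matI f_ge0 f_mono d_gt0 bl rr i).
Qed.

Lemma slot_runs i t m A : (i < M)%N -> at_slot i t m A ->
  runs ((41 * k + 81) * (offset (i.+1 * d) - offset (i * d)) + 41 * k + 21 * d + 120)
    slot_body t m A (at_slot i.+1).
Proof.
move=> iM am; have [_ inj subW _] := run_invariant k matI f_ge0 f_mono d_gt0 bl rr i.
have [cm wm gm curm cntm lm tm clm bm im nm ltm] := am.
have Lt w : w \in contents k (cells i) -> (pos (Some w) < t)%N.
  by move=> wL; have [j Wj] := subW w wL; exact: ltm Wj.
pose xo := wins i (rr i).
set cost := ((41 * k + 81) * _)%N.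
apply: (runs_le (C := (7 + (41 * k + 13 + (15 + (10 + ((cost + 21 * d + 1) + (20 + 7).+1).+1).+1).+1).+1).+1)).
  by lia.
apply: runs_seq; apply: (@runs_code _ _ I f s q [:: _; _; _]).
set m1 := execs _ _ _ _ _ _.
have ag1 : agree sub_ns item_rs m m1 by split=> //= y; frame_tac.
have [en ek ez eo erz el ei] := cm.
have m1x : nvar m1 20 = pos xo.
  by rewrite /= /upd /= im (glob_recycle gm) wm en encK.
have cm1 : ctx s k (cells i) m1 by apply: agree_ctx ag1 _ _ cm.
have m1k : forall y, y \in [:: 10; 13; 14; 15; 17]%N -> nvar m1 y = nvar m y.
  by move=> y yn; rewrite /= /upd; do ?[case: eqP yn => [->//|_ yn]].
have m1r : rvar m1 4 = rvar m 4 by [].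
clearbody m1.
apply: runs_seq; apply: (@runs_conseq _ _ I f s q _ _ _ _ _ _ _ _
   (@eval_runs _ _ I f s q k (cells i) xo t m1 A inj _ _ cm1 m1x)); last 2 first.
- by move=> w /Lt/ltnW.
- by move=> w /ltm/ltnW.
move=> _ m2 _ [-> -> ag2 vE bE].
have m2k : forall y, y \in [:: 10; 13; 14; 15; 17]%N -> nvar m2 y = nvar m y.
  move=> y yn; have [h _ _] := ag2; rewrite h ?m1k //.
  exact: (allP (isT : all (fun y => y \notin eval_ns) [:: 10; 13; 14; 15; 17]%N)).
have m2r : rvar m2 4 = rvar m 4 by have [_ -> //] := ag2.
have m2x : nvar m2 20 = pos xo by have [-> //] := ag2.
have {}ag2 : agree sub_ns item_rs m m2.
  by apply: agree_trans ag1 (agree_sub eval_sub_ns eval_item_rs ag2).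
clear m1 ag1 m1x cm1 m1k m1r.
apply: runs_seq; apply: (@runs_code _ _ I f s q [:: _; _; _; _; _; _; _]).
set m3 := execs _ _ _ _ _ _.
have ag3 : agree sub_ns item_rs m m3 by apply: agree_trans ag2 _; split=> //= y; frame_tac.
have cm3 : ctx s k (cells i) m3 by apply: agree_ctx ag3 _ _ cm.
have [en3 ek3 ez3 eo3 erz3 el3 ei3] := cm3.
have cm2 : ctx s k (cells i) m2 by apply: agree_ctx ag2 _ _ cm.
have m3b : rvar m3 3 = f (contents k (cells i)).
  by rewrite /= /upd /= (ctx_rzero cm2) addr0 m2r curm.
have m3v : rvar m3 1 = (best_swap I f k (cells i) xo).1 by [].
have m3c : nvar m3 26 = (best_swap I f k (cells i) xo).2 by [].
have m3n : [/\ nvar m3 30 = 0, nvar m3 31 = 0, nvar m3 32 = 0, nvar m3 33 = 0 & nvar m3 11 = 0 /\ nvar m3 18 = 1]%N by [].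
have m3k : forall y, y \in [:: 10; 13; 14; 15; 17]%N -> nvar m3 y = nvar m y.
  by move=> y yn; rewrite -m2k //= /upd; do ?[case: eqP yn => [->//|_ yn]].
have m3x : nvar m3 20 = pos xo by [].
clearbody m3; clear m2 ag2 vE bE m2k m2r m2x cm2.
have [n30 n31 n32 n33 [n11 n18]] := m3n.
pose sa0 := (slot_start I f k (cells i) xo, acc i).
pose mid (t' : nat) (m' : memory) (A' : {set 'I_n}) : Prop :=
  [/\ t' = t, A' = A, agree sub_ns item_rs m m', 
      [/\ nvar m' 11 = 0, nvar m' 18 = 1 & nvar m' 14 = i * d]%N &
      live s k cap sa0.1 sa0.2 t m' A].
apply: runs_seq; apply: (runs_conseq (Q := mid)); last first.
  have cur0 : 0 <= f (contents k (cells i)) by exact: f_ge0.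
  apply: (runs_le (C := 8)); first by [].
  apply: runs_if; rewrite /eval_test m3v m3b; case: ifP => le_v.
    apply: (runs_le (C := 1)); first by [].
    apply: runs_skip; split=> //; first by split=> //; rewrite m3k.
    rewrite /= /slot_start ltNge le_v /=; split=> //=; rewrite ?n30 ?n31 ?n32 ?n33 ?m3k //.
    - by rewrite enc_none.
    - by rewrite enc_none.
  have lt_v : f (contents k (cells i)) < (best_swap I f k (cells i) xo).1 by rewrite ltNge le_v.
  apply: (@runs_code _ _ I f s q [:: _; _; _]); split=> //.
  - by apply: agree_trans ag3 _; split=> //= y; frame_tac.
  - by split=> //; rewrite /= /upd /= m3k.
  rewrite /= /slot_start lt_v /=; split=> //=; rewrite /upd /= ?m3v ?erz3 ?addr0 ?m3c ?ez3 ?addn0 ?n32 ?n33 ?(m3k 13%N isT) ?(m3k 15%N isT) //.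
  - by rewrite en3 m3x.
  - by rewrite enc_none.
  - by apply: le_trans cur0 (ltW _).
  - move=> _; have [_ _ ] := best_swapP I f k (cells i) xo; case=> //.
    exact: le_lt_trans lt_v.
  - by move=> z /ltm.
move=> _ m4 _ [-> -> ag4 [n4c n4C n4b] lm4].
pose sa := run_bins I f k d bl i (cells i) sa0.
have mulS : (i * d + d = i.+1 * d)%N by rewrite mulSn addnC.
have tE : t = offset (i * d + 0) by rewrite addn0.
rewrite tE in lm4 *.
apply: runs_seq; apply: (@runs_conseq _ _ I f s q _ _ _ _ _ _ _ _
   (@runs_le _ _ I f s q _ _ _ _ _ _ _ _ (@sub_loop_runs (cells i) i sa0 m d 0 m4 A inj iM (add0n d) cm gm _ ag4 n4c n4C _ lm4))); last 3 first.
- by rewrite addn0 mulS /cost.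
- by rewrite -tm.
- by rewrite addn0.
rewrite mulS => _ m5 A5 [-> ag5 lm5 m5b].
have cm5 : ctx s k (cells i) m5 by apply: agree_ctx ag5 _ _ cm.
have gm5 : glob m5 by apply: glob_agree ag5 _ gm.
have [en5 ek5 ez5 eo5 erz5 el5 ei5] := cm5.
have m5i : nvar m5 10 = i by have [-> //] := ag5.
have m5n : nvar m5 17 = i.+1 by have [-> //] := ag5.
have m5w : narr m5 3 =1 (fun j => enc (wins i j)) by move=> j; have [_ _ ->] := ag5; exact: wm.
have m5r : rvar m5 4 = f (contents k (cells i)) by have [_ -> //] := ag5.
have [cellsS winsS accS] := run_raw i; rewrite -/xo -/sa0 -/(sa _) in cellsS winsS accS.
rewrite -/sa in lm5.
set t' := offset (i.+1 * d) in lm5 *.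
pose fin (t2 : nat) (m' : memory) (A' : {set 'I_n}) : Prop :=
  [/\ t2 = t', A' = A5, ctx s k (cells i.+1) m', glob m' &
      [/\ rvar m' 4 = f (contents k (cells i.+1)), narr m' 3 =1 narr m5 3 &
          forall y, y \in [:: 10; 13; 14; 15; 17; 32]%N -> nvar m' y = nvar m5 y]].
have [_ _ subW' _] := run_invariant k matI f_ge0 f_mono d_gt0 bl rr i.+1.
apply: runs_seq; apply: (runs_conseq (Q := fin)).
  move=> _ m6 _ [-> -> cm6 gm6 [r6 w6 n6]].
  apply: (@runs_code _ _ I f s q [:: _; _; _]).
  have [en6 ek6 ez6 eo6 erz6 el6 ei6] := cm6.
  have [h3 h30 h31 h32 h33 h15 hA h13 _ _ _ _ hfresh] := lm5.
  split; rewrite ?accS //=; rewrite ?/upd /= ?(n6 10%N isT, n6 13%N isT, n6 14%N isT, n6 15%N isT, n6 17%N isT, n6 32%N isT) //.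
  - move=> j; rewrite m5i h32 winsS /upd; case: (eqVneq j i) => // ji.
    by rewrite w6 m5w.
  - by case: gm6; split.
  - by rewrite m5n ez6 addn0.
  - by rewrite m5n eo6 addn1.
  - move=> j z; rewrite winsS /upd; case: eqP => [_|_]; first exact: hfresh.
    move/ltm/leq_trans; apply; rewrite tm; apply: offset_mono; rewrite leq_mul2r; lia.
apply: (runs_le (C := 16)); first by [].
apply: runs_if; rewrite /eval_test eo5 (live_winner lm5) enc_gt0.
case: ifP => hw; last first.
  apply: (runs_le (C := 1)); first by [].
  have eC : cells i.+1 = cells i.
    by rewrite cellsS /end_slot; case: (winner _) hw.
  by apply: runs_skip; split=> //; rewrite ?eC.
apply: (@runs_code _ _ I f s q [:: _; _; _; _; _; _; _]).
have [w ew] : exists w, winner (sa (iota 0 d)).1 = Some w.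
  by case: (winner _) hw => [w _|//]; exists w.
have eC : cells i.+1 = upd (cells i) (cell (sa (iota 0 d)).1) (Some w).
  by rewrite cellsS /end_slot ew.
set p := cell _ in eC.
have pk : (p < k)%N by apply: (live_cell_lt lm5); rewrite ew.
have h31 : nvar m5 31 = enc (Some w) by rewrite (live_winner lm5) ew.
have h30 : nvar m5 30 = p by rewrite (live_cell lm5).
have y_pos : (n - narr m5 1 p)%N = pos (cells i p) by rewrite el5 encK.
have x_pos : (n - enc (Some w))%N = pos (Some w) by rewrite encK.
have curS : top (sa (iota 0 d)).1 = f (contents k (cells i.+1)).
  by rewrite run_top.
split=> //.
- split=> //=; rewrite /upd /=.
  + move=> j; rewrite h30 h31 eC /upd; case: eqP => // _; exact: el5.
  + move=> j; rewrite h30 h31 en5 y_pos x_pos ez5 eo5 eC.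
    case: (ltnP j n) => jn.
      have := indf_upd s (Some w) (Ordinal jn) inj pk; rewrite /upd /= => <-.
      by rewrite ei5.
    rewrite indf_ge //; case: eqP => [ej|_]; first by move: jn; rewrite ej /= leqNgt ltn_ord.
    by case: eqP => // _; rewrite ei5 indf_ge.
- by case: gm5; split.
- split=> //=; first by rewrite /upd /= (live_top lm5) erz5 addr0 curS.
  by move=> y yn; rewrite /upd; do ?[case: eqP yn => [->//|_ yn]].
Qed.

Lemma slots_runs e i t m A : (i + e = M)%N -> at_slot i t m A ->
  runs ((41 * k + 81) * (offset (M * d) - offset (i * d)) + (41 * k + 21 * d + 121) * e + 1)
    (While (NLe 17 4) slot_body) t m A (at_slot M).
Proof.
elim: e i t m A => [|e IH] i t m A ie am.
  rewrite addn0 in ie; rewrite ie subnn !muln0; apply: runs_while_false; last by rewrite -ie.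
  by rewrite /= (slot_next am) (glob_slots (slot_glob am)) ie ltnn.
have iM : (i < M)%N by lia.
have h1 : (offset (i * d) <= offset (i.+1 * d))%N by apply: offset_mono; rewrite leq_mul2r leqnSn orbT.
have h2 : (offset (i.+1 * d) <= offset (M * d))%N by apply: offset_mono; rewrite leq_mul2r iM orbT.
apply: (runs_le (C := (((41 * k + 81) * (offset (i.+1 * d) - offset (i * d)) + 41 * k + 21 * d + 120) +
  ((41 * k + 81) * (offset (M * d) - offset (i.+1 * d)) + (41 * k + 21 * d + 121) * e + 1)).+1)).
  rewrite (_ : offset (M * d) - offset (i * d) = (offset (i.+1 * d) - offset (i * d)) +
     (offset (M * d) - offset (i.+1 * d)))%N; last by lia.
  by rewrite mulnDr mulnS; lia.
apply: runs_while_true; first by rewrite /= (slot_next am) (glob_slots (slot_glob am)).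
apply: (@runs_conseq _ _ I f s q _ _ _ _ _ _ _ _ (@slot_runs i t m A iM am)) => t' m' A' am'.
by apply: IH; rewrite // addSnnS.
Qed.

End Slots.

(** The machine cannot multiply, so products by constants depending on [d] are unrolled into
    additions; the length of the program depends on [d] alone. *)
Definition init_prog (d : nat) : cmd :=
  code ([:: NConst 3 1; NConst 6 d] ++ nseq (d * d + d) (NAdd 4 4 1)
          ++ nseq (d.+1 * d) (NAdd 5 5 4)).

Definition count_body (d : nat) : cmd :=
  code ([:: NLoad 22 4 21; NLoad 23 5 21] ++ nseq d (NAdd 23 23 22)
          ++ [:: NLoad 24 0 23; NAdd 24 24 3; NStore 0 23 24; NAdd 21 27 2; NAdd 27 27 3]).

Definition count_prog (d : nat) : cmd :=
  Seq (code [:: NConst 21 0; NConst 27 1]) (While (NLe 27 0) (count_body d)).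

Definition slots_prog : cmd :=
  Seq (code [:: Value 4 2; NConst 10 0; NConst 17 1]) (While (NLe 17 4) slot_body).

Definition shortlist_alg (d : nat) : cmd :=
  Seq (init_prog d)
  (Seq (draw 4 0 4)
  (Seq (draw 5 0 6)
  (Seq (draw 6 4 4)
  (Seq (count_prog d) slots_prog)))).

(** * The whole program *)

Section Algorithm.
Variables (R : realType) (n : nat) (I : {set {set 'I_n}}) (f : {set 'I_n} -> R).
Variables (s : 'S_n) (d : nat).
Notation memory := (memory R).
Hypotheses (matI : is_matroid I) (f_ge0 : nonnegative f) (f_mono : monotone f).
Hypotheses (d_gt0 : (0 < d)%N) (rk_gt0 : (0 < rk I)%N).
Let k := rk I.
Let M := ((d * d + d) * k)%N.
Let cap := (M * d.+1 * d)%N.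
Notation runs := (runs I f s cap).

Lemma execs_cat t l1 l2 (m : memory) :
  execs I f s t (l1 ++ l2) m = execs I f s t l2 (execs I f s t l1 m).
Proof. exact: foldl_cat. Qed.

Lemma execs_nseq t c x y (m : memory) : x != y ->
  agree [:: x] [::] m (execs I f s t (nseq c (NAdd x x y)) m) /\
  nvar (execs I f s t (nseq c (NAdd x x y)) m) x = (nvar m x + c * nvar m y)%N.
Proof.
move=> xy; elim: c m => [|c IH] m /=; first by rewrite mul0n addn0; split=> //; split.
have [[h1 h2 h3] ->] := IH (set_nvar m x (nvar m x + nvar m y)).
split; last by rewrite /= /upd eqxx eq_sym (negPf xy) mulSn addnA.
split=> //= z; rewrite inE => zx; rewrite h1 ?inE //= /upd (negPf zx).
by [].
Qed.

Definition key (sl : {ffun 'I_n -> 'I_M}) (sb : {ffun 'I_n -> 'I_d}) (j : nat) : nat :=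
  (ext sl j * d + ext sb j)%N.

Definition count_ns : seq nat := [:: 21; 22; 23; 24; 27]%N.

Definition counted (m0 m : memory) (sl : {ffun 'I_n -> 'I_M}) (sb : {ffun 'I_n -> 'I_d}) (j : nat) : Prop :=
  [/\ forall x, x \notin count_ns -> nvar m x = nvar m0 x, forall x, rvar m x = rvar m0 x,
      forall a, a != 0%N -> narr m a =1 narr m0 a &
      forall b, narr m 0 b = count (fun i => key sl sb i == b) (iota 0 j)].

Lemma count_loop m0 sl sb t A e j m : (j + e = n)%N ->
  nvar m0 0 = n -> nvar m0 2 = 0%N -> nvar m0 3 = 1%N ->
  narr m0 4 =1 ext sl -> narr m0 5 =1 ext sb ->
  counted m0 m sl sb j -> nvar m 21 = j -> nvar m 27 = j.+1 ->
  runs ((2 * d + 16) * e + 1) (While (NLe 27 0) (count_body d)) t m A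
    (fun t' m' A' => [/\ t' = t, A' = A & counted m0 m' sl sb n]).
Proof.
move=> + m0n m0z m0o m0l m0b; elim: e j m => [|e IH] j m je cm mj mJ; have [hn hr ha hc] := cm.
  rewrite addn0 in je; rewrite muln0; apply: runs_while_false; last by split=> //; rewrite -je.
  by rewrite /= mJ hn // m0n je ltnn.
have jn : (j < n)%N by lia.
apply: (runs_le (C := ((2 * (size ([:: NLoad 22 4 21; NLoad 23 5 21] ++ nseq d (NAdd 23 23 22)
          ++ [:: NLoad 24 0 23; NAdd 24 24 3; NStore 0 23 24; NAdd 21 27 2; NAdd 27 27 3]))).+1 +
   ((2 * d + 16) * e + 1)).+1)).
  by rewrite !size_cat size_nseq /=; lia.
apply: runs_while_true; first by rewrite /= mJ hn // m0n.
apply: runs_code; rewrite !execs_cat.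
set m1 := execs I f s t [:: NLoad 22 4 21; NLoad 23 5 21] m.
have [[gn gr ga] g23] := @execs_nseq t d 23 22 m1 isT.
set m2 := execs I f s t (nseq d _) m1 in gn gr ga g23 *.
have m2k : nvar m2 23 = key sl sb j.
  by rewrite g23 /= /upd /= !mj !ha // m0l m0b /key addnC mulnC.
have m2n x : x \notin count_ns -> nvar m2 x = nvar m0 x.
  move=> xn; rewrite gn ?inE; last by apply: contraNneq xn => ->.
  by rewrite -hn //= /upd; do ?[case: eqP xn => [->//|_ xn]].
have m2j : nvar m2 21 = j by rewrite gn.
have m2J : nvar m2 27 = j.+1 by rewrite gn.
have m2a a : narr m2 a =1 narr m a by move=> i; rewrite ga.
have m2r x : rvar m2 x = rvar m x by rewrite gr.
clearbody m2; clear m1 gn gr ga g23.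
apply: (IH j.+1); first by lia.
- split.
  + by move=> x xn; rewrite -m2n //= /upd; do ?[case: eqP xn => [->//|_ xn]].
  + by move=> x; rewrite m2r hr.
  + by move=> a a0 i; rewrite /= /upd (negPf a0) m2a ha.
  + move=> b; rewrite -[in RHS](addn1 j) iotaD count_cat /= add0n addn0 /upd /= m2k m2n // m0o m2a hc.
    by rewrite eq_sym; case: eqP => [->|_]; rewrite ?m2a ?hc ?addn0 ?addn1.
- by rewrite /= /upd /= m2J m2n // m0z addn0.
- by rewrite /= /upd /= m2J m2n // m0o addn1.
Qed.

(** The program uses only the sizes of the bins. Any family of blocks with these sizes and
    consecutive arrival times will do, so its choice is left to the probabilistic argument. *)
Variable bl : {ffun 'I_n -> 'I_M} -> {ffun 'I_n -> 'I_d} -> nat -> seq 'I_n.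
Hypothesis bl_size : forall sl sb b, (b < M * d)%N ->
  size (bl sl sb b) = count (fun i => key sl sb i == b) (iota 0 n).
Hypothesis bl_pos : forall sl sb b, (b < M * d)%N ->
  [seq pos s (Some z) | z <- bl sl sb b] = iota (offset (bl sl sb) b) (size (bl sl sb b)).
Hypothesis bl_total : forall sl sb, offset (bl sl sb) (M * d) = n.

Definition outcome sl sb (r : {ffun 'I_M -> 'I_M}) : R :=
  best I f (shortlisted cap (accepted_at I f k d (bl sl sb) (ext r) M)).

Lemma key_lt sl sb (j : 'I_n) : (key sl sb j < M * d)%N.
Proof.
rewrite /key !extE; have h1 := ltn_ord (sl j); have h2 := ltn_ord (sb j).
apply: leq_trans (_ : (sl j).+1 * d <= _)%N; last by rewrite leq_mul2r h1 orbT.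
by rewrite mulSn addnC ltn_add2r.
Qed.

Lemma card_shortlisted c (acc : seq 'I_n) : (#|shortlisted c acc| <= c)%N.
Proof.
rewrite /shortlisted cardsE; apply: leq_trans (card_size _) _.
by rewrite size_take; case: ltnP.
Qed.

Lemma slots_prog_good sl sb (r : {ffun 'I_M -> 'I_M}) m0 m :
  counted m0 m sl sb n -> nvar m0 0 = n -> nvar m0 1 = k -> nvar m0 2 = 0%N -> nvar m0 3 = 1%N ->
  nvar m0 4 = M -> nvar m0 5 = cap -> nvar m0 6 = d -> (forall x, (10 <= x < 20)%N -> nvar m0 x = 0%N) ->
  (forall x, rvar m0 x = 0) -> (forall a, a \in [:: 1; 2; 3]%N -> narr m0 a =1 fun=> 0%N) ->
  narr m0 6 =1 ext r ->
  good I f s cap ((41 * k + 81) * n + (41 * k + 21 * d + 121) * M + 9)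
    (Config [:: slots_prog] 0 m set0) (outcome sl sb r).
Proof.
move=> [hn hr ha hc] m0n m0k m0z m0o m0M m0c m0d m01 m0r m0a m06.
rewrite (_ : _ + 9 = ((7 + ((41 * k + 81) * (offset (bl sl sb) (M * d) - offset (bl sl sb) (0 * d)) + (41 * k + 21 * d + 121) * M + 1)).+1) + 0)%N; last first.
  by rewrite bl_total mul0n /offset big_ord0; lia.
have := @runs_seq _ _ I f s cap _ _ (code [:: Value 4 2; NConst 10 0; NConst 17 1]) (While (NLe 17 4) slot_body)
  0 m set0 (at_slot I f s k cap d M (bl sl sb) (ext r) M).
apply; last first.
  move=> t' m' A' am; apply: good_halted; rewrite (slot_list am) ?card_shortlisted //.
apply: (@runs_code _ _ I f s cap [:: _; _; _]).
apply: (slots_runs (bl_pos sl sb) matI f_ge0 f_mono d_gt0 (i := 0)) => //.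
have c0 : contents k (fun=> None) = set0 :> {set 'I_n}.
  by apply/setP => z; rewrite !inE; apply/existsP => -[].
have e0 : enc s None = 0%N by exact: enc_none.
have i0 j : indf s set0 j = 0%N by rewrite /indf; case: insub => // j'; rewrite inE.
have q0 : queried s 0 (narr m 2) = set0.
  by apply: queried_indf => [j|z]; rewrite ?inE // i0 ha // m0a.
split=> //=.
- split=> //=; rewrite /upd /= ?hn ?hr // => i; rewrite ha // m0a // ?e0 // .
  by rewrite [X in indf _ X]c0 i0.
- by move=> j; rewrite ha // m0a // e0.
- split=> //=; rewrite /upd /= ?hn // => b.
    rewrite hc; case: ifP => bM; first by rewrite bl_size.
    apply/eqP; rewrite -leqn0 leqNgt -has_count; apply/hasPn => i; rewrite mem_iota add0n => /andP[_ ii].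
    apply: contraFN bM => /eqP <-; exact: (key_lt sl sb (Ordinal ii)).
  by rewrite ha // m06.
- by rewrite /upd /= q0 [in RHS]c0.
- by rewrite /upd /= hn // m01 // minn0.
- by rewrite mul0n /offset big_ord0.
- by rewrite /upd /= hn // m01.
- by rewrite /upd /= hn // m01.
Qed.


Lemma alg_good :
  good I f s cap ((2 * (2 + (d * d + d) + d.+1 * d)).+2 + (10 * n + 8) + (10 * n + 8) + (10 * M + 8) +
     ((2 * d + 16) * n + 8) + ((41 * k + 81) * n + (41 * k + 21 * d + 121) * M + 9))
    (start R I (shortlist_alg d))
    (average (fun sl => average (fun sb => average (fun r => outcome sl sb r)))).
Proof.
pose B4 := ((41 * k + 81) * n + (41 * k + 21 * d + 121) * M + 9)%N.
pose B3 := ((2 * d + 16) * n + (8 + B4))%N; pose B2' := (10 * M + (8 + B3))%N.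
pose B2 := (10 * n + (8 + B2'))%N; pose B1 := (10 * n + (8 + B2))%N.
have M_gt0 : (0 < M)%N by rewrite !muln_gt0 addn_gt0 d_gt0 orbT.
set l := [:: NConst 3 1; NConst 6 d] ++ nseq (d * d + d) (NAdd 4 4 1) ++ nseq (d.+1 * d) (NAdd 5 5 4).
have sl : (2 * size l).+1 = (2 * (2 + (d * d + (d + d.+1 * d)))).+1.
  by rewrite /l !size_cat !size_nseq -[(d * d + d + _)%N]addnA.
apply: (good_le (B := ((2 * size l).+1 + B1).+1)); last by rewrite sl /B1 /B2 /B2' /B3 /B4; lia.
apply: good_seq.
apply: (@good_code _ _ I f s cap B1 l); rewrite /l !execs_cat.
set m1 := execs _ _ _ _ [:: _; _] _.
have [[g1 g2 g3] g4] := @execs_nseq 0 (d * d + d) 4 1 m1 isT.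
set m2 := execs I f s 0 (nseq (d * d + d) _) m1 in g1 g2 g3 g4 *.
have [[h1 h2 h3] h4] := @execs_nseq 0 (d.+1 * d) 5 4 m2 isT.
set m3 := execs I f s 0 (nseq (d.+1 * d) _) m2 in h1 h2 h3 h4 *.
have m3_4 : nvar m3 4 = M by rewrite h1 // g4 /= /upd /= add0n.
have m3_5 : nvar m3 5 = cap by rewrite h4 g1 // g4 /= /upd /= !add0n [LHS]mulnC mulnA.
have m3_n x : x \notin [:: 4; 5]%N -> nvar m3 x =
    if x == 6%N then d else if x == 3%N then 1%N else if x == 1%N then k else if x == 0%N then n else 0%N.
  rewrite !inE negb_or => /andP[x4 x5]; rewrite h1 ?inE // g1 ?inE //.
have m3_r x : rvar m3 x = 0 by rewrite h2 // g2.
have m3_a a : narr m3 a =1 fun=> 0%N by move=> i; rewrite h3 g3.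
clearbody m3; clear g1 g2 g3 g4 h1 h2 h3 h4 m1 m2 sl l.
rewrite (_ : B1 = (10 * n + 7 + B2).+1)%N; last by rewrite /B1; lia.
apply: good_seq.
apply: (@good_draw R n I f s cap 4 0 4 n M 0 m3 set0 [:: Seq (draw 5 0 6)
  (Seq (draw 6 4 4) (Seq (count_prog d) slots_prog))] B2) => //; try by rewrite m3_n.
move=> sl m4 [fr4 rv4 ar4] a4.
rewrite (_ : B2 = (10 * n + 7 + B2').+1)%N; last by rewrite /B2; lia.
apply: good_seq.
apply: (@good_draw R n I f s cap 5 0 6 n d 0 m4 set0
  [:: Seq (draw 6 4 4) (Seq (count_prog d) slots_prog)] B2') => //; try by rewrite fr4 // m3_n.
  by move=> i; rewrite ar4 // m3_a.
move=> sb m5 [fr5 rv5 ar5] a5.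
rewrite (_ : B2' = (10 * M + 7 + B3).+1)%N; last by rewrite /B2'; lia.
apply: good_seq.
apply: (@good_draw R n I f s cap 6 4 4 M M 0 m5 set0 [:: Seq (count_prog d) slots_prog] B3) => //;
  try by rewrite fr5 // fr4 // ?m3_4 // m3_n.
  by move=> i; rewrite ar5 // ar4 // m3_a.
move=> r m6 [fr6 rv6 ar6] a6.
have m6n x : x \notin [:: 4; 5; 20; 21; 27]%N -> nvar m6 x =
    if x == 6%N then d else if x == 3%N then 1%N else if x == 1%N then k else if x == 0%N then n else 0%N.
  rewrite !inE !negb_or => /and5P[x4 x5 x20 x21 x27].
  by rewrite fr6 ?fr5 ?fr4 ?m3_n ?inE ?negb_or ?x4 ?x5 ?x20 ?x21.
rewrite (_ : B3 = (5 + ((2 * d + 16) * n + 1)).+1.+1 + B4)%N; last by rewrite /B3; lia.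
rewrite addSn; apply: good_seq.
apply: (@runs_seq _ _ I f s cap _ _ (code [:: NConst 21 0; NConst 27 1]) (While (NLe 27 0) (count_body d))
  0 m6 set0 (fun t' m' A' => [/\ t' = 0%N, A' = set0 & counted m6 m' sl sb n])); last first.
  move=> _ m7 _ [-> -> c7]; apply: (slots_prog_good c7) => //; try by rewrite m6n.
  - by rewrite fr6 // fr5 // fr4.
  - by rewrite fr6 // fr5 // fr4.
  - by move=> x /andP[x10 x20]; rewrite m6n ?inE; [do ?case: eqP => //; lia | lia].
  - by move=> x; rewrite rv6 rv5 rv4.
  - move=> a; rewrite !inE => /or3P[] /eqP-> i; by rewrite ar6 // ar5 // ar4 // m3_a.
apply: (@runs_code _ _ I f s cap [:: _; _]).
apply: (count_loop (sl := sl) (sb := sb) (j := 0)) => //; try by rewrite m6n.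
- by move=> i; rewrite ar6 // ar5 // a4.
- by move=> i; rewrite ar6 // a5.
split=> //.
- by move=> x xn; rewrite /= /upd; do ?[case: eqP xn => [->//|_ xn]].
- by move=> b; rewrite ar6 // ar5 // ar4 // m3_a.
Qed.

End Algorithm.

(** * Numerical estimates *)

Section Numeric.
Variable R : realType.

Lemma onem_expR_le (x : R) : x < 1 -> expR x <= (1 - x)^-1.
Proof.
move=> x1; have := expR_ge1Dx (- x); rewrite expRN => h.
by rewrite -[expR x]invrK lef_pV2 // posrE ?invr_gt0 ?expR_gt0 ?subr_gt0.
Qed.

(** By [1 + x <= expR x] the power is at most the exponential of -2 (1 - 1/d) d^2 / (d^2 + d) = -2
    (d - 1)/(d + 1) = -2 + 4/(d + 1). *)
Lemma decay_le (d k : nat) : (0 < d)%N -> (0 < k)%N ->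
  let m : R := ((d * d + d) * k)%:R in
  (1 - 2 * ((1 - d%:R^-1) / m)) ^+ (d * d * k) <=
  (expR 1 ^+ 2)^-1 * expR (4 / d.+1%:R).
Proof.
move=> d0 k0 /=; set m : R := ((d * d + d) * k)%:R.
have dR : 1 <= (d%:R : R) by rewrite ler1n.
have kR : 1 <= (k%:R : R) by rewrite ler1n.
have mE : m = (d%:R * d%:R + d%:R) * k%:R by rewrite /m natrM natrD natrM.
have m2 : 2 <= m.
  by rewrite /m ler_nat; apply: leq_trans (leq_pmulr _ k0); case: d d0 {dR m mE} => // e _; rewrite mulSn; lia.
set c := (1 - d%:R^-1) / m.
have id1 : 0 <= (d%:R : R)^-1 by rewrite invr_ge0 ler0n.
have c1 : 0 <= 1 - 2 * c.
  by rewrite subr_ge0 /c mulrA ler_pdivrMr; lra.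
apply: le_trans (_ : expR (- (2 * c)) ^+ (d * d * k) <= _).
  by apply: lerXn2r; rewrite ?nnegrE ?expR_ge0 // expR_ge1Dx.
rewrite -expRM_natl -expRM_natl -expRN -expRD ler_expR.
rewrite /c mE !natrM [leLHS](_ : _ = - (2 * 1) + 4 / d.+1%:R) //.
by rewrite -[d.+1%:R]natr1; field; do ?[apply/andP; split]; apply: lt0r_neq0; nra.
Qed.

(** With y = 4/(d + 1), [expR y - 1] is at most 1/(1 - y) - 1 = 4/(d - 3), hence at most eps/2; the
    factor 1 - 2/d costs at most another eps/2. *)
Lemma ratio_ge (eps : R) (d : nat) : 0 < eps -> 8 / eps <= (d%:R : R) - 3 -> (5 <= d)%N ->
  1 - 1 / expR 1 ^+ 2 - eps <=
  (1 - 2 * d%:R^-1) * (1 - (expR 1 ^+ 2)^-1 * expR (4 / d.+1%:R)).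
Proof.
move=> e0 ed d5.
have d5R : 5 <= (d%:R : R) by rewrite ler_nat.
set E := (expR 1 ^+ 2)^-1; set Y := expR _.
have E0 : 0 < E by rewrite invr_gt0 exprn_gt0 // expR_gt0.
have E1 : E <= 1.
  rewrite invf_le1 ?exprn_gt0 ?expR_gt0 // exprn_ege1 //.
  by apply: le_trans (expR_ge1Dx 1); lra.
have Y0 : 0 < Y by exact: expR_gt0.
have dd : (d.+1%:R : R) = d%:R + 1 by rewrite -natr1.
have hy : 4 / (d.+1%:R : R) < 1 by rewrite dd ltr_pdivrMr; lra.
have hY : Y - 1 <= eps / 2.
  have := onem_expR_le hy; rewrite -/Y.
  have -> : (1 - 4 / (d.+1%:R : R))^-1 = 1 + 4 / (d%:R - 3).
    rewrite dd; field; do ?[apply/andP; split]; apply: lt0r_neq0; lra.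
  have : 4 / (d%:R - 3) <= eps / 2.
    rewrite ler_pdivrMr; last by lra.
    have := ler_wpM2l (ltW e0) ed; rewrite mulrCA mulfV ?gt_eqF // mulr1; lra.
  lra.
have hd : 2 * (d%:R : R)^-1 <= eps / 2.
  rewrite ler_pdivrMr; last by lra.
  have := ler_wpM2l (ltW e0) ed; rewrite mulrCA mulfV ?gt_eqF // mulr1; lra.
have hd0 : 0 < (d%:R : R)^-1 by rewrite invr_gt0; lra.
set u := (d%:R : R)^-1 in hd hd0 *.
have EY0 : 0 <= u * (E * Y) by rewrite !mulr_ge0 // ltW.
have EY : E * (Y - 1) <= eps / 2.
  have [h|h] := lerP 0 (Y - 1); last by nra.
  by apply: le_trans hY; rewrite ler_piMl.
rewrite div1r -/E; nra.
Qed.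

Lemma ln2_ge : 2^-1 <= ln (2 : R).
Proof.
rewrite -ler_expR lnK ?posrE //; apply: le_trans (onem_expR_le _) _; first by lra.
by rewrite (_ : 1 - 2^-1 = 2^-1) ?invrK //; lra.
Qed.

Lemma powR2_ge (x : R) : 0 <= x -> 1 + x <= 2 `^ (2 * x).
Proof.
move=> x0; rewrite /powR pnatr_eq0 /=; apply: le_trans (expR_ge1Dx _).
by have := ler_wpM2l x0 ln2_ge; lra.
Qed.

(** The left side is d^2 (d + 1)^2, at most (d + 1)^4, and d + 1 is at most 8 (1 + x), hence at most
    8 times 2 to the power 2 x. *)
Lemma cap_le (x : R) (d : nat) : 0 <= x -> (d%:R : R) <= 8 * x + 7 ->
  ((d * d + d) * d.+1 * d)%:R <= 8 ^+ 4 * (2 `^ (8 * x)) :> R.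
Proof.
move=> x0 hd.
have -> : 2 `^ (8 * x) = (2 `^ (2 * x)) ^+ 4 :> R.
  by rewrite -powR_mulrn ?powR_ge0 // -powRrM; congr (_ `^ _); ring.
apply: le_trans (_ : (d.+1%:R : R) ^+ 4 <= _).
  by rewrite -natrX ler_nat !expnS expn0; nia.
rewrite -exprMn; apply: lerXn2r; rewrite ?nnegrE ?ler0n ?mulr_ge0 ?powR_ge0 //.
by have := powR2_ge x0; rewrite -natr1; lra.
Qed.

End Numeric.

(** * Arrival orders and bins *)

Lemma perm_group_by (T : eqType) (key : T -> nat) (s : seq T) (B : nat) :
  perm_eq (flatten [seq [seq x <- s | key x == b] | b <- iota 0 B]) [seq x <- s | (key x < B)%N].
Proof.
elim: B => [|B IH]; first by rewrite (eq_filter (a2 := pred0)) ?filter_pred0.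
rewrite -[in iota _ _](addn1 B) iotaD map_cat flatten_cat /= cats0 add0n.
rewrite perm_sym -(perm_filterC (fun x => key x < B)%N) -!filter_predI.
rewrite (eq_filter (a2 := fun x => key x < B)%N); last by move=> x /=; lia.
rewrite [X in _ ++ X](eq_filter (a2 := fun x => key x == B)%N); last by move=> x /=; lia.
by rewrite perm_cat2r perm_sym.
Qed.

Lemma map_flatten_iota (T : Type) (g : T -> nat) (ss : seq (seq T)) (a b : nat) :
  map g (flatten ss) = iota a (size (flatten ss)) -> (b < size ss)%N ->
  map g (nth [::] ss b) = iota (a + \sum_(j < b) size (nth [::] ss j)) (size (nth [::] ss b)).
Proof.
elim: ss a b => [//|s ss IH] a b /=; rewrite map_cat size_cat iotaD => /eqP.
rewrite eqseq_cat ?size_map ?size_iota // => /andP[/eqP hs /eqP hss].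
case: b => [|b] /=; first by rewrite big_ord0 addn0.
by rewrite ltnS big_ord_recl /= addnA; exact: IH.
Qed.

Lemma sum_size_nth (T : Type) (ss : seq (seq T)) :
  (\sum_(j < size ss) size (nth [::] ss j))%N = size (flatten ss).
Proof. by elim: ss => [|s ss IH] /=; rewrite ?big_ord0 // big_ord_recl size_cat IH. Qed.

Lemma run_ext (R : realType) n (I : {set {set 'I_n}}) (f : {set 'I_n} -> R) k d bl bl' r i :
  bl =1 bl' -> run I f k d bl r i = run I f k d bl' r i.
Proof.
move=> eb; elim: i => [//|i IH] /=; rewrite IH /run_slot; case: (run _ _ _ _ _ _ _) => [[L W] acc].
suff -> : forall sa cs, run_bins I f k d bl i L sa cs = run_bins I f k d bl' i L sa cs by [].
by move=> sa cs; rewrite /run_bins; elim: cs sa => //= c cs IHc sa; rewrite eb IHc.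
Qed.

Section Arrangement.
Variables (n d M : nat).
Notation slots := {ffun 'I_n -> 'I_M}.
Notation subs := {ffun 'I_n -> 'I_d}.
Implicit Types (sl : slots) (sb : subs).

Definition groups sl sb : seq (seq 'I_n) :=
  [seq [seq j <- enum 'I_n | sl j * d + sb j == b]%N | b <- iota 0 (M * d)].

Lemma perm_groups sl sb : perm_eq (flatten (groups sl sb)) (enum 'I_n).
Proof.
apply: perm_trans (perm_group_by _ _ _) _; rewrite (eq_in_filter (a2 := predT)) ?filter_predT //.
move=> j _ /=; have := ltn_ord (sl j); have := ltn_ord (sb j) => h1 h2.
apply: leq_trans (_ : (sl j).+1 * d <= _)%N; last by rewrite leq_mul2r h2 orbT.
by rewrite mulSn addnC ltn_add2r.
Qed.

Lemma uniq_groups sl sb : uniq (flatten (groups sl sb)).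
Proof. by rewrite (perm_uniq (perm_groups sl sb)) enum_uniq. Qed.

Lemma size_groups sl sb : size (flatten (groups sl sb)) = n.
Proof. by rewrite (perm_size (perm_groups sl sb)) size_enum_ord. Qed.

Lemma rank_lt sl sb (j : 'I_n) : (index j (flatten (groups sl sb)) < n)%N.
Proof.
by rewrite -[X in (_ < X)%N](size_groups sl sb) index_mem (perm_mem (perm_groups sl sb)) mem_enum.
Qed.

Definition rank_fun sl sb (j : 'I_n) : 'I_n := Ordinal (rank_lt sl sb j).

Lemma rank_inj sl sb : injective (rank_fun sl sb).
Proof.
move=> i j /(congr1 val) /= e; have mem x : x \in flatten (groups sl sb).
  by rewrite (perm_mem (perm_groups sl sb)) mem_enum.
by rewrite -(nth_index i (mem i)) e nth_index.
Qed.

(** Sorts the labels by bin: the label [j] is carried by the item arriving at time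
    [rank_fun sl sb j], so each bin occupies consecutive times. *)
Definition rank_perm sl sb : 'S_n := perm (@rank_inj sl sb).

Definition arranged (p : 'S_n) sl sb (b : nat) : seq 'I_n :=
  [seq p j | j <- enum 'I_n & (sl j * d + sb j == b)%N].

Lemma nth_groups sl sb b : (b < M * d)%N ->
  nth [::] (groups sl sb) b = [seq j <- enum 'I_n | sl j * d + sb j == b]%N.
Proof. by move=> bM; rewrite (nth_map 0%N) ?size_iota // nth_iota. Qed.

Lemma offset_groups p sl sb b : (b <= M * d)%N ->
  offset (arranged p sl sb) b = (\sum_(j < b) size (nth [::] (groups sl sb) j))%N.
Proof.
move=> bM; apply: eq_bigr => j _; rewrite nth_groups; last exact: leq_trans bM.
by rewrite size_map.
Qed.

Lemma arranged_pos (s : 'S_n) sl sb b : (b < M * d)%N ->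
  [seq pos s (Some z) | z <- arranged (rank_perm sl sb * s) sl sb b] =
  iota (offset (arranged (rank_perm sl sb * s) sl sb) b) (size (arranged (rank_perm sl sb * s) sl sb b)).
Proof.
move=> bM; rewrite offset_groups; last exact: ltnW.
rewrite /arranged -map_comp size_map -nth_groups //.
rewrite (eq_map (g := index^~ (flatten (groups sl sb)))); last first.
  by move=> j; rewrite /= permM permK permE.
have := @map_flatten_iota _ (index^~ (flatten (groups sl sb))) (groups sl sb) 0 b.
apply; last by rewrite size_map size_iota.
apply: (@eq_from_nth _ 0%N); rewrite size_map ?size_iota // => i iL.
case: (flatten (groups sl sb)) iL (uniq_groups sl sb) => [//|x l] iL u.
by rewrite (nth_map x) // nth_iota // index_uniq.
Qed.

Lemma arranged_total p sl sb : offset (arranged p sl sb) (M * d) = n.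
Proof.
rewrite offset_groups // -[RHS](size_groups sl sb) -sum_size_nth.
by rewrite /groups size_map size_iota.
Qed.

End Arrangement.

Lemma arranged_size n d (I : {set {set 'I_n}}) p sl sb b :
  size (arranged p sl sb b) = count (fun i => @key n I d sl sb i == b) (iota 0 n).
Proof.
rewrite size_map size_filter -val_enum_ord count_map; apply: eq_count => j /=.
by rewrite /key !extE.
Qed.

Lemma arranged_binned n d M (p : 'S_n) (sg : {ffun 'I_n -> 'I_M}) (bt : {ffun 'I_n -> 'I_d}) :
  arranged p [ffun j => sg (p j)] [ffun j => bt (p j)] =1 binned [seq p j | j <- enum 'I_n] sg bt.
Proof.
move=> b; rewrite /arranged /binned /bins [RHS]filter_map; apply: (congr1 (map p)).
by apply: eq_filter => j /=; rewrite !ffunE.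
Qed.

Lemma sum_ffun_perm (R : realType) (n : nat) (B : finType) (p : 'S_n) (H : {ffun 'I_n -> B} -> R) :
  \sum_g H g = \sum_(g : {ffun 'I_n -> B}) H [ffun j => g (p j)].
Proof.
rewrite (reindex_inj (h := fun g : {ffun 'I_n -> B} => [ffun j => g (p j)])) //=.
move=> g g' /ffunP e; apply/ffunP => x.
by have := e ((p^-1)%g x); rewrite !ffunE permKV.
Qed.

Section Guarantee.
Variables (R : realType) (n d : nat) (I : {set {set 'I_n}}) (f : {set 'I_n} -> R).
Hypotheses (matI : is_matroid I) (f_ge0 : nonnegative f) (f_mono : monotone f) (f_sub : submodular f).
Hypotheses (rk_gt0 : (0 < rk I)%N) (d5 : (5 <= d)%N).
Let k := rk I.
Let M := ((d * d + d) * k)%N.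
Let cap := (M * d.+1 * d)%N.
Notation slots := {ffun 'I_n -> 'I_M}.
Notation subs := {ffun 'I_n -> 'I_d}.
Notation recs := {ffun 'I_M -> 'I_M}.

Let E : R := (expR 1 ^+ 2)^-1 * expR (4 / d.+1%:R).
Let ratio : R := (1 - 2 * d%:R^-1) * (1 - E).

Lemma decay_le1 : E <= 1.
Proof.
rewrite /E -[expR 1 ^+ 2]expRM_natl -expRN -expRD -[leRHS]expR0 ler_expR.
have d5R : 5 <= (d%:R : R) by rewrite ler_nat.
have : 4 / (d.+1%:R : R) <= 1 by rewrite ler_pdivrMr -natr1; lra.
by rewrite mulr1; set z := 4 / _; move=> h; rewrite addrC subr_le0 (le_trans h) // ler1n.
Qed.

Lemma opt_basis : exists A : {set 'I_n}, [/\ A \in I, #|A| = k & opt I f <= f A].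
Proof.
have [S SI oS] : exists2 S, S \in I & opt I f <= f S.
  have [||S SP eS] := @Order.TotalTheory.eq_bigmax _ R _ (0 : R) (set0 : {set 'I_n})
    (fun S : {set 'I_n} => (S \in I) && (S \subset [set: 'I_n])) f.
  - by rewrite indep0 ?sub0set.
  - by move=> S _; exact: f_ge0.
  exists S; last by rewrite /opt /best eS.
  by case/andP: SP.
have [A [AI sA cA]] := basis_extend matI SI.
by exists A; split=> //; apply: le_trans oS _; exact: f_mono.
Qed.

Lemma fixed_order_value (p : 'S_n) :
  (#|{: slots}| * #|{: subs}| * #|{: recs}|)%:R * (2^-1 * ratio * opt I f) <=
  \sum_(sl : slots) \sum_(sb : subs) \sum_(r : recs)
     best I f (shortlisted cap (accepted_at I f k d (arranged p sl sb) (ext r) M)).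
Proof.
have d0 : (0 < d)%N by lia.
have [A [AI cA oA]] := opt_basis.
pose ord := [seq p j | j <- enum 'I_n].
have ord_uniq : uniq ord by rewrite map_inj_uniq ?enum_uniq //; exact: perm_inj.
have ord_all x : x \in ord.
  by apply/mapP; exists ((p^-1)%g x); rewrite ?mem_enum ?permKV.
have m2 : (2 <= M)%N.
  by rewrite /M; apply: leq_trans (leq_pmulr _ rk_gt0); nia.
have M0 : (0 < M)%N by lia.
(* Reindexing by [p] turns bins drawn for labels into bins drawn for items, with the order inside
   the bins fixed. *)
rewrite (sum_ffun_perm p).
under eq_bigr => sl _ do rewrite (sum_ffun_perm p).
pose out (sg : slots) (bt : subs) (r : recs) : R := best I f (shortlisted cap (accepted_at I f k d (binned ord sg bt) (ext r) M)).
apply: le_trans (_ : \sum_(sg : slots) \sum_(bt : subs) \sum_(r : recs) out sg bt r <= _); last first.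
  apply: ler_sum => sg _; apply: ler_sum => bt _; apply: ler_sum => r _.
  by rewrite /out /accepted_at (run_ext _ _ _ _ _ _ (arranged_binned p sg bt)).
pose value (sg : slots) (bt : subs) (r : recs) : R := f (contents k (cells_at I f k d (binned ord sg bt) (ext r) M)).
apply: le_trans (_ : (1 - 2 * d%:R^-1) * \sum_(sg : slots) \sum_(r : recs) \sum_(bt : subs) value sg bt r <= _); last first.
  under [leRHS]eq_bigr => sg _ do rewrite exchange_big /=.
  rewrite mulr_sumr; apply: ler_sum => sg _; rewrite mulr_sumr; apply: ler_sum => r _.
  exact: (expected_shortlist k matI f_ge0 f_mono f_sub d0 ord_uniq ord_all sg r M0).
have d5R : 5 <= (d%:R : R) by rewrite ler_nat.
have q0 : 0 <= 1 - 2 * (d%:R : R)^-1 by rewrite subr_ge0 ler_pdivrMr; lra.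
rewrite (_ : _ * (_ * _) = (1 - 2 * d%:R^-1) * ((#|{: slots}| * #|{: subs}| * #|{: recs}|)%:R * (2^-1 * (1 - E) * opt I f))); last first.
  by rewrite /ratio; ring.
apply: ler_wpM2l => //.
under [leRHS]eq_bigr => sg _ do rewrite exchange_big /=.
rewrite [leRHS]exchange_big /=.
apply: le_trans (_ : \sum_(bt : subs) (#|{: slots}| * #|{: recs}|)%:R * (f A / 2 * (1 - E)) <= _).
  rewrite sumr_const -[leRHS]mulr_natl.
  rewrite (_ : (#|{: slots}| * #|{: subs}| * #|{: recs}|)%:R =
    #|{: subs}|%:R * (#|{: slots}| * #|{: recs}|)%:R :> R); last by rewrite -natrM mulnCA mulnA.
  rewrite -[leLHS]mulrA; apply: ler_wpM2l => //; apply: ler_wpM2l => //.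
  rewrite mulrAC ler_wpM2r ?subr_ge0 ?decay_le1 // mulrC ler_wpM2r ?invr_ge0 //.
apply: ler_sum => bt _.
(* Here [b] is [d]: the first [d * d * k] slots make progress, and the remaining [d * k] are the
   slack against collisions. *)
have := expected_value matI erefl f_ge0 f_mono f_sub d0 ord_uniq ord_all bt AI cA d0 rk_gt0 m2
  (i0 := (d * d * k)%N).
have -> : (d * d * k + d * k)%N = M by rewrite /M mulnDl.
move=> /(_ (leqnn _)) /=; apply: le_trans.
have -> : \sum_(sg : slots) \sum_(r : recs) 1 = (#|{: slots}| * #|{: recs}|)%:R :> R.
  by rewrite !sumr_const natrM mulr_natl.
rewrite ler_wpM2l // ler_wpM2l ?divr_ge0 // lerD2l lerN2.
exact: decay_le.
Qed.

End Guarantee.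

(** * The guarantee *)

Lemma rk_le n (I : {set {set 'I_n}}) : (rk I <= n)%N.
Proof. by apply/bigmax_leqP => S _; rewrite -[X in (_ <= X)%N]card_ord max_card. Qed.

Definition time_factor (d : nat) : nat :=
  (2 * (2 + (d * d + d) + d.+1 * d) + 10 * (d * d + d) + (2 * d + 16) +
   (162 + 21 * d) * (d * d + d) + 300)%N.

(** Evaluating a recycled winner in each of the [M] slots costs a term quadratic in [k]; it is
    absorbed because the rank is at most [n]. *)
Lemma time_bound (d n k : nat) : (0 < k <= n)%N ->
  let M := ((d * d + d) * k)%N in
  ((2 * (2 + (d * d + d) + d.+1 * d)).+2 + (10 * n + 8) + (10 * n + 8) + (10 * M + 8) +
     ((2 * d + 16) * n + 8) + ((41 * k + 81) * n + (41 * k + 21 * d + 121) * M + 9) <=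
   time_factor d * n * k)%N.
Proof.
move=> /andP[k0 kn] /=; rewrite /time_factor -mulnA.
set e := (d * d + d)%N; set g := (2 + e + d.+1 * d)%N; set P := (n * k)%N.
have P1 : (1 <= P)%N by rewrite muln_gt0 k0 (leq_trans k0 kn).
have nP : (n <= P)%N by rewrite leq_pmulr.
have kP : (k * k <= P)%N by rewrite leq_mul2r kn orbT.
have kP' : (k <= P)%N by apply: leq_trans nP.
have h1 : (e * k <= e * P)%N by rewrite leq_mul2l kP' orbT.
have h2 : (k * (e * k) <= e * P)%N by rewrite mulnCA leq_mul2l kP orbT.
have h3 : (d * (e * k) <= d * (e * P))%N by rewrite leq_mul2l h1 orbT.
have h4 : (d * n <= d * P)%N by rewrite leq_mul2l nP orbT.
have h5 : (g <= g * P)%N by rewrite leq_pmulr.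
have h6 : (k * n = P)%N by rewrite mulnC.
clearbody e g P; nia.
Qed.

Section AlgorithmValue.
Variables (R : realType) (n d : nat) (I : {set {set 'I_n}}) (f : {set 'I_n} -> R).
Hypotheses (matI : is_matroid I) (f_ge0 : nonnegative f) (f_mono : monotone f) (f_sub : submodular f).
Hypotheses (rk_gt0 : (0 < rk I)%N) (d5 : (5 <= d)%N).
Let k := rk I.
Let M := ((d * d + d) * k)%N.
Let cap := (M * d.+1 * d)%N.
Notation slots := {ffun 'I_n -> 'I_M}.
Notation subs := {ffun 'I_n -> 'I_d}.
Notation recs := {ffun 'I_M -> 'I_M}.
Let N := (time_factor d * n * k)%N.

Definition arrangement (s : 'S_n) (sl : slots) (sb : subs) : nat -> seq 'I_n :=
  arranged (rank_perm sl sb * s) sl sb.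

Definition order_value (s : 'S_n) : R :=
  average (fun sl : slots => average (fun sb : subs => average (fun r : recs =>
    @outcome R n I f d (arrangement s) sl sb r))).

Lemma alg_outcomes s :
  all (fun o => halted o.2 && (#|shortlist o.2| <= cap)%N)
    (outcomes I f s N (start R I (shortlist_alg d))) /\
  order_value s <= \sum_(o <- outcomes I f s N (start R I (shortlist_alg d)))
     o.1 * best I f (shortlist o.2).
Proof.
have d0 : (0 < d)%N by lia.
apply: (@alg_good R n I f s d matI f_ge0 f_mono d0 rk_gt0 (arrangement s)).
- by move=> sl sb b _; exact: arranged_size.
- by move=> sl sb b bM; exact: arranged_pos.
- by move=> sl sb; exact: arranged_total.
by apply: time_bound; rewrite rk_gt0 rk_le.
Qed.

Lemma sum_order_value :
  (n`!)%:R * (2^-1 * ((1 - 2 * d%:R^-1) * (1 - (expR 1 ^+ 2)^-1 * expR (4 / d.+1%:R))) * opt I f)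
    <= \sum_s order_value s.
Proof.
set X := 2^-1 * _ * _.
have M0 : (0 < M)%N by rewrite /M muln_gt0 rk_gt0 addn_gt0 muln_gt0; lia.
have card_pos a b : (0 < b)%N -> 0 < (#|{: {ffun 'I_a -> 'I_b}}|%:R : R).
  move=> b0; rewrite ltr0n; apply/card_gt0P; by exists [ffun=> Ordinal b0].
set C := (#|{: slots}| * #|{: subs}| * #|{: recs}|)%N.
have C0 : 0 < (C%:R : R) by rewrite !natrM !mulr_gt0 ?card_pos //; lia.
pose out p sl sb r := best I f (shortlisted cap (accepted_at I f k d (@arranged n d M p sl sb) (@ext M M r) M)).
have E s : order_value s = C%:R^-1 *
    \sum_(sl : slots) \sum_(sb : subs) \sum_(r : recs) out (rank_perm sl sb * s)%g sl sb r.
  rewrite /order_value /average.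
  under eq_bigr => sl _ do rewrite -mulr_suml.
  by rewrite -!mulr_suml /C !natrM !invfM mulrC; ring.
rewrite (eq_bigr _ (fun s _ => E s)) -mulr_sumr exchange_big /=.
under eq_bigr => sl _ do rewrite exchange_big /=.
under eq_bigr => sl _ do under eq_bigr => sb _ do rewrite exchange_big /=.
(* For fixed draws, composing with the sorting permutation is a bijection of the arrival orders, so
   the item order becomes independent of the bins. *)
have E2 (sl : slots) (sb : subs) (r : recs) :
    \sum_(s : 'S_n) out (rank_perm sl sb * s)%g sl sb r = \sum_(p : 'S_n) out p sl sb r.
  by rewrite [RHS](reindex_inj (mulgI (rank_perm sl sb))).
under eq_bigr => sl _ do under eq_bigr => sb _ do under eq_bigr => r _ do rewrite E2.
under eq_bigr => sl _ do under eq_bigr => sb _ do rewrite exchange_big /=.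
under eq_bigr => sl _ do rewrite exchange_big /=.
rewrite exchange_big /= -(ler_pM2l C0) mulVKf ?gt_eqF //.
rewrite (_ : n`! = #|{: 'S_n}|); last by rewrite card_Sn.
rewrite mulr_natl mulrnAr -sumr_const.
by apply: ler_sum => p _; exact: fixed_order_value.
Qed.

End AlgorithmValue.

Theorem theorem1 (R : realType) :
  exists (p : {poly R}) (K : R),
  forall eps : R, 0 < eps ->
  exists (alg : cmd) (eta : nat -> nat) (C : R) (D : nat),
    (forall k : nat, (0 < k)%N ->
       (eta k)%:R <= K * (2 `^ p.[eps^-1]) * k%:R) /\
    (forall (n k : nat) (I : {set {set 'I_n}}) (f : {set 'I_n} -> R),
       (0 < k)%N -> is_matroid I -> rk I = k ->
       nonnegative f -> monotone f -> submodular f ->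
       achieves I f alg (D * n * k)%N
         (2^-1 * (1 - 1 / expR 1 ^+ 2 - eps - C / k%:R)) (eta k)).
Proof.
exists (8 *: 'X), (8 ^+ 4) => eps e0.
(* The summand 5 makes [d - 3] exceed [8 / eps], as [ratio_ge] requires, while [d] stays below
   [8 / eps + 7] for [cap_le]. *)
pose d := (Num.truncn (8 / eps) + 5)%N.
have i0 : 0 <= 8 / eps by rewrite divr_ge0 // ltW.
have /andP[d_le d_gt] := truncn_itv i0.
have d5 : (5 <= d)%N by rewrite leq_addl.
have dE : (d%:R : R) = (Num.truncn (8 / eps))%:R + 5 by rewrite natrD.
(* The constant of the O(1/k) term is 0: the bound holds with no loss depending on [k]. *)
exists (shortlist_alg d), (fun k => (d * d + d) * k * d.+1 * d)%N, 0, (time_factor d); split.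
  move=> k k0; rewrite (_ : (d * d + d) * k * d.+1 * d = (d * d + d) * d.+1 * d * k)%N; last by lia.
  rewrite natrM ler_wpM2r //; rewrite hornerZ hornerX; apply: cap_le; first by rewrite invr_ge0 ltW.
  by rewrite dE; lra.
move=> n k I f k0 matI rkI f_ge0 f_mono f_sub; subst k.
have ao := alg_outcomes matI f_ge0 f_mono k0 d5.
split.
- by move=> s; have [h _] := ao s; apply: sub_all h => o /andP[].
- by move=> s; have [h _] := ao s; apply: sub_all h => o /andP[].
rewrite /alg_value ler_pdivlMr ?ltr0n ?fact_gt0 //.
apply: le_trans (ler_sum _ (fun s _ => (ao s).2)).
apply: le_trans (sum_order_value matI f_ge0 f_mono f_sub k0 d5).
rewrite mulrC ler_wpM2l // mul0r subr0 -!mulrA ler_wpM2l ?invr_ge0 // mulrA.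
apply: ler_wpM2r; first exact: best_ge0.
apply: ratio_ge => //; rewrite dE; move: d_gt; rewrite -natr1; lra.
Qed.
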